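(* Let $f:\mathbb{D}\to\mathbb{D}$ be a holomorphic function, let $\xi\in\partial\mathbb{D}$, and let $B$ be a maximal Blaschke product for $f$. Assume further that $$\liminf_{z\to\xi}\frac{1-|B(z)|}{1-|z|}\in(0,\infty).$$ If there is a sequence $(z_n)\subseteq\mathbb{D}$ such that $z_n\to\xi$ non-tangentially as $n\to\infty$ and $$f(z_n)=B(z_n)+o\big(|\xi-z_n|^3\big)\quad\text{as }n\to\infty,$$ then $f(z)=B(z)$ for all $z\in\mathbb{D}$.
   Context: $\mathbb{D}=\{z\in\mathbb{C}: |z|<1\}$ is the open unit disk. Critical points: a point $z\in\mathbb{D}$ is a critical point of multiplicity $m$ of a holomorphic $f:\mathbb{D}\to\mathbb{D}$ if it is a zero of multiplicity $m$ of $f'$. $\mathcal{C}_f$ denotes the collection of critical points of $f$ counting multiplicities. ''$\mathcal{C}_B$ is a subcollection of $\mathcal{C}_f$'' means that every critical point of $B$ is a critical point of $f$ with at least the same multiplicity. Maximal Blaschke product (MBP): let $f:\mathbb{D}\to\mathbb{D}$ be holomorphic. A (finite or infinite) Blaschke product $B$, regarded as a holomorphic self-map of $\mathbb{D}$, is called a maximal Blaschke product for $f$ if $\mathcal{C}_B$ is a subcollection of $\mathcal{C}_f$ and $$\frac{|g'(z)|}{1-|g(z)|^2}\le\frac{|B'(z)|}{1-|B(z)|^2}\qquad\text{for all }z\in\mathbb{D}$$ for every holomorphic function $g:\mathbb{D}\to\mathbb{D}$ such that $\mathcal{C}_B$ is also a subcollection of $\mathcal{C}_g$. Non-tangential convergence: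 let $d_{\mathbb{D}}(z,w)=2\tanh^{-1}\left|\frac{z-w}{1-\overline{z}w}\right|$ be the hyperbolic distance, and for $m>0$ let $S(m,\xi)=\{z\in\mathbb{D}: d_{\mathbb{D}}(z,(\xi,-\xi)_h)<m\}$, where $(\xi,-\xi)_h$ is the hyperbolic geodesic line with end points $\xi$ and $-\xi$ (the diameter $\{t\xi:-1<t<1\}$). A sequence $(z_n)\subseteq\mathbb{D}$ converges to $\xi$ non-tangentially if $z_n\to\xi$ and there is $m>0$ such that $z_n\in S(m,\xi)$ for all sufficiently large $n$. *)

(* Defs.v *)
(* Stdlib real numbers, with Coquelicot for complex analysis. *)
From Stdlib Require Export Reals List.
From Coquelicot Require Export Coquelicot.
Open Scope R_scope.

Definition in_disk (z : C) : Prop := Cmod z < 1.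

Definition on_circle (xi : C) : Prop := Cmod xi = 1.

(* Functions on the disk are represented by total functions C -> C; their values
   off the disk are never constrained or used.  As the disk is open,
   differentiability and [C_derive] at a point of the disk only depend on values
   inside the disk. *)
Definition holomorphic_on_disk (f : C -> C) : Prop :=
  forall z, in_disk z -> @ex_derive C_AbsRing C_NormedModule f z.

Definition holomorphic_self_map (f : C -> C) : Prop :=
  holomorphic_on_disk f /\ forall z, in_disk z -> in_disk (f z).

Definition zero_of_multiplicity (F : C -> C) (z : C) (m : nat) : Prop :=
  (1 <= m)%nat /\
  exists h : C -> C, holomorphic_on_disk h /\
    (forall w, in_disk w -> F w = ((w - z) ^ m * h w)%C) /\
    h z <> RtoC 0.

(* No condition on [h z]: a function vanishing identically on the disk has at
   every point a zero of multiplicity at least [m], for all [m]. *)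
Definition zero_of_multiplicity_at_least (F : C -> C) (z : C) (m : nat) : Prop :=
  exists h : C -> C, holomorphic_on_disk h /\
    (forall w, in_disk w -> F w = ((w - z) ^ m * h w)%C).

Definition critical_point (f : C -> C) (z : C) (m : nat) : Prop :=
  in_disk z /\ zero_of_multiplicity (C_derive f) z m.

Definition critical_point_at_least (f : C -> C) (z : C) (m : nat) : Prop :=
  in_disk z /\ zero_of_multiplicity_at_least (C_derive f) z m.

Definition critical_subcollection (B f : C -> C) : Prop :=
  forall z m, critical_point B z m -> critical_point_at_least f z m.

Definition blaschke_factor (a z : C) : C :=
  if Ceq_dec a 0 then z
  else (RtoC (Cmod a) / a * ((a - z) / (1 - Cconj a * z)))%C.

Definition blaschke_prod (l : list C) (z : C) : C :=
  fold_right (fun a p => (blaschke_factor a z * p)%C) (RtoC 1) l.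

Definition finite_blaschke_product (B : C -> C) : Prop :=
  exists (eta : C) (l : list C),
    on_circle eta /\ List.Forall in_disk l /\
    forall z, in_disk z -> B z = (eta * blaschke_prod l z)%C.

Definition infinite_blaschke_product (B : C -> C) : Prop :=
  exists (eta : C) (a : nat -> C),
    on_circle eta /\ (forall n, in_disk (a n)) /\
    ex_series (fun n => 1 - Cmod (a n)) /\
    forall z, in_disk z ->
      filterlim (fun n => (eta * blaschke_prod (map a (List.seq 0 n)) z)%C)
        eventually (locally (B z)).

Definition blaschke_product (B : C -> C) : Prop :=
  finite_blaschke_product B \/ infinite_blaschke_product B.

(* Requiring [B] to be a self-map of the disk excludes the empty products, which
   are unimodular constants. *)
Definition maximal_blaschke_product (f B : C -> C) : Prop :=
  blaschke_product B /\ holomorphic_self_map B /\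
  critical_subcollection B f /\
  forall g : C -> C, holomorphic_self_map g -> critical_subcollection B g ->
    forall z, in_disk z ->
      Cmod (C_derive g z) / (1 - Cmod (g z) ^ 2)
      <= Cmod (C_derive B z) / (1 - Cmod (B z) ^ 2).

(* liminf of phi(z) as z -> xi with z in the disk, as the supremum over r > 0 of
   the infimum of phi over the points of the disk at distance < r from xi. *)
Definition LimInf_disk (phi : C -> R) (xi : C) : Rbar :=
  Rbar_lub (fun l : Rbar => exists r : posreal,
    l = Glb_Rbar (fun y : R => exists z : C,
          in_disk z /\ Cmod (z - xi) < r /\ y = phi z)).

Definition artanh (x : R) : R := / 2 * ln ((1 + x) / (1 - x)).

Definition hyp_dist (z w : C) : R :=
  2 * artanh (Cmod ((z - w) / (1 - Cconj z * w))).

Definition diameter (xi w : C) : Prop :=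
  exists t : R, -1 < t < 1 /\ w = (t * xi)%C.

Definition hyp_dist_to_set (z : C) (A : C -> Prop) : Rbar :=
  Glb_Rbar (fun y : R => exists w : C, A w /\ y = hyp_dist z w).

Definition hyp_sector (m : R) (xi z : C) : Prop :=
  in_disk z /\ Rbar_lt (hyp_dist_to_set z (diameter xi)) m.

Definition converges_nontangentially (z : nat -> C) (xi : C) : Prop :=
  filterlim z eventually (locally xi) /\
  exists m : R, 0 < m /\ eventually (fun n => hyp_sector m xi (z n)).

(* Main.v *)
Require Import Defs.
From Stdlib Require Import Lra Lia Psatz Classical ClassicalEpsilon.

(** The extremality of [B] enters only through the competitor [f] itself: the hyperbolic derivative
    of [f] is at most that of [B].  Let [A] bound the given lower limit.  A Julia-type argument
    produces a boundary value [eta] of [B] at [xi]; Cayley transforms sending [xi] and [eta] to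
    infinity turn [f] and [B] into self-maps [F] and [G] of the right half-plane with
    [|F'| / Re F <= |G'| / Re G], both asymptotic to [a w] in every sector, and the hypothesis
    becomes [F - G = o(1/|w|)] along a sequence tending to infinity in a sector.

    The quotient [U] of the two hyperbolic derivatives satisfies
    [Delta log U = (U^2 - 1) (|G'| / Re G)^2]; comparison with an explicit barrier shows that if
    [U < 1] at one point, then [1 - U] is at least a multiple of [1/|w|^2] in sectors.  The gradient
    of [log (Re G)] has modulus [|G'| / Re G], so [log (Re F / Re G)] decreases at a definite rate in
    the direction of that gradient, which points to infinity.  As [log (Re F / Re G)] tends to [0],
    it is at least a multiple of [1/|w|^2], contradicting [F - G = o(1/|w|)].  Hence [U = 1], the same
    comparison in both directions gives [Re F = Re G] far out in a sector, and [F = G] follows from the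
    hypothesis and the identity principle. *)

(** In the half-plane the exponents can be read off. Since [|xi - z|] is of order [1/|w|], as is
    [|eta - B|], and [F - G = 2 eta (f - B) / ((eta - f) (eta - B))], an error [o(|xi - z|^3)] in
    the disk becomes [o(1/|w|)]. On the other side, a deficit [1 - U] of order [1/|w|^2] times
    [|G'| / Re G], of order [1/|w|], is a rate [1/|w|^3]; it accumulates to [1/|w|^2] for the
    logarithm and, after multiplication by [Re G], to [1/|w|] for [Re F - Re G]. The two orders meet
    exactly, whence the exponent 3.

    The obstacle is the critical points of [B], where the quotient [U] reads 0/0. The condition on
    critical points yields a holomorphic [h] with [f' = h B'], and [U] is written through [h], so
    that [log U] has a Laplacian wherever [h] does not vanish. No gradient curve is integrated: the
    decrease of the logarithm is used only at a minimum over a truncated cone, and Laplacians only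
    at local maxima. These Laplacians call for second derivatives of holomorphic functions, hence
    Goursat's theorem and Cauchy transforms. *)

Lemma Ceq (x y : C) : Re x = Re y -> Im x = Im y -> x = y.
Proof. destruct x, y; simpl; intros; subst; reflexivity. Qed.

Lemma Cmod_sq (z : C) : Cmod z ^ 2 = Re z ^ 2 + Im z ^ 2.
Proof. apply Cmod2_alt. Qed.

Lemma Cmod_le_abs (z : C) : Cmod z <= Rabs (Re z) + Rabs (Im z).
Proof.
  pose proof (Cmod_sq z) as H. pose proof (Cmod_ge_0 z).
  pose proof (Rabs_pos (Re z)). pose proof (Rabs_pos (Im z)).
  rewrite <- (pow2_abs (Re z)), <- (pow2_abs (Im z)) in H. nra.
Qed.

Lemma im_le_Cmod (z : C) : Rabs (Im z) <= Cmod z.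
Proof. eapply Rle_trans; [|apply Rmax_Cmod]. apply Rmax_r. Qed.

Lemma Cmod_minus_sym (x y : C) : Cmod (x - y) = Cmod (y - x).
Proof. rewrite <- Cmod_opp. f_equal. ring. Qed.

Lemma Cmod_tri_sub (x y z : C) : Cmod (x - z) <= Cmod (x - y) + Cmod (y - z).
Proof. replace (x - z)%C with ((x - y) + (y - z))%C by ring. apply Cmod_triangle. Qed.

Lemma Cmod_rev (x y : C) : Cmod x - Cmod y <= Cmod (x - y).
Proof.
  pose proof (Cmod_triangle (x - y) y). replace (x - y + y)%C with x in H by ring. lra.
Qed.

Lemma Cmult_neq (x y : C) : x <> 0 -> y <> 0 -> (x * y)%C <> 0.
Proof.
  intros Hx Hy E. apply (f_equal Cmod) in E. rewrite Cmod_mult, Cmod_0 in E.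
  apply Cmod_gt_0 in Hx. apply Cmod_gt_0 in Hy. nra.
Qed.

Lemma Cminus_neq (x y : C) : x <> y -> (x - y)%C <> 0.
Proof. intros H E. apply H. replace x with (x - y + y)%C by ring. rewrite E. ring. Qed.

Lemma Re_Cdiv_sq (x y : C) : y <> 0 -> Re (x / y) = Re (x * Cconj y) / Cmod y ^ 2.
Proof.
  intros Hy. rewrite Cmod_sq.
  assert (0 < Re y ^ 2 + Im y ^ 2).
  { rewrite <- Cmod_sq. apply Cmod_gt_0 in Hy. nra. }
  destruct x, y; simpl in *. field. lra.
Qed.

Lemma Rdiv_mul (a b : R) : b <> 0 -> a / b * b = a.
Proof. intros. field. auto. Qed.

(** * Continuity of maps into C *)

Notation CU := C_UniformSpace.
Notation RU := R_UniformSpace.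

(** The uniform structure of C is the product one, whose balls are squares; this lemma and
    [continuous_C_CU] translate it to discs of [Cmod], at the cost of a factor [sqrt 2]. *)
Lemma continuous_C_RU (f : CU -> RU) (z : C) :
  continuous f z <-> forall eps, 0 < eps -> exists del, 0 < del /\
    forall w, Cmod (w - z) < del -> Rabs (f w - f z) < eps.
Proof.
  split.
  - intros H eps He.
    assert (He' : locally (f z) (fun y => Rabs (y - f z) < eps)).
    { exists (mkposreal eps He). intros y Hy. exact Hy. }
    destruct (H _ He') as [d Hd]. exists d. split; [apply cond_pos|].
    intros w Hw. apply Hd. apply C_NormedModule_mixin_compat1. exact Hw.
  - intros H P [eps HP]. destruct (H eps (cond_pos eps)) as [d [Hd Hw]].
    assert (Hs : 0 < d / sqrt 2) by (apply Rdiv_lt_0_compat; [lra|apply sqrt_lt_R0; lra]).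
    exists (mkposreal _ Hs). intros w Hb. apply HP. apply Hw.
    eapply Rlt_le_trans; [apply (C_NormedModule_mixin_compat2 z w (mkposreal _ Hs)); exact Hb|].
    simpl. assert (0 < sqrt 2) by (apply sqrt_lt_R0; lra). right. field. lra.
Qed.

Section ContinuityC.
Context {U : UniformSpace}.

Lemma continuous_pairC (f g : U -> RU) (x : U) :
  continuous f x -> continuous g x -> continuous (fun u => (f u, g u) : CU) x.
Proof.
  intros Hf Hg P [eps HP].
  assert (H1 : locally (f x) (ball (f x) eps)) by (exists eps; auto).
  assert (H2 : locally (g x) (ball (g x) eps)) by (exists eps; auto).
  specialize (Hf _ H1). specialize (Hg _ H2). unfold filtermap in *.
  generalize (filter_and _ _ Hf Hg). apply filter_imp.
  intros u [A B]. apply HP. split; assumption.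
Qed.

Lemma continuous_Re (f : U -> CU) (x : U) : continuous f x -> continuous (fun u => Re (f u)) x.
Proof. intros H. apply (continuous_comp f (fun z : CU => fst z : RU)); auto. apply continuous_fst. Qed.

Lemma continuous_Im (f : U -> CU) (x : U) : continuous f x -> continuous (fun u => Im (f u)) x.
Proof. intros H. apply (continuous_comp f (fun z : CU => snd z : RU)); auto. apply continuous_snd. Qed.

Lemma continuous_Rplus (f g : U -> RU) (x : U) :
  continuous f x -> continuous g x -> continuous (fun u => f u + g u) x.
Proof. intros; apply (continuous_plus (V := R_NormedModule)); auto. Qed.

Lemma continuous_Ropp (f : U -> RU) (x : U) :
  continuous f x -> continuous (fun u => - f u) x.
Proof. intros; apply (continuous_opp (V := R_NormedModule)); auto. Qed.

Lemma continuous_Rminus (f g : U -> RU) (x : U) :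
  continuous f x -> continuous g x -> continuous (fun u => f u - g u) x.
Proof. intros; apply (continuous_minus (V := R_NormedModule)); auto. Qed.

Lemma continuous_Rmult (f g : U -> RU) (x : U) :
  continuous f x -> continuous g x -> continuous (fun u => f u * g u) x.
Proof. intros; apply (continuous_mult (K := R_AbsRing)); auto. Qed.

Lemma continuous_Rfun (h : R -> R) (f : U -> RU) (x : U) :
  continuity_pt h (f x) -> continuous f x -> continuous (fun u => h (f u)) x.
Proof.
  intros Hh Hf. apply (continuous_comp f (h : RU -> RU)); auto.
  apply continuity_pt_filterlim. exact Hh.
Qed.

Lemma continuous_Rinv (f : U -> RU) (x : U) :
  f x <> 0 -> continuous f x -> continuous (fun u => / f u) x.
Proof.
  intros. apply (continuous_Rfun Rinv); auto.
  apply (continuity_pt_inv id); auto. apply derivable_continuous_pt, derivable_pt_id.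
Qed.

Lemma continuous_Rexp (f : U -> RU) (x : U) :
  continuous f x -> continuous (fun u => exp (f u)) x.
Proof.
  intros. apply (continuous_Rfun exp); auto. apply derivable_continuous_pt, derivable_pt_exp.
Qed.

Lemma continuous_Rln (f : U -> RU) (x : U) :
  0 < f x -> continuous f x -> continuous (fun u => ln (f u)) x.
Proof.
  intros. apply (continuous_Rfun ln); auto. apply continuity_pt_filterlim.
  apply continuous_ln. auto.
Qed.

Lemma continuous_Rpow (f : U -> RU) (n : nat) (x : U) :
  continuous f x -> continuous (fun u => f u ^ n) x.
Proof.
  intros Hf. induction n; simpl; [apply continuous_const|]. apply continuous_Rmult; auto.
Qed.

Lemma continuous_RtoC (f : U -> RU) (x : U) : continuous f x -> continuous (fun u => RtoC (f u) : CU) x.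
Proof. intros. apply continuous_pairC; auto. apply continuous_const. Qed.

Lemma continuous_Cplus (f g : U -> CU) (x : U) :
  continuous f x -> continuous g x -> continuous (fun u => (f u + g u)%C : CU) x.
Proof.
  intros Hf Hg.
  exact (continuous_pairC _ _ x
    (continuous_Rplus _ _ x (continuous_Re f x Hf) (continuous_Re g x Hg))
    (continuous_Rplus _ _ x (continuous_Im f x Hf) (continuous_Im g x Hg))).
Qed.

Lemma continuous_Copp (f : U -> CU) (x : U) :
  continuous f x -> continuous (fun u => (- f u)%C : CU) x.
Proof.
  intros Hf.
  exact (continuous_pairC _ _ x
    (continuous_Ropp _ x (continuous_Re f x Hf)) (continuous_Ropp _ x (continuous_Im f x Hf))).
Qed.

Lemma continuous_Cminus (f g : U -> CU) (x : U) :
  continuous f x -> continuous g x -> continuous (fun u => (f u - g u)%C : CU) x.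
Proof. intros. apply continuous_Cplus; auto. apply continuous_Copp; auto. Qed.

Lemma continuous_Cmult (f g : U -> CU) (x : U) :
  continuous f x -> continuous g x -> continuous (fun u => (f u * g u)%C : CU) x.
Proof.
  intros Hf Hg.
  pose proof (continuous_Re f x Hf). pose proof (continuous_Im f x Hf).
  pose proof (continuous_Re g x Hg). pose proof (continuous_Im g x Hg).
  exact (continuous_pairC _ _ x
    (continuous_Rminus _ _ x (continuous_Rmult (fun u => Re (f u)) (fun u => Re (g u)) x ltac:(assumption) ltac:(assumption))
      (continuous_Rmult (fun u => Im (f u)) (fun u => Im (g u)) x ltac:(assumption) ltac:(assumption)))
    (continuous_Rplus _ _ x (continuous_Rmult (fun u => Re (f u)) (fun u => Im (g u)) x ltac:(assumption) ltac:(assumption))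
      (continuous_Rmult (fun u => Im (f u)) (fun u => Re (g u)) x ltac:(assumption) ltac:(assumption)))).
Qed.

Lemma continuous_Cmod (f : U -> CU) (x : U) :
  continuous f x -> continuous (fun u => Cmod (f u)) x.
Proof.
  intros. apply (continuous_comp f (Cmod : CU -> RU)); auto.
  apply continuous_C_RU. intros eps He. exists eps. split; auto.
  intros w Hw. pose proof (Cmod_rev w (f x)). pose proof (Cmod_rev (f x) w).
  rewrite (Cmod_minus_sym (f x) w) in *. apply Rabs_def1; lra.
Qed.

Lemma continuous_Cinv (f : U -> CU) (x : U) :
  f x <> RtoC 0 -> continuous f x -> continuous (fun u => (/ f u)%C : CU) x.
Proof.
  intros Hn H.
  assert (Hs : fst (f x) ^ 2 + snd (f x) ^ 2 <> 0).
  { intro E. apply Hn. apply Cmod_eq_0. unfold Cmod. rewrite E. apply sqrt_0. }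
  pose proof (continuous_Re f x H) as H1. pose proof (continuous_Im f x H) as H2.
  apply continuous_pairC; apply continuous_Rmult; auto.
  - apply (continuous_Rinv (fun u => fst (f u) ^ 2 + snd (f u) ^ 2)); auto.
    apply continuous_Rplus; apply continuous_Rpow; auto.
  - apply continuous_Ropp; auto.
  - apply (continuous_Rinv (fun u => fst (f u) ^ 2 + snd (f u) ^ 2)); auto.
    apply continuous_Rplus; apply continuous_Rpow; auto.
Qed.

Lemma continuous_Cdiv (f g : U -> CU) (x : U) :
  g x <> RtoC 0 -> continuous f x -> continuous g x -> continuous (fun u => (f u / g u)%C : CU) x.
Proof. intros. apply continuous_Cmult; auto. apply continuous_Cinv; auto. Qed.

Lemma continuous_Cpow (f : U -> CU) (n : nat) (x : U) :
  continuous f x -> continuous (fun u => (f u ^ n)%C : CU) x.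
Proof.
  intros Hf. induction n; simpl; [apply continuous_const|]. apply continuous_Cmult; auto.
Qed.

End ContinuityC.

Lemma continuous_Cid z : continuous (fun w : CU => w : CU) z.
Proof. apply continuous_id. Qed.

Ltac cont := repeat match goal with
  | H : continuous ?f ?x |- continuous ?f ?x => exact H
  | H : forall x, continuous ?f x |- continuous ?f _ => apply H
  | |- continuous (fun _ => ?c) _ => apply continuous_const
  | |- continuous (fun x => x) _ => apply continuous_id
  | |- continuous (fun x => Cmod (@?f x)) _ => apply continuous_Cmod
  | |- continuous (fun x => Re (@?f x)) _ => apply continuous_Re
  | |- continuous (fun x => Im (@?f x)) _ => apply continuous_Im
  | |- continuous (fun x => Rplus (@?f x) (@?g x)) _ => apply (continuous_Rplus f g)
  | |- continuous (fun x => Rminus (@?f x) (@?g x)) _ => apply (continuous_Rminus f g)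
  | |- continuous (fun x => Rmult (@?f x) (@?g x)) _ => apply (continuous_Rmult f g)
  | |- continuous (fun x => Ropp (@?f x)) _ => apply (continuous_Ropp f)
  | |- continuous (fun x => pow (@?f x) _) _ => apply (continuous_Rpow f)
  | |- continuous (fun x => RtoC (@?f x)) _ => apply (continuous_RtoC f)
  | |- continuous (fun x => Cplus (@?f x) (@?g x)) _ => apply (continuous_Cplus f g)
  | |- continuous (fun x => Cminus (@?f x) (@?g x)) _ => apply (continuous_Cminus f g)
  | |- continuous (fun x => Cmult (@?f x) (@?g x)) _ => apply (continuous_Cmult f g)
  | |- continuous (fun x => Copp (@?f x)) _ => apply (continuous_Copp f)
  end.

Lemma continuous_C_CU (f : CU -> CU) (z : C) :
  continuous f z <-> forall eps, 0 < eps -> exists del, 0 < del /\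
    forall w, Cmod (w - z) < del -> Cmod (f w - f z) < eps.
Proof.
  split.
  - intros H. 
    assert (Hc : continuous (fun w => Cmod (f w - f z) : RU) z).
    { cont. }
    intros eps He. destruct (proj1 (continuous_C_RU _ _) Hc eps He) as [d [Hd Hw]].
    exists d. split; auto. intros w Hw'. specialize (Hw w Hw').
    replace (f z - f z)%C with (RtoC 0) in Hw by ring. rewrite Cmod_0 in Hw.
    apply Rabs_def2 in Hw. lra.
  - intros H. 
    assert (HR : forall p : C -> R, (forall a b, Rabs (p a - p b) <= Cmod (a - b)) ->
       continuous (fun w : CU => p (f w) : RU) z).
    { intros p Hp. apply continuous_C_RU. intros eps He. destruct (H eps He) as [d [Hd Hw]].
      exists d. split; auto. intros w Hw'. eapply Rle_lt_trans; [apply Hp|auto]. }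
    apply (continuous_ext (fun w : CU => (Re (f w), Im (f w)) : CU)).
    { intros w. destruct (f w); reflexivity. }
    apply continuous_pairC; apply HR.
    + intros a b. apply (re_le_Cmod (a - b)%C).
    + intros a b. apply (im_le_Cmod (a - b)%C).
Qed.

Lemma lt_near (f g : C -> R) (z : C) : continuous (f : CU -> RU) z -> continuous (g : CU -> RU) z ->
  f z < g z -> exists d, 0 < d /\ forall w, Cmod (w - z) < d -> f w < g w.
Proof.
  intros Hf Hg L. pose proof (continuous_Rminus _ _ _ Hg Hf) as Hc.
  destruct (proj1 (continuous_C_RU _ _) Hc (g z - f z) ltac:(lra)) as [d [Hd Hw]].
  exists d. split; auto. intros w Hw'. specialize (Hw w Hw'). apply Rabs_def2 in Hw. lra.
Qed.

Lemma nonzero_near (f : C -> C) (z : C) : continuous (f : CU -> CU) z -> f z <> 0 ->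
  exists d, 0 < d /\ forall w, Cmod (w - z) < d -> f w <> 0.
Proof.
  intros Hf Hn. apply (Cmod_gt_0 (f z)) in Hn.
  destruct (lt_near (fun _ => 0) (fun w => Cmod (f w)) z) as [d [Hd Hw]]; auto; [cont..|].
  exists d. split; auto. intros w Hw'. apply (Cmod_gt_0 (f w)). auto.
Qed.

(** * Complex derivatives *)

(* Caratheodory's form of the derivative, which reduces the calculus rules to
   algebra and continuity. *)
Definition cderiv (f : C -> C) (z l : C) : Prop :=
  exists phi : C -> C, continuous (phi : CU -> CU) z /\ phi z = l /\
    forall w, f w = (f z + phi w * (w - z))%C.

Lemma cderiv_cont f z l : cderiv f z l -> continuous (f : CU -> CU) z.
Proof.
  intros [phi [Hc [_ H]]].
  apply (continuous_ext (fun w : CU => (f z + phi w * (w - z))%C : CU)).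
  { intros; symmetry; apply H. }
  cont.
Qed.

Lemma cderiv_eps f z l :
  cderiv f z l <-> forall eps, 0 < eps -> exists del, 0 < del /\
    forall w, Cmod (w - z) < del -> Cmod (f w - f z - l * (w - z)) <= eps * Cmod (w - z).
Proof.
  split.
  - intros [phi [Hc [Hl H]]] eps He.
    destruct (proj1 (continuous_C_CU _ _) Hc eps He) as [d [Hd Hw]].
    exists d. split; auto. intros w Hw'. rewrite (H w).
    replace (f z + phi w * (w - z) - f z - l * (w - z))%C with ((phi w - phi z) * (w - z))%C
      by (rewrite Hl; ring).
    rewrite Cmod_mult. apply Rmult_le_compat_r; [apply Cmod_ge_0|]. left. auto.
  - intros H. exists (fun w => if Ceq_dec w z then l else ((f w - f z) / (w - z))%C).
    split; [|split].
    + apply continuous_C_CU. intros eps He. destruct (H (eps/2)) as [d [Hd Hw]]; [lra|].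
      exists d. split; auto. intros w Hw'. specialize (Hw w Hw').
      destruct (Ceq_dec z z) as [_|n]; [|congruence].
      destruct (Ceq_dec w z) as [e|n].
      { replace (l - l)%C with (RtoC 0) by ring. rewrite Cmod_0. auto. }
      pose proof (Cminus_neq _ _ n) as n'.
      replace ((f w - f z) / (w - z) - l)%C with ((f w - f z - l * (w - z)) / (w - z))%C
        by (field; auto).
      rewrite Cmod_div by auto. apply Cmod_gt_0 in n'.
      apply Rle_lt_trans with (eps/2); [|lra].
      apply Rmult_le_reg_r with (Cmod (w - z)); auto. unfold Rdiv at 1.
      rewrite Rmult_assoc, Rinv_l, Rmult_1_r by lra. auto.
    + destruct (Ceq_dec z z); congruence.
    + intros w. destruct (Ceq_dec w z) as [e|n].
      * subst; ring.
      * field. apply Cminus_neq; auto.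
Qed.

Lemma is_derive_cderiv f z l : @is_derive C_AbsRing C_NormedModule f z l <-> cderiv f z l.
Proof.
  rewrite cderiv_eps. split.
  - intros [_ H] eps He. 
    specialize (H z (fun P HP => HP) (mkposreal eps He)). 
    destruct H as [d Hd]. exists d. split; [apply cond_pos|].
    intros w Hw. specialize (Hd w Hw). simpl in Hd.
    replace (l * (w - z))%C with ((w - z) * l)%C by ring. exact Hd.
  - intros H. split; [apply is_linear_scal_l|].
    intros x Hx. 
    assert (x = z). { symmetry. apply (is_filter_lim_locally_unique z x Hx). }
    subst x. intros [eps He]. destruct (H eps He) as [d [Hd Hw]].
    exists (mkposreal d Hd). intros w Hb. specialize (Hw w Hb).
    replace (l * (w - z))%C with ((w - z) * l)%C in Hw by ring. exact Hw.
Qed.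

Lemma C_derive_cderiv f z l : cderiv f z l -> C_derive f z = l.
Proof. intros. apply is_C_derive_unique. apply is_derive_cderiv. auto. Qed.

Lemma cderiv_ext_loc f g z l d : 0 < d -> (forall w, Cmod (w - z) < d -> f w = g w) ->
  cderiv f z l -> cderiv g z l.
Proof.
  rewrite !cderiv_eps. intros Hd E H eps He. destruct (H eps He) as [d' [Hd' Hw]].
  exists (Rmin d d'). split; [apply Rmin_glb_lt; auto|]. intros w Hw'.
  rewrite <- (E w), <- (E z).
  - apply Hw. eapply Rlt_le_trans; [apply Hw'|apply Rmin_r].
  - replace (z - z)%C with (RtoC 0) by ring. rewrite Cmod_0; auto.
  - eapply Rlt_le_trans; [apply Hw'|apply Rmin_l].
Qed.

Lemma cderiv_eq f z l l' : cderiv f z l -> l = l' -> cderiv f z l'.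
Proof. intros; subst; auto. Qed.

Lemma cderiv_const c z : cderiv (fun _ => c) z 0.
Proof. exists (fun _ => 0). repeat split; [apply continuous_const|]. intros; ring. Qed.

Lemma cderiv_id z : cderiv (fun w => w) z 1.
Proof. exists (fun _ => 1). repeat split; [apply continuous_const|]. intros; ring. Qed.

Lemma cderiv_plus f g z a b : cderiv f z a -> cderiv g z b -> cderiv (fun w => (f w + g w)%C) z (a + b).
Proof.
  intros [p [Hp [Ep H]]] [q [Hq [Eq' H']]]. exists (fun w => (p w + q w)%C).
  split; [apply continuous_Cplus; auto|split; [congruence|]].
  intros w. rewrite (H w), (H' w). ring.
Qed.

Lemma cderiv_opp f z a : cderiv f z a -> cderiv (fun w => (- f w)%C) z (- a).
Proof.
  intros [p [Hp [Ep H]]]. exists (fun w => (- p w)%C).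
  split; [apply continuous_Copp; auto|split; [congruence|]].
  intros w. rewrite (H w). ring.
Qed.

Lemma cderiv_minus f g z a b : cderiv f z a -> cderiv g z b -> cderiv (fun w => (f w - g w)%C) z (a - b).
Proof. intros. apply cderiv_plus; auto. apply cderiv_opp; auto. Qed.

Lemma cderiv_mult f g z a b : cderiv f z a -> cderiv g z b ->
  cderiv (fun w => (f w * g w)%C) z (a * g z + f z * b).
Proof.
  intros [p [Hp [Ep H]]] Hg. pose proof (cderiv_cont _ _ _ Hg) as Hgc. destruct Hg as [q [Hq [Eq' H']]].
  exists (fun w => (p w * g w + f z * q w)%C).
  split; [|split; [congruence|]].
  - apply continuous_Cplus; apply continuous_Cmult; auto. apply continuous_const.
  - intros w. rewrite (H w), (H' w). ring.
Qed.

Lemma cderiv_scal c f z a : cderiv f z a -> cderiv (fun w => (c * f w)%C) z (c * a).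
Proof.
  intros H. eapply cderiv_eq; [apply (cderiv_mult (fun _ => c) f); [apply cderiv_const|apply H]|]. ring.
Qed.

Lemma cderiv_inv (f : C -> C) z a : f z <> 0 -> cderiv f z a -> cderiv (fun w => (/ f w)%C) z (- a / (f z * f z)).
Proof.
  intros Hn Hf. pose proof (cderiv_cont _ _ _ Hf) as Hfc. destruct Hf as [p [Hp [Ep H]]].
  destruct (nonzero_near f z Hfc Hn) as [d [Hd Hnz]].
  (* Caratheodory's equation is demanded at every [w], but [f] may vanish away from [z]; so it is
     proved for an expression that agrees with [/ f] only near [z]. *)
  assert (K : cderiv (fun w => (/ f z + (- p w / (f w * f z)) * (w - z))%C) z (- a / (f z * f z))).
  { exists (fun w => (- p w / (f w * f z))%C). split; [|split].
    - apply continuous_Cdiv.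
      + apply Cmult_neq; auto.
      + apply continuous_Copp; auto.
      + apply continuous_Cmult; auto. apply continuous_const.
    - rewrite Ep. reflexivity.
    - intros w. ring. }
  apply (cderiv_ext_loc _ (fun w => (/ f w)%C) _ _ d Hd) in K; auto.
  intros w Hw'. specialize (Hnz w Hw').
  assert (E : (p w * (w - z) = f w - f z)%C) by (rewrite (H w); ring).
  replace (- p w / (f w * f z) * (w - z))%C with (- (p w * (w - z)) / (f w * f z))%C by (field; auto).
  rewrite E. field. auto.
Qed.

Lemma cderiv_div (f g : C -> C) z a b : g z <> 0 -> cderiv f z a -> cderiv g z b ->
  cderiv (fun w => (f w / g w)%C) z ((a * g z - f z * b) / (g z * g z)).
Proof.
  intros Hn Hf Hg. eapply cderiv_eq.
  - apply cderiv_mult; [exact Hf|apply cderiv_inv; [exact Hn|exact Hg]].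
  - cbv beta. field. auto.
Qed.

Lemma cderiv_comp f g z a b : cderiv f z a -> cderiv g (f z) b -> cderiv (fun w => g (f w)) z (b * a).
Proof.
  intros Hf. pose proof (cderiv_cont _ _ _ Hf) as Hfc. destruct Hf as [p [Hp [Ep H]]].
  intros [q [Hq [Eq' H']]]. exists (fun w => (q (f w) * p w)%C). split; [|split].
  - apply continuous_Cmult; auto. apply (continuous_comp (f : CU -> CU) (q : CU -> CU)); auto.
  - congruence.
  - intros w. rewrite (H' (f w)). rewrite (H w) at 2. ring.
Qed.

(** Derivatives are taken over full neighbourhoods in C even if [D] is not open; on a closed disk
    this asks for differentiability across the boundary circle. *)
Definition hol (D : C -> Prop) (f : C -> C) : Prop := forall z, D z -> exists l, cderiv f z l.

Definition Copen (D : C -> Prop) : Prop :=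
  forall z, D z -> exists r, 0 < r /\ forall w, Cmod (w - z) < r -> D w.

Lemma hol_deriv D f z : hol D f -> D z -> cderiv f z (C_derive f z).
Proof. intros H Hz. destruct (H z Hz) as [l Hl]. rewrite (C_derive_cderiv _ _ _ Hl). auto. Qed.

Lemma hol_cont D f z : hol D f -> D z -> continuous (f : CU -> CU) z.
Proof. intros H Hz. eapply cderiv_cont. eapply hol_deriv; eauto. Qed.

Lemma hol_const D c : hol D (fun _ => c).
Proof. intros z _. eexists. apply cderiv_const. Qed.

Lemma hol_id D : hol D (fun z => z).
Proof. intros z _. eexists. apply cderiv_id. Qed.

Lemma hol_plus D f g : hol D f -> hol D g -> hol D (fun z => (f z + g z)%C).
Proof. intros H H' z Hz. destruct (H z Hz), (H' z Hz). eexists. apply cderiv_plus; eauto. Qed.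

Lemma hol_minus D f g : hol D f -> hol D g -> hol D (fun z => (f z - g z)%C).
Proof. intros H H' z Hz. destruct (H z Hz), (H' z Hz). eexists. apply cderiv_minus; eauto. Qed.

Lemma hol_mult D f g : hol D f -> hol D g -> hol D (fun z => (f z * g z)%C).
Proof. intros H H' z Hz. destruct (H z Hz), (H' z Hz). eexists. apply cderiv_mult; eauto. Qed.

Lemma hol_div D (f g : C -> C) : hol D f -> hol D g -> (forall z, D z -> g z <> 0) -> hol D (fun z => (f z / g z)%C).
Proof. intros H H' Hn z Hz. destruct (H z Hz), (H' z Hz). eexists. apply cderiv_div; eauto. Qed.

Lemma hol_pow D f n : hol D f -> hol D (fun z => (f z ^ n)%C).
Proof.
  intros H. induction n; simpl; [apply hol_const|]. apply (hol_mult D f (fun z => (f z ^ n)%C)); auto.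
Qed.

Lemma hol_comp D D' f g : hol D f -> hol D' g -> (forall z, D z -> D' (f z)) -> hol D (fun z => g (f z)).
Proof. intros H H' Hn z Hz. destruct (H z Hz), (H' (f z)); auto. eexists. eapply cderiv_comp; eauto. Qed.


(** * Computing with real and imaginary parts *)

Lemma Re_plus (a b : C) : Re (a + b) = Re a + Re b. Proof. reflexivity. Qed.
Lemma Im_plus (a b : C) : Im (a + b) = Im a + Im b. Proof. reflexivity. Qed.
Lemma Re_opp (a : C) : Re (- a) = - Re a. Proof. reflexivity. Qed.
Lemma Im_opp (a : C) : Im (- a) = - Im a. Proof. reflexivity. Qed.
Lemma Re_minus (a b : C) : Re (a - b) = Re a - Re b. Proof. reflexivity. Qed.
Lemma Im_minus (a b : C) : Im (a - b) = Im a - Im b. Proof. reflexivity. Qed.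
Lemma Re_mult (a b : C) : Re (a * b) = Re a * Re b - Im a * Im b. Proof. reflexivity. Qed.
Lemma Im_mult (a b : C) : Im (a * b) = Re a * Im b + Im a * Re b. Proof. reflexivity. Qed.
Lemma Re_RtoC (a : R) : Re (RtoC a) = a. Proof. reflexivity. Qed.
Lemma Im_RtoC (a : R) : Im (RtoC a) = 0. Proof. reflexivity. Qed.
Lemma Re_Ci : Re Ci = 0. Proof. reflexivity. Qed.
Lemma Im_Ci : Im Ci = 1. Proof. reflexivity. Qed.
Lemma Re_Cconj (a : C) : Re (Cconj a) = Re a. Proof. reflexivity. Qed.
Lemma Im_Cconj (a : C) : Im (Cconj a) = - Im a. Proof. reflexivity. Qed.

Ltac reim := cbv beta; rewrite ?Re_minus, ?Im_minus, ?Re_plus, ?Im_plus, ?Re_opp, ?Im_opp;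
  repeat (progress rewrite ?Re_mult, ?Im_mult, ?Re_Ci, ?Im_Ci, ?Re_Cconj, ?Im_Cconj, ?Re_RtoC, ?Im_RtoC,
    ?Re_minus, ?Im_minus, ?Re_plus, ?Im_plus, ?Re_opp, ?Im_opp).

(** * Goursat's theorem and Cauchy's formula *)

Lemma nested_intervals (u : nat -> R) (w : R) :
  0 <= w -> (forall n, u n <= u (S n) /\ u (S n) + w / 2 ^ S n <= u n + w / 2 ^ n) ->
  exists x, forall n, u n <= x <= u n + w / 2 ^ n.
Proof.
  intros Hw H.
  assert (Hp : forall n, 0 <= w / 2 ^ n).
  { intros n. apply Rmult_le_pos; [auto|]. left. apply Rinv_0_lt_compat, pow_lt; lra. }
  assert (M1 : forall n k, u n <= u (n + k)%nat).
  { intros n k. induction k; [rewrite Nat.add_0_r; lra|].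
    replace (n + S k)%nat with (S (n + k)) by lia. destruct (H (n + k)%nat). lra. }
  assert (M2 : forall n k, u (n + k)%nat + w / 2 ^ (n + k) <= u n + w / 2 ^ n).
  { intros n k. induction k; [rewrite Nat.add_0_r; lra|].
    replace (n + S k)%nat with (S (n + k)) by lia. destruct (H (n + k)%nat). lra. }
  assert (M : forall n m, u n <= u m + w / 2 ^ m).
  { intros n m. destruct (Nat.le_ge_cases n m) as [L|L].
    - replace m with (n + (m - n))%nat by lia. pose proof (M1 n (m - n)%nat).
      specialize (Hp (n + (m - n))%nat). lra.
    - replace n with (m + (n - m))%nat by lia. pose proof (M2 m (n - m)%nat).
      specialize (Hp (m + (n - m))%nat). lra. }
  destruct (completeness (fun y => exists n, y = u n)) as [x [Hx1 Hx2]].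
  - exists (u 0%nat + w / 2 ^ 0). intros y [n ->]. apply M.
  - exists (u 0%nat), 0%nat. reflexivity.
  - exists x. intros n. split; [apply Hx1; eauto|]. apply Hx2. intros y [m ->]. apply M.
Qed.

(** Goursat's argument for an additive function of rectangles: if the whole rectangle carried
    [c > 0] in absolute value, some quarter would carry at least [c / 4], and nested quarters
    carrying [c / 4 ^ n] would violate the bound [o(size^2)] at their common point. *)
Lemma bisection (J : R -> R -> R -> R -> R) (a w a' k : R) :
  0 < w -> 0 < k ->
  (forall s1 s2 s3 t1 t2, a <= s1 <= s2 -> s2 <= s3 <= a + w -> a' <= t1 <= t2 -> t2 <= a' + k ->
     J s1 s3 t1 t2 = J s1 s2 t1 t2 + J s2 s3 t1 t2) ->
  (forall s1 s2 t1 t2 t3, a <= s1 <= s2 -> s2 <= a + w -> a' <= t1 <= t2 -> t2 <= t3 <= a' + k ->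
     J s1 s2 t1 t3 = J s1 s2 t1 t2 + J s1 s2 t2 t3) ->
  (forall x y eps, a <= x <= a + w -> a' <= y <= a' + k -> 0 < eps ->
     exists del, 0 < del /\ forall s1 s2 t1 t2, a <= s1 <= x -> x <= s2 <= a + w ->
       a' <= t1 <= y -> y <= t2 <= a' + k -> s2 - s1 < del -> t2 - t1 < del ->
       Rabs (J s1 s2 t1 t2) <= eps * (s2 - s1 + (t2 - t1)) ^ 2) ->
  J a (a + w) a' (a' + k) = 0.
Proof.
  intros Hw Hk As At Loc.
  destruct (Req_dec (J a (a + w) a' (a' + k)) 0) as [E|N]; [exact E|exfalso].
  apply Rabs_pos_lt in N. set (c := Rabs (J a (a + w) a' (a' + k))) in *.
  set (JJ := fun (p : R * R) n => J (fst p) (fst p + w / 2 ^ n) (snd p) (snd p + k / 2 ^ n)).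
  (* The last quarter is taken untested: by additivity the four values cannot all be below a quarter
     of the whole. *)
  set (step := fun (p : R * R) n =>
    let p10 := (fst p + w / 2 ^ S n, snd p) in
    let p01 := (fst p, snd p + k / 2 ^ S n) in
    let p11 := (fst p + w / 2 ^ S n, snd p + k / 2 ^ S n) in
    if Rle_dec (c / 4 ^ S n) (Rabs (JJ p (S n))) then p
    else if Rle_dec (c / 4 ^ S n) (Rabs (JJ p10 (S n))) then p10
    else if Rle_dec (c / 4 ^ S n) (Rabs (JJ p01 (S n))) then p01
    else p11).
  set (P := fix P n := match n with O => (a, a') | S m => step (P m) m end).
  assert (Pw : forall n, 0 < w / 2 ^ n) by (intros; apply Rdiv_lt_0_compat; auto; apply pow_lt; lra).
  assert (Pk : forall n, 0 < k / 2 ^ n) by (intros; apply Rdiv_lt_0_compat; auto; apply pow_lt; lra).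
  assert (P4 : forall n, 0 < 4 ^ n) by (intros; apply pow_lt; lra).
  assert (Hw2 : forall n, w / 2 ^ n = 2 * (w / 2 ^ S n)).
  { intros n. simpl. field. apply pow_nonzero; lra. }
  assert (Hk2 : forall n, k / 2 ^ n = 2 * (k / 2 ^ S n)).
  { intros n. simpl. field. apply pow_nonzero; lra. }
  assert (Corner : forall n, fst (P n) <= fst (P (S n)) <= fst (P n) + w / 2 ^ S n /\
     snd (P n) <= snd (P (S n)) <= snd (P n) + k / 2 ^ S n).
  { intros n. change (P (S n)) with (step (P n) n). unfold step.
    specialize (Pw (S n)). specialize (Pk (S n)).
    destruct Rle_dec; [|destruct Rle_dec; [|destruct Rle_dec]]; cbn [fst snd]; lra. }
  assert (In : forall n, a <= fst (P n) /\ fst (P n) + w / 2 ^ n <= a + w /\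
     a' <= snd (P n) /\ snd (P n) + k / 2 ^ n <= a' + k).
  { induction n as [|n IH].
    - simpl. lra.
    - specialize (Corner n). specialize (Hw2 n). specialize (Hk2 n). lra. }
  assert (Big : forall n, c / 4 ^ n <= Rabs (JJ (P n) n)).
  { induction n as [|n IH].
    - unfold JJ. simpl. unfold c. replace (w / 1) with w by field. replace (k / 1) with k by field.
      lra.
    - change (P (S n)) with (step (P n) n).
      destruct (P n) as [s t] eqn:EP. specialize (In n). rewrite EP in In. cbn [fst snd] in In.
      pose proof (Hw2 n) as W2. pose proof (Hk2 n) as K2.
      pose proof (Pw (S n)) as PW. pose proof (Pk (S n)) as PK.
      assert (E : JJ (s, t) n = JJ (s, t) (S n) + JJ (s + w / 2 ^ S n, t) (S n)
         + JJ (s, t + k / 2 ^ S n) (S n) + JJ (s + w / 2 ^ S n, t + k / 2 ^ S n) (S n)).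
      { unfold JJ. cbn [fst snd].
        rewrite (As s (s + w / 2 ^ S n) (s + w / 2 ^ n)) by lra.
        rewrite (At s (s + w / 2 ^ S n) t (t + k / 2 ^ S n) (t + k / 2 ^ n)) by lra.
        rewrite (At (s + w / 2 ^ S n) (s + w / 2 ^ n) t (t + k / 2 ^ S n) (t + k / 2 ^ n)) by lra.
        replace (s + w / 2 ^ n) with (s + w / 2 ^ S n + w / 2 ^ S n) by lra.
        replace (t + k / 2 ^ n) with (t + k / 2 ^ S n + k / 2 ^ S n) by lra. ring. }
      assert (E4 : c / 4 ^ n = 4 * (c / 4 ^ S n)) by (simpl; field; specialize (P4 n); lra).
      unfold step. cbn [fst snd].
      destruct Rle_dec as [L|L]; [exact L|].
      destruct Rle_dec as [L1|L1]; [exact L1|].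
      destruct Rle_dec as [L2|L2]; [exact L2|].
      apply Rnot_le_lt in L, L1, L2.
      rewrite E in IH.
      pose proof (Rabs_triang (JJ (s, t) (S n) + JJ (s + w / 2 ^ S n, t) (S n)
         + JJ (s, t + k / 2 ^ S n) (S n)) (JJ (s + w / 2 ^ S n, t + k / 2 ^ S n) (S n))).
      pose proof (Rabs_triang (JJ (s, t) (S n) + JJ (s + w / 2 ^ S n, t) (S n))
         (JJ (s, t + k / 2 ^ S n) (S n))).
      pose proof (Rabs_triang (JJ (s, t) (S n)) (JJ (s + w / 2 ^ S n, t) (S n))). lra. }
  destruct (nested_intervals (fun n => fst (P n)) w) as [x Hx]; [lra| |].
  { intros n. specialize (Corner n). specialize (Hw2 n). specialize (Pw (S n)). lra. }
  destruct (nested_intervals (fun n => snd (P n)) k) as [y Hy]; [lra| |].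
  { intros n. specialize (Corner n). specialize (Hk2 n). specialize (Pk (S n)). lra. }
  (* With this [eps] the local bound at level [n] is [c / 4 ^ n / 2], half of what the quarter
     carries. *)
  assert (He : 0 < c / (2 * (w + k) ^ 2)).
  { apply Rdiv_lt_0_compat; auto. assert (0 < (w + k) ^ 2) by (apply pow_lt; lra). lra. }
  assert (Hx0 : a <= x <= a + w) by (generalize (Hx 0%nat); cbn; lra).
  assert (Hy0 : a' <= y <= a' + k) by (generalize (Hy 0%nat); cbn; lra).
  destruct (Loc x y _ Hx0 Hy0 He) as [d [Hd HL]].
  assert (Hn : exists n, w / 2 ^ n < d /\ k / 2 ^ n < d).
  { destruct (Pow_x_infinity 2 ltac:(rewrite Rabs_right; lra) ((w + k + d) / d)) as [n Hn].
    exists n. specialize (Hn n (Nat.le_refl n)). rewrite Rabs_right in Hn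
      by (apply Rle_ge, pow_le; lra).
    assert (0 < 2 ^ n) by (apply pow_lt; lra).
    apply Rge_le in Hn. apply Rmult_le_compat_r with (r := d) in Hn; [|lra].
    rewrite Rdiv_mul in Hn by lra.
    split; apply Rmult_lt_reg_r with (2 ^ n); auto; unfold Rdiv;
      rewrite Rmult_assoc, Rinv_l by lra; lra. }
  destruct Hn as [n [Hn1 Hn2]].
  specialize (Big n). unfold JJ in Big. specialize (Hx n). specialize (Hy n). specialize (In n).
  simpl in Hx, Hy.
  specialize (HL (fst (P n)) (fst (P n) + w / 2 ^ n) (snd (P n)) (snd (P n) + k / 2 ^ n)
    ltac:(lra) ltac:(lra) ltac:(lra) ltac:(lra) ltac:(lra) ltac:(lra)).
  assert (E : c / (2 * (w + k) ^ 2) *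
       (fst (P n) + w / 2 ^ n - fst (P n) + (snd (P n) + k / 2 ^ n - snd (P n))) ^ 2
     = c / 4 ^ n / 2).
  { assert (E2 : 4 ^ n = 2 ^ n * 2 ^ n) by (rewrite <- Rpow_mult_distr; f_equal; lra).
    rewrite E2. field. split; [apply pow_nonzero; lra|lra]. }
  rewrite E in HL. assert (0 < c / 4 ^ n) by (apply Rdiv_lt_0_compat; auto). lra.
Qed.

(** The form [P ds + Q dt] is closed at the point: both coefficients are differentiable there and
    share the mixed derivative [m]. Nothing is said about continuity of the derivatives. *)
Definition closed_at (P Q : R -> R -> R) (x y : R) : Prop :=
  exists p1 m q2, forall eps, 0 < eps -> exists del, 0 < del /\ forall s t,
    Rabs (s - x) < del -> Rabs (t - y) < del ->
    Rabs (P s t - P x y - (p1 * (s - x) + m * (t - y))) <= eps * (Rabs (s - x) + Rabs (t - y)) /\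
    Rabs (Q s t - Q x y - (m * (s - x) + q2 * (t - y))) <= eps * (Rabs (s - x) + Rabs (t - y)).

Lemma derivable_eps (h : R -> R) (x m : R) :
  (forall eps, 0 < eps -> exists del, 0 < del /\ forall s, Rabs (s - x) < del ->
     Rabs (h s - h x - m * (s - x)) <= eps * Rabs (s - x)) -> derivable_pt_lim h x m.
Proof.
  intros H eps He. destruct (H (eps / 2) ltac:(lra)) as [d [Hd Hw]].
  exists (mkposreal d Hd). intros u Hu Hu'. simpl in Hu'.
  specialize (Hw (x + u)). replace (x + u - x) with u in Hw by ring. specialize (Hw Hu').
  replace ((h (x + u) - h x) / u - m) with ((h (x + u) - h x - m * u) / u) by (field; auto).
  unfold Rdiv. rewrite Rabs_mult, Rabs_inv. apply Rabs_pos_lt in Hu.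
  apply Rle_lt_trans with (eps / 2); [|lra].
  apply Rmult_le_reg_r with (Rabs u); auto. rewrite Rmult_assoc, Rinv_l by lra. lra.
Qed.

Lemma diff_continuous (h : R -> R) (x m : R) :
  (forall eps, 0 < eps -> exists del, 0 < del /\ forall s, Rabs (s - x) < del ->
     Rabs (h s - h x - m * (s - x)) <= eps * Rabs (s - x)) -> continuous h x.
Proof.
  intros H. apply continuity_pt_filterlim, derivable_continuous_pt. exists m. apply derivable_eps, H.
Qed.

Lemma RInt_Rminus (f g : R -> R) (a b : R) : ex_RInt f a b -> ex_RInt g a b ->
  RInt (fun x => f x - g x) a b = RInt f a b - RInt g a b.
Proof. exact (RInt_minus (V := R_CompleteNormedModule) f g a b). Qed.

Lemma ex_RInt_Rminus (f g : R -> R) (a b : R) : ex_RInt f a b -> ex_RInt g a b ->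
  ex_RInt (fun x => f x - g x) a b.
Proof. exact (ex_RInt_minus (V := R_NormedModule) f g a b). Qed.

Lemma RInt_Rconst (a b c : R) : RInt (fun _ => c) a b = (b - a) * c.
Proof. exact (RInt_const (V := R_CompleteNormedModule) a b c). Qed.

Lemma RInt_RChasles (f : R -> R) (a b c : R) : ex_RInt f a b -> ex_RInt f b c ->
  RInt f a c = RInt f a b + RInt f b c.
Proof. intros H H'. symmetry. exact (RInt_Chasles (V := R_CompleteNormedModule) f a b c H H'). Qed.

Lemma RInt_near_const (f : R -> R) (a b c M : R) : a <= b -> ex_RInt f a b ->
  (forall t, a <= t <= b -> Rabs (f t - c) <= M) -> Rabs (RInt f a b - c * (b - a)) <= (b - a) * M.
Proof.
  intros Hab If HM. replace (c * (b - a)) with (RInt (fun _ => c) a b) by (rewrite RInt_Rconst; apply Rmult_comm).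
  rewrite <- RInt_Rminus by (auto; apply ex_RInt_const).
  apply abs_RInt_le_const; auto. apply ex_RInt_Rminus; auto. apply ex_RInt_const.
Qed.

(** The circulation [J] around subrectangles is additive. Near a point, the affine part of the form
    contributes [m] times the area to both integrals, and this cancels; what remains is at most
    [eps] times the square of the half-perimeter, so [bisection] applies. *)
Lemma green_goursat (P Q : R -> R -> R) (a b a' b' : R) :
  a < b -> a' < b' ->
  (forall x y, a <= x <= b -> a' <= y <= b' -> closed_at P Q x y) ->
  RInt (fun t => Q b t - Q a t) a' b' = RInt (fun s => P s b' - P s a') a b.
Proof.
  intros Hab Hab' H.
  assert (CP : forall s t, a <= s <= b -> a' <= t <= b' -> continuous (fun s => P s t : R_CompleteNormedModule) s).
  { intros s t Hs Ht. destruct (H s t Hs Ht) as [p1 [m [q2 HH]]]. apply (diff_continuous _ _ p1).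
    intros eps He. destruct (HH eps He) as [d [Hd Hw]]. exists d. split; auto. intros u Hu.
    destruct (Hw u t) as [A _]; [auto|rewrite Rminus_diag, Rabs_R0; auto|].
    rewrite Rminus_diag, Rabs_R0, Rmult_0_r, !Rplus_0_r in A. exact A. }
  assert (CQ : forall s t, a <= s <= b -> a' <= t <= b' -> continuous (fun t => Q s t : R_CompleteNormedModule) t).
  { intros s t Hs Ht. destruct (H s t Hs Ht) as [p1 [m [q2 HH]]]. apply (diff_continuous _ _ q2).
    intros eps He. destruct (HH eps He) as [d [Hd Hw]]. exists d. split; auto. intros u Hu.
    destruct (Hw s u) as [_ A]; [rewrite Rminus_diag, Rabs_R0; auto|auto|].
    rewrite Rminus_diag, Rabs_R0, Rmult_0_r, !Rplus_0_l in A. exact A. }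
  assert (IP : forall s1 s2 t, a <= s1 <= s2 -> s2 <= b -> a' <= t <= b' -> ex_RInt (fun s => P s t) s1 s2).
  { intros. apply (ex_RInt_continuous (V := R_CompleteNormedModule)). intros z Hz. rewrite Rmin_left, Rmax_right in Hz by lra.
    apply CP; lra. }
  assert (IQ : forall s t1 t2, a <= s <= b -> a' <= t1 <= t2 -> t2 <= b' -> ex_RInt (fun t => Q s t) t1 t2).
  { intros. apply (ex_RInt_continuous (V := R_CompleteNormedModule)). intros z Hz. rewrite Rmin_left, Rmax_right in Hz by lra.
    apply CQ; lra. }
  assert (IP2 : forall s1 s2 t t', a <= s1 <= s2 -> s2 <= b -> a' <= t <= b' -> a' <= t' <= b' ->
     ex_RInt (fun s => P s t' - P s t) s1 s2).
  { intros. apply ex_RInt_Rminus; auto. }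
  assert (IQ2 : forall s s' t1 t2, a <= s <= b -> a <= s' <= b -> a' <= t1 <= t2 -> t2 <= b' ->
     ex_RInt (fun t => Q s' t - Q s t) t1 t2).
  { intros. apply ex_RInt_Rminus; auto. }
  set (J := fun s1 s2 t1 t2 => RInt (fun t => Q s2 t - Q s1 t) t1 t2 - RInt (fun s => P s t2 - P s t1) s1 s2).
  assert (Z : J a (a + (b - a)) a' (a' + (b' - a')) = 0).
  { apply bisection; try lra.
    - intros s1 s2 s3 t1 t2 ? ? ? ?. unfold J.
      rewrite (RInt_RChasles (fun s => P s t2 - P s t1) s1 s2 s3) by (apply IP2; lra).
      rewrite (RInt_Rminus (Q s3) (Q s1)), (RInt_Rminus (Q s2) (Q s1)), (RInt_Rminus (Q s3) (Q s2))
        by (apply IQ; lra). ring.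
    - intros s1 s2 t1 t2 t3 ? ? ? ?. unfold J.
      rewrite (RInt_RChasles (fun t => Q s2 t - Q s1 t) t1 t2 t3) by (apply IQ2; lra).
      rewrite (RInt_Rminus (fun s => P s t3) (fun s => P s t1)),
        (RInt_Rminus (fun s => P s t2) (fun s => P s t1)),
        (RInt_Rminus (fun s => P s t3) (fun s => P s t2)) by (apply IP; lra). ring.
    - intros x y eps Hx Hy He.
      destruct (H x y ltac:(lra) ltac:(lra)) as [p1 [m [q2 HH]]].
      destruct (HH (eps / 2) ltac:(lra)) as [d [Hd Hw]]. exists d. split; auto.
      intros s1 s2 t1 t2 ? ? ? ? Hs Ht. unfold J.
      set (sg := s2 - s1 + (t2 - t1)).
      assert (B : forall s t, s1 <= s <= s2 -> t1 <= t <= t2 ->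
         Rabs (P s t - P x y - (p1 * (s - x) + m * (t - y))) <= eps / 2 * sg /\
         Rabs (Q s t - Q x y - (m * (s - x) + q2 * (t - y))) <= eps / 2 * sg).
      { intros s t Hs' Ht'.
        assert (Rabs (s - x) <= s2 - s1) by (apply Rabs_le; lra).
        assert (Rabs (t - y) <= t2 - t1) by (apply Rabs_le; lra).
        assert (eps / 2 * (Rabs (s - x) + Rabs (t - y)) <= eps / 2 * sg).
        { apply Rmult_le_compat_l; unfold sg; lra. }
        destruct (Hw s t); lra. }
      assert (E1 : Rabs (RInt (fun t => Q s2 t - Q s1 t) t1 t2 - m * (s2 - s1) * (t2 - t1))
         <= (t2 - t1) * (eps * sg)).
      { apply RInt_near_const; [lra|apply IQ2; lra|].
        intros t Ht'. destruct (B s1 t) as [_ B1]; [lra|lra|]. destruct (B s2 t) as [_ B2]; [lra|lra|].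
          apply Rabs_le_between in B1. apply Rabs_le_between in B2.
          apply Rabs_le. lra. }
      assert (E2 : Rabs (RInt (fun s => P s t2 - P s t1) s1 s2 - m * (t2 - t1) * (s2 - s1))
         <= (s2 - s1) * (eps * sg)).
      { apply RInt_near_const; [lra|apply IP2; lra|].
        intros s Hs'. destruct (B s t1) as [B1 _]; [lra|lra|]. destruct (B s t2) as [B2 _]; [lra|lra|].
          apply Rabs_le_between in B1. apply Rabs_le_between in B2.
          apply Rabs_le. lra. }
      apply Rabs_le_between in E1. apply Rabs_le_between in E2.
      replace (eps * sg ^ 2) with ((t2 - t1) * (eps * sg) + (s2 - s1) * (eps * sg)) by (unfold sg; ring).
      apply Rabs_le. lra. }
  unfold J in Z. replace (a + (b - a)) with b in Z by ring. replace (a' + (b' - a')) with b' in Z by ring. lra.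
Qed.

(** * Differentiable maps from R and R^2 to C, in Caratheodory's form *)

Definition rderiv (h : R -> C) (x : R) (l : C) : Prop :=
  exists phi : R -> C, continuous (phi : RU -> CU) x /\ phi x = l /\
    forall s, h s = (h x + phi s * RtoC (s - x))%C.

Notation RRU := (prod_UniformSpace R_UniformSpace R_UniformSpace).

Definition cdiff2 (Phi : R * R -> C) (p0 : R * R) (A B : C) : Prop :=
  exists al be : R * R -> C, continuous (al : RRU -> CU) p0 /\ continuous (be : RRU -> CU) p0 /\
    al p0 = A /\ be p0 = B /\
    forall p, Phi p = (Phi p0 + al p * RtoC (fst p - fst p0) + be p * RtoC (snd p - snd p0))%C.

Lemma caratheodory_R (h : R -> R) (x l : R) : derivable_pt_lim h x l ->
  exists phi : R -> R, continuous (phi : RU -> RU) x /\ phi x = l /\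
    forall s, h s = h x + phi s * (s - x).
Proof.
  intros H. exists (fun s => if Req_EM_T s x then l else (h s - h x) / (s - x)).
  split; [|split].
  - intros P [eps HP]. destruct (H eps (cond_pos eps)) as [d Hd].
    exists d. intros s Hs. apply HP. change (Rabs (s - x) < d) in Hs.
    destruct (Req_EM_T x x) as [_|n]; [|congruence].
    destruct (Req_EM_T s x) as [e|n].
    + apply ball_center.
    + specialize (Hd (s - x) ltac:(lra) Hs). rewrite Rplus_minus in Hd. exact Hd.
  - destruct (Req_EM_T x x); congruence.
  - intros s. change (@eq R (h s) (h x + (if Req_EM_T s x then l else (h s - h x) / (s - x)) * (s - x))).
    destruct (Req_EM_T s x) as [e|n]; [subst; ring|]. field. lra.
Qed.

Lemma rderiv_pair (h1 h2 : R -> R) (x l1 l2 : R) : derivable_pt_lim h1 x l1 -> derivable_pt_lim h2 x l2 ->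
  rderiv (fun s => (h1 s, h2 s)) x (l1, l2).
Proof.
  intros H1 H2. destruct (caratheodory_R _ _ _ H1) as [p1 [C1 [E1 K1]]].
  destruct (caratheodory_R _ _ _ H2) as [p2 [C2 [E2 K2]]].
  exists (fun s => (p1 s, p2 s)). split; [apply continuous_pairC; auto|split; [congruence|]].
  intros s. apply Ceq; simpl; rewrite ?(K1 s), ?(K2 s); ring.
Qed.

Definition Ecirc (t : R) : C := (cos t, sin t).

Lemma rderiv_E t : rderiv Ecirc t (Ci * Ecirc t).
Proof.
  replace (Ci * Ecirc t)%C with ((- sin t, cos t) : C) by (apply Ceq; simpl; ring).
  apply rderiv_pair; [apply derivable_pt_lim_cos|apply derivable_pt_lim_sin].
Qed.

Lemma rderiv_exp_opp s : rderiv (fun s => RtoC (exp (- s))) s (- RtoC (exp (- s))).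
Proof.
  replace (- RtoC (exp (- s)))%C with ((- exp (- s), 0) : C) by (apply Ceq; simpl; ring).
  apply rderiv_pair; [|apply derivable_pt_lim_const].
  replace (- exp (- s)) with (exp (- s) * (- (1))) by ring.
  apply (derivable_pt_lim_comp (fun u => - u) exp).
  - apply (derivable_pt_lim_opp id). apply derivable_pt_lim_id.
  - apply derivable_pt_lim_exp.
Qed.

Lemma Cmod_E t : Cmod (Ecirc t) = 1.
Proof.
  unfold Cmod, Ecirc. rewrite <- sqrt_1. f_equal. cbn [fst snd].
  pose proof (sin2_cos2 t) as H. unfold Rsqr in H.
  replace (cos t ^ 2 + sin t ^ 2) with (sin t * sin t + cos t * cos t) by ring. exact H.
Qed.

Lemma rderiv_cont h x l : rderiv h x l -> continuous (h : RU -> CU) x.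
Proof.
  intros [phi [Hc [_ H]]].
  apply (continuous_ext (fun s : RU => (h x + phi s * RtoC (s - x))%C : CU)).
  { intros; symmetry; apply H. }
  cont.
Qed.

Lemma continuous_E t : continuous (Ecirc : RU -> CU) t.
Proof. eapply rderiv_cont, rderiv_E. Qed.

Lemma cdiff2_fst h p l : rderiv h (fst p) l -> cdiff2 (fun p => h (fst p)) p l 0.
Proof.
  intros [phi [Hc [E H]]]. exists (fun p => phi (fst p)), (fun _ => 0).
  split; [|split; [apply continuous_const|split; [auto|split; [auto|]]]].
  - apply (continuous_comp (fst : RRU -> RU) (phi : RU -> CU)); auto.
    destruct p; apply continuous_fst.
  - intros q. rewrite (H (fst q)) at 1. ring.
Qed.

Lemma cdiff2_snd h p l : rderiv h (snd p) l -> cdiff2 (fun p => h (snd p)) p 0 l.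
Proof.
  intros [phi [Hc [E H]]]. exists (fun _ => 0), (fun p => phi (snd p)).
  split; [apply continuous_const|split; [|split; [auto|split; [auto|]]]].
  - apply (continuous_comp (snd : RRU -> RU) (phi : RU -> CU)); auto.
    destruct p; apply continuous_snd.
  - intros q. rewrite (H (snd q)) at 1. ring.
Qed.

Lemma cdiff2_cont F p A B : cdiff2 F p A B -> continuous (F : RRU -> CU) p.
Proof.
  intros [a [b [Ca [Cb [_ [_ H]]]]]].
  apply (continuous_ext (fun q : RRU => (F p + a q * RtoC (fst q - fst p) + b q * RtoC (snd q - snd p))%C : CU)).
  { intros; symmetry; apply H. }
  assert (C1 : continuous (fst : RRU -> RU) p) by (destruct p; apply continuous_fst).
  assert (C2 : continuous (snd : RRU -> RU) p) by (destruct p; apply continuous_snd).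
  cont.
Qed.

Lemma cdiff2_mult F G p A B A' B' : cdiff2 F p A B -> cdiff2 G p A' B' ->
  cdiff2 (fun q => (F q * G q)%C) p (A * G p + F p * A') (B * G p + F p * B').
Proof.
  intros HF HG. pose proof (cdiff2_cont _ _ _ _ HG) as CG.
  destruct HF as [a [b [Ca [Cb [Ea [Eb H]]]]]]. destruct HG as [a' [b' [Ca' [Cb' [Ea' [Eb' H']]]]]].
  exists (fun q => (a q * G q + F p * a' q)%C), (fun q => (b q * G q + F p * b' q)%C).
  split; [|split; [|split; [congruence|split; [congruence|]]]].
  1,2: cont.
  intros q. rewrite (H q), (H' q). ring.
Qed.

Lemma cdiff2_comp F f p A B l : cdiff2 F p A B -> cderiv f (F p) l ->
  cdiff2 (fun q => f (F q)) p (l * A) (l * B).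
Proof.
  intros HF. pose proof (cdiff2_cont _ _ _ _ HF) as CF.
  destruct HF as [a [b [Ca [Cb [Ea [Eb H]]]]]]. intros [phi [Cp [Ep Hp]]].
  assert (Cp' : continuous (fun q : RRU => phi (F q) : CU) p)
    by (apply (continuous_comp (F : RRU -> CU) (phi : CU -> CU)); auto).
  exists (fun q => (phi (F q) * a q)%C), (fun q => (phi (F q) * b q)%C).
  split; [|split; [|split; [congruence|split; [congruence|]]]].
  1,2: cont.
  intros q. rewrite (Hp (F q)). rewrite (H q) at 2. ring.
Qed.

Lemma continuous_RRU (f : RRU -> RU) p eps : continuous f p -> 0 < eps -> exists del, 0 < del /\
  forall s t, Rabs (s - fst p) < del -> Rabs (t - snd p) < del -> Rabs (f (s, t) - f p) < eps.
Proof.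
  intros H He.
  assert (He' : locally (f p) (fun y => Rabs (y - f p) < eps)).
  { exists (mkposreal eps He). intros y Hy. exact Hy. }
  destruct (H _ He') as [d Hd]. exists d. split; [apply cond_pos|].
  intros s t Hs Ht. apply (Hd (s, t)). split; assumption.
Qed.

(** [pr] stands for [Re] or [Im]: a complex form with equal mixed derivatives splits into two closed
    real forms. *)
Lemma cdiff2_closed (pr : C -> R) (P Q : R * R -> C) x y A m B :
  (forall a b : C, pr (a + b)%C = pr a + pr b) -> (forall (a : C) r, pr (a * RtoC r)%C = pr a * r) ->
  (forall f : RRU -> CU, forall p, continuous f p -> continuous (fun q : RRU => pr (f q) : RU) p) ->
  cdiff2 P (x, y) A m -> cdiff2 Q (x, y) m B ->
  closed_at (fun s t => pr (P (s, t))) (fun s t => pr (Q (s, t))) x y.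
Proof.
  intros Hadd Hscal Hcont HP HQ.
  assert (Gen : forall F A B, cdiff2 F (x, y) A B -> forall eps, 0 < eps -> exists del, 0 < del /\
    forall s t, Rabs (s - x) < del -> Rabs (t - y) < del ->
    Rabs (pr (F (s, t)) - pr (F (x, y)) - (pr A * (s - x) + pr B * (t - y)))
      <= eps * (Rabs (s - x) + Rabs (t - y))).
  { clear - Hadd Hscal Hcont. intros F A B [a [b [Ca [Cb [Ea [Eb H]]]]]] eps He.
    destruct (continuous_RRU _ _ eps (Hcont _ _ Ca) He) as [d1 [Hd1 H1]].
    destruct (continuous_RRU _ _ eps (Hcont _ _ Cb) He) as [d2 [Hd2 H2]].
    exists (Rmin d1 d2). split; [apply Rmin_glb_lt; auto|]. intros s t Hs Ht.
    specialize (H1 s t (Rlt_le_trans _ _ _ Hs (Rmin_l _ _)) (Rlt_le_trans _ _ _ Ht (Rmin_l _ _))).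
    specialize (H2 s t (Rlt_le_trans _ _ _ Hs (Rmin_r _ _)) (Rlt_le_trans _ _ _ Ht (Rmin_r _ _))).
    rewrite (H (s, t)), !Hadd, !Hscal. rewrite Ea in H1. rewrite Eb in H2. cbn [fst snd].
    replace (pr (F (x, y)) + pr (a (s, t)) * (s - x) + pr (b (s, t)) * (t - y) - pr (F (x, y)) -
      (pr A * (s - x) + pr B * (t - y)))
      with ((pr (a (s, t)) - pr A) * (s - x) + (pr (b (s, t)) - pr B) * (t - y)) by ring.
    eapply Rle_trans; [apply Rabs_triang|]. rewrite !Rabs_mult, Rmult_plus_distr_l.
    apply Rplus_le_compat; apply Rmult_le_compat_r; try apply Rabs_pos; lra. }
  exists (pr A), (pr m), (pr B). intros eps He.
  destruct (Gen _ _ _ HP eps He) as [d1 [Hd1 H1]]. destruct (Gen _ _ _ HQ eps He) as [d2 [Hd2 H2]].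
  exists (Rmin d1 d2). split; [apply Rmin_glb_lt; auto|]. intros s t Hs Ht.
  split; [apply H1|apply H2]; eapply Rlt_le_trans; eauto; (apply Rmin_l || apply Rmin_r).
Qed.

(** * Integrals over the unit circle *)

Definition CInt (h : R -> C) : C :=
  (RInt (fun t => Re (h t)) 0 (2 * PI), RInt (fun t => Im (h t)) 0 (2 * PI)).

Lemma PI2_pos : 0 < 2 * PI.
Proof. pose proof PI_RGT_0. lra. Qed.

Lemma ex_RInt_Re h : (forall t, continuous (h : RU -> CU) t) -> ex_RInt (fun t => Re (h t)) 0 (2 * PI).
Proof.
  intros H. apply (ex_RInt_continuous (V := R_CompleteNormedModule)). intros z _. 
  exact (continuous_Re h z (H z)).
Qed.

Lemma ex_RInt_Im h : (forall t, continuous (h : RU -> CU) t) -> ex_RInt (fun t => Im (h t)) 0 (2 * PI).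
Proof.
  intros H. apply (ex_RInt_continuous (V := R_CompleteNormedModule)). intros z _. 
  exact (continuous_Im h z (H z)).
Qed.

Lemma RInt_Rext (f g : R -> R) a b : (forall x, f x = g x) -> RInt f a b = RInt g a b.
Proof. intros H. apply RInt_ext. auto. Qed.

Lemma RInt_Rplus (f g : R -> R) (a b : R) : ex_RInt f a b -> ex_RInt g a b ->
  RInt (fun x => f x + g x) a b = RInt f a b + RInt g a b.
Proof. exact (RInt_plus (V := R_CompleteNormedModule) f g a b). Qed.

Lemma RInt_Rscal (f : R -> R) (a b l : R) : ex_RInt f a b ->
  RInt (fun x => l * f x) a b = l * RInt f a b.
Proof. exact (RInt_scal (V := R_CompleteNormedModule) f a b l). Qed.

Lemma ex_RInt_Rscal (f : R -> R) (a b l : R) : ex_RInt f a b -> ex_RInt (fun x => l * f x) a b.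
Proof. exact (ex_RInt_scal (V := R_NormedModule) f a b l). Qed.

Lemma CInt_ext h k : (forall t, h t = k t) -> CInt h = CInt k.
Proof. intros H. unfold CInt. f_equal; apply RInt_Rext; intros; rewrite H; auto. Qed.

Lemma CInt_minus h k : (forall t, continuous (h : RU -> CU) t) -> (forall t, continuous (k : RU -> CU) t) ->
  CInt (fun t => (h t - k t)%C) = (CInt h - CInt k)%C.
Proof.
  intros H K. apply Ceq.
  - exact (RInt_Rminus _ _ _ _ (ex_RInt_Re h H) (ex_RInt_Re k K)).
  - exact (RInt_Rminus _ _ _ _ (ex_RInt_Im h H) (ex_RInt_Im k K)).
Qed.

Lemma CInt_scal c h : (forall t, continuous (h : RU -> CU) t) ->
  CInt (fun t => (c * h t)%C) = (c * CInt h)%C.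
Proof.
  intros H. pose proof (ex_RInt_Re h H) as HR. pose proof (ex_RInt_Im h H) as HI.
  assert (S : forall l (f : R -> R), ex_RInt f 0 (2 * PI) -> ex_RInt (fun t => l * f t) 0 (2 * PI))
    by (intros; apply ex_RInt_Rscal; auto).
  apply Ceq; simpl.
  - rewrite <- !RInt_Rscal by auto.
    exact (RInt_Rminus _ _ _ _ (S (fst c) _ HR) (S (snd c) _ HI)).
  - rewrite <- !RInt_Rscal by auto.
    exact (RInt_Rplus _ _ _ _ (S (fst c) _ HI) (S (snd c) _ HR)).
Qed.

(** The constant is twice the sharp one, because real and imaginary parts are bounded separately. *)
Lemma CInt_bound h M : (forall t, continuous (h : RU -> CU) t) ->
  (forall t, 0 <= t <= 2 * PI -> Cmod (h t) <= M) -> Cmod (CInt h) <= 4 * PI * M.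
Proof.
  intros H HM. pose proof PI2_pos. eapply Rle_trans; [apply Cmod_le_abs|]. unfold CInt; cbn [Re Im fst snd].
  assert (Rabs (RInt (fun t : R => Re (h t)) 0 (2 * PI)) <= (2 * PI - 0) * M).
  { apply abs_RInt_le_const; [lra|apply ex_RInt_Re; auto|]. intros t Ht. 
    eapply Rle_trans; [apply re_le_Cmod|auto]. }
  assert (Rabs (RInt (fun t : R => Im (h t)) 0 (2 * PI)) <= (2 * PI - 0) * M).
  { apply abs_RInt_le_const; [lra|apply ex_RInt_Im; auto|]. intros t Ht. 
    eapply Rle_trans; [apply im_le_Cmod|auto]. }
  lra.
Qed.

(** Differentiation under the integral sign, from a remainder that is quadratic in [w - z] uniformly
    in [t]; it integrates to a quadratic remainder. *)
Lemma CInt_deriv (k : C -> R -> C) (k' : R -> C) (z : C) (M r : R) :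
  0 < r -> (forall w t, Cmod (w - z) < r -> continuous (k w : RU -> CU) t) ->
  (forall t, continuous (k' : RU -> CU) t) ->
  (forall w t, Cmod (w - z) < r -> 0 <= t <= 2 * PI ->
     Cmod (k w t - k z t - (w - z) * k' t) <= M * Cmod (w - z) ^ 2) ->
  cderiv (fun w => CInt (k w)) z (CInt k').
Proof.
  intros Hr Hk Hk' H. apply cderiv_eps. intros eps He.
  pose proof PI_RGT_0.
  assert (HA : 0 < 4 * PI * (Rabs M + 1)) by (pose proof (Rabs_pos M); nra).
  exists (Rmin r (eps / (4 * PI * (Rabs M + 1)))). split.
  { apply Rmin_glb_lt; auto. apply Rdiv_lt_0_compat; auto. }
  intros w Hw. assert (Hwr := Rlt_le_trans _ _ _ Hw (Rmin_l _ _)).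
  assert (Hz : Cmod (z - z) < r) by (replace (z - z)%C with (RtoC 0) by ring; rewrite Cmod_0; auto).
  apply Rlt_le in Hw. assert (Hwe := Rle_trans _ _ _ Hw (Rmin_r _ _)).
  replace (CInt k' * (w - z))%C with (CInt (fun t => ((w - z) * k' t)%C))
    by (rewrite CInt_scal by auto; ring).
  assert (Cs : forall t, continuous ((fun t => ((w - z) * k' t)%C) : RU -> CU) t)
    by (intros; cont).
  rewrite <- CInt_minus by auto. rewrite <- CInt_minus; [| |auto].
  2: { intros t. apply continuous_Cminus; auto. }
  eapply Rle_trans.
  - apply CInt_bound with (M := (Rabs M + 1) * Cmod (w - z) ^ 2).
    + intros t. pose proof (Hk w t Hwr). pose proof (Hk z t Hz). cont.
    + intros t Ht. eapply Rle_trans; [apply H; auto|]. apply Rmult_le_compat_r; [apply pow_le, Cmod_ge_0|].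
      pose proof (Rle_abs M). lra.
  - rewrite <- Rmult_assoc. set (A := 4 * PI * (Rabs M + 1)) in *.
    apply Rmult_le_compat_l with (r := A) in Hwe; [|lra].
    replace (A * (eps / A)) with eps in Hwe by (field; lra).
    pose proof (Cmod_ge_0 (w - z)). nra.
Qed.

Lemma cdiff2_eq F p A B A' B' : cdiff2 F p A B -> A = A' -> B = B' -> cdiff2 F p A' B'.
Proof. intros; subst; auto. Qed.

Lemma Cmod_E_minus z t : 1 - Cmod z <= Cmod (Ecirc t - z).
Proof. pose proof (Cmod_rev (Ecirc t) z). rewrite Cmod_E in H. auto. Qed.

Lemma E_minus_neq z t : Cmod z < 1 -> (Ecirc t - z)%C <> 0.
Proof. intros H. apply Cmod_gt_0. pose proof (Cmod_E_minus z t). lra. Qed.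

Lemma small_zero (x : R) : (forall eps, 0 < eps -> Rabs x <= eps) -> x = 0.
Proof.
  intros H. destruct (Req_dec x 0) as [E|N]; auto. apply Rabs_pos_lt in N.
  specialize (H (Rabs x / 2) ltac:(lra)). lra.
Qed.

Lemma continuous_E_div z (n : nat) t : Cmod z < 1 -> continuous (fun t : RU => (/ (Ecirc t - z) ^ n)%C : CU) t.
Proof.
  intros Hz. apply continuous_Cinv.
  - apply Cmod_gt_0. rewrite Cmod_pow. apply pow_lt. pose proof (Cmod_E_minus z t). lra.
  - pose proof (continuous_E t). apply continuous_Cpow. cont.
Qed.

(* The circle is contracted to [z] along [Psi (s,t) = z + exp (-s) (E t - z)]; the form
   [g (Psi) d Psi / (Psi - z)] is [- g (Psi) ds + i E / (E - z) g (Psi) dt]. *)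
Lemma cauchy_unit (f : C -> C) (z : C) :
  hol (fun w => Cmod w <= 1) f -> Cmod z < 1 ->
  CInt (fun t => (Ecirc t / (Ecirc t - z) * (f (Ecirc t) - f z))%C) = 0.
Proof.
  intros Hf Hz. pose proof PI_RGT_0 as HPI. pose proof PI2_pos as HPI2.
  set (Psi := fun p : R * R => (z + RtoC (exp (- fst p)) * (Ecirc (snd p) - z))%C).
  set (g := fun w => (f w - f z)%C).
  set (k := fun w => (Ci * w / (w - z))%C).
  set (P := fun p => (- g (Psi p))%C).
  set (Q := fun p => (k (Ecirc (snd p)) * g (Psi p))%C).
  assert (Hin : forall s t, 0 <= s -> Cmod (Psi (s, t)) <= 1).
  { intros s t Hs. unfold Psi; cbn [fst snd].
    assert (0 < exp (- s)) by apply exp_pos.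
    assert (exp (- s) <= 1) by (pose proof (exp_ineq1_le s); rewrite exp_Ropp, <- Rinv_1; apply Rinv_le_contravar; lra).
    replace (z + RtoC (exp (- s)) * (Ecirc t - z))%C
      with (RtoC (1 - exp (- s)) * z + RtoC (exp (- s)) * Ecirc t)%C
      by (rewrite RtoC_minus; ring).
    eapply Rle_trans; [apply Cmod_triangle|]. rewrite !Cmod_mult, !Cmod_R, Cmod_E.
    rewrite !Rabs_right by lra. pose proof (Cmod_ge_0 z). nra. }
  assert (Hk : forall t, cderiv k (Ecirc t) (- Ci * z / ((Ecirc t - z) * (Ecirc t - z)))).
  { intros t. pose proof (E_minus_neq z t Hz). eapply cderiv_eq.
    - apply (cderiv_div (fun w => (Ci * w)%C) (fun w => (w - z)%C)); auto.
      + apply cderiv_scal, cderiv_id.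
      + apply cderiv_minus; [apply cderiv_id|apply cderiv_const].
    - cbv beta. field. auto. }
  assert (HPsi : forall s t, cdiff2 Psi (s, t) (- RtoC (exp (- s)) * (Ecirc t - z))
     (RtoC (exp (- s)) * (Ci * Ecirc t))).
  { intros s t. 
    assert (D1 : cdiff2 (fun p => RtoC (exp (- fst p))) (s, t) (- RtoC (exp (- s))) 0).
    { apply (cdiff2_fst (fun s => RtoC (exp (- s)))). apply rderiv_exp_opp. }
    assert (D2 : cdiff2 (fun p => (Ecirc (snd p) - z)%C) (s, t) 0 (Ci * Ecirc t)).
    { assert (D3 : cdiff2 (fun p => Ecirc (snd p)) (s, t) 0 (Ci * Ecirc t))
        by (apply cdiff2_snd, rderiv_E).
      eapply cdiff2_eq; [apply (cdiff2_comp _ (fun w => (w - z)%C) _ _ _ 1 D3)|ring|ring].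
      eapply cderiv_eq; [apply cderiv_minus; [apply cderiv_id|apply cderiv_const]|ring]. }
    pose proof (cdiff2_mult _ _ _ _ _ _ _ D1 D2) as D4. cbn [fst snd] in D4.
    eapply cdiff2_eq; [apply (cdiff2_comp _ (fun w => (z + w)%C) _ _ _ 1 D4)|ring|ring].
    eapply cderiv_eq; [apply cderiv_plus; [apply cderiv_const|apply cderiv_id]|ring]. }
  assert (Hcl : forall s t, 0 <= s -> exists A m B, cdiff2 P (s, t) A m /\ cdiff2 Q (s, t) m B).
  { intros s t Hs. destruct (Hf (Psi (s, t)) (Hin s t Hs)) as [l Hl].
    assert (Hg : cderiv g (Psi (s, t)) l).
    { eapply cderiv_eq; [apply cderiv_minus; [apply Hl|apply cderiv_const]|ring]. }
    assert (HgO : cderiv (fun w => (- g w)%C) (Psi (s, t)) (- l)) by (apply cderiv_opp; auto).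
    assert (D3 : cdiff2 (fun p => Ecirc (snd p)) (s, t) 0 (Ci * Ecirc t))
        by (apply cdiff2_snd, rderiv_E).
    pose proof (cdiff2_comp _ _ _ _ _ _ D3 (Hk t)) as D4.
    pose proof (cdiff2_comp _ _ _ _ _ _ (HPsi s t) Hg) as D5.
    pose proof (cdiff2_mult _ _ _ _ _ _ _ D4 D5) as D6.
    eexists _, _, _. split; [apply (cdiff2_comp _ _ _ _ _ _ (HPsi s t) HgO)|].
    eapply cdiff2_eq; [exact D6| |reflexivity].
    cbn [fst snd]. unfold k. field. apply E_minus_neq; auto. }
  assert (HQc : forall s, 0 <= s -> forall t, continuous ((fun t => Q (s, t)) : RU -> CU) t).
  { intros s Hs t. destruct (Hcl s t Hs) as [A [m [B [_ HQ]]]]. apply cdiff2_cont in HQ.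
    apply (continuous_comp (fun t : RU => (s, t) : RRU) (Q : RRU -> CU)); auto.
    intros W [eps HW]. exists eps. intros u Hu. apply HW. split; [apply ball_center|exact Hu]. }
  assert (Hpr : forall pr : C -> R,
    (forall a b : C, pr (a + b)%C = pr a + pr b) -> (forall (a : C) r, pr (a * RtoC r)%C = pr a * r) ->
    (forall f : RRU -> CU, forall p, continuous f p -> continuous (fun q : RRU => pr (f q) : RU) p) ->
    forall S, 0 < S -> RInt (fun t => pr (Q (S, t)) - pr (Q (0, t))) 0 (2 * PI) = 0).
  { intros pr H1 H2 H3 S HS.
    rewrite (green_goursat (fun s t => pr (P (s, t))) (fun s t => pr (Q (s, t))) 0 S 0 (2 * PI)); auto.
    (* The sides [t = 0] and [t = 2 PI] cancel because [Ecirc] is periodic; hence the circles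
       [s = 0] and [s = S] carry the same integral. *)
    - rewrite (RInt_Rext _ (fun _ => 0)); [rewrite RInt_Rconst; apply Rmult_0_r|].
      intros s. unfold P, Psi, Ecirc; cbn [fst snd]. rewrite cos_2PI, sin_2PI, cos_0, sin_0. apply Rminus_diag.
    - intros x y Hx Hy. destruct (Hcl x y ltac:(lra)) as [A [m [B [HP HQ]]]].
      apply (cdiff2_closed pr P Q x y A m B); auto. }
  assert (HS : forall S, 0 < S -> CInt (fun t => Q (S, t)) = CInt (fun t => Q (0, t))).
  { intros S HS. apply Ceq.
    - assert (E := Hpr Re ltac:(intros; unfold Re, Im; simpl; ring) ltac:(intros; unfold Re, Im; simpl; ring)
        (fun f p => continuous_Re f p) S HS).
      rewrite RInt_Rminus in E; [apply Rminus_diag_uniq, E| |]; apply ex_RInt_Re, HQc; lra.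
    - assert (E := Hpr Im ltac:(intros; unfold Re, Im; simpl; ring) ltac:(intros; unfold Re, Im; simpl; ring)
        (fun f p => continuous_Im f p) S HS).
      rewrite RInt_Rminus in E; [apply Rminus_diag_uniq, E| |]; apply ex_RInt_Im, HQc; lra. }
  assert (Z : Cmod (CInt (fun t => Q (0, t))) = 0).
  { apply small_zero. intros eps He. rewrite Rabs_right by apply Rle_ge, Cmod_ge_0.
    set (e1 := eps * (1 - Cmod z) / (4 * PI)).
    assert (He1 : 0 < e1) by (apply Rdiv_lt_0_compat; nra).
    assert (Hzz : Cmod z <= 1) by lra.
    destruct (proj1 (continuous_C_CU _ _) (hol_cont _ _ z Hf Hzz) e1 He1) as [d [Hd Hw]].
    (* As [exp S > 1 + S] and [|E t - z| <= 2], the circle contracted by [exp (- S)] lies within [d]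
       of [z], where [g] is at most [e1]; [e1] is scaled so that the integral is then at most
       [eps]. *)
    set (S := Rmax 1 (2 / d)).
    assert (HS1 : 0 < S) by (unfold S; pose proof (Rmax_l 1 (2/d)); lra).
    assert (HSd : exp (- S) * 2 < d).
    { rewrite exp_Ropp. assert (1 + S < exp S) by (apply exp_ineq1; lra).
      assert (2 / d <= S) by apply Rmax_r. pose proof (exp_pos S).
      apply Rmult_lt_reg_l with (exp S); auto. rewrite <- Rmult_assoc, Rinv_r, Rmult_1_l by lra.
      assert (2 / d * d <= S * d) by (apply Rmult_le_compat_r; lra).
      replace (2 / d * d) with 2 in * by (field; lra). nra. }
    rewrite <- (HS S HS1). eapply Rle_trans.
    - apply CInt_bound with (M := e1 / (1 - Cmod z)); [apply HQc; lra|].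
      intros t Ht. unfold Q, k; cbn [snd]. rewrite Cmod_mult, Cmod_div, Cmod_mult, Cmod_Ci, Cmod_E
        by (apply E_minus_neq; auto).
      pose proof (Cmod_E_minus z t).
      assert (Cmod (g (Psi (S, t))) <= e1).
      { left. unfold g. apply Hw. unfold Psi; cbn [fst snd].
        replace (z + RtoC (exp (- S)) * (Ecirc t - z) - z)%C with (RtoC (exp (- S)) * (Ecirc t - z))%C by ring.
        rewrite Cmod_mult, Cmod_R, Rabs_right by (apply Rle_ge; left; apply exp_pos).
        assert (Cmod (Ecirc t - z) <= 2).
        { pose proof (Cmod_triangle (Ecirc t) (- z)). rewrite Cmod_opp, Cmod_E in H0.
          unfold Cminus. lra. }
        pose proof (exp_pos (- S)). nra. }
      rewrite Rmult_1_l. unfold Rdiv. rewrite Rmult_1_l, Rmult_comm.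
      apply Rmult_le_compat; auto; try apply Cmod_ge_0.
      + left; apply Rinv_0_lt_compat; lra.
      + apply Rinv_le_contravar; lra.
    - right. unfold e1. field. split; lra. }
  apply Cmod_eq_0 in Z.
  assert (E : CInt (fun t => Q (0, t)) = (Ci * CInt (fun t => (Ecirc t / (Ecirc t - z) * (f (Ecirc t) - f z))))%C).
  { rewrite <- CInt_scal.
    - apply CInt_ext. intros t. unfold Q, k, g, Psi; cbn [fst snd]. rewrite Ropp_0, exp_0.
      replace (z + 1 * (Ecirc t - z))%C with (Ecirc t) by ring. field. apply E_minus_neq; auto.
    - intros t. pose proof (continuous_E t).
      assert (continuous (fun t : RU => f (Ecirc t) : CU) t).
      { apply (continuous_comp (Ecirc : RU -> CU) (f : CU -> CU)); auto.
        apply (hol_cont _ _ (Ecirc t) Hf). rewrite Cmod_E; lra. }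
      apply continuous_Cmult; [apply continuous_Cdiv; [apply E_minus_neq|..]|]; auto; cont. }
  rewrite E in Z. apply Cmod_eq_0. apply (f_equal Cmod) in Z.
  rewrite Cmod_mult, Cmod_Ci, Rmult_1_l, Cmod_0 in Z. exact Z.
Qed.

(** * Cauchy transforms and the derivative of a holomorphic function *)

(** The remainder equals [h^2 / (u^2 (u - h))], and [|u - h| >= d / 2]. The exponent 1 is kept to
    match the kernels of [Ctrans]. *)
Lemma Cinv_diff1 (u h : C) d : 0 < d -> d <= Cmod u -> Cmod h <= d / 2 ->
  Cmod (/ (u - h) ^ 1 - / u ^ 1 - h * / u ^ 2)%C <= 2 / d ^ 3 * Cmod h ^ 2.
Proof.
  intros Hd Hu Hh.
  assert (Huh : d / 2 <= Cmod (u - h)) by (pose proof (Cmod_rev u h); lra).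
  assert (Hun : u <> 0) by (apply Cmod_gt_0; lra).
  assert (Huhn : (u - h)%C <> 0) by (apply Cmod_gt_0; lra).
  replace (/ (u - h) ^ 1 - / u ^ 1 - h * / u ^ 2)%C with (h ^ 2 / (u ^ 2 * (u - h)))%C
    by (simpl; field; auto).
  rewrite Cmod_div by (apply Cmult_neq; auto; simpl; apply Cmult_neq; auto; rewrite Cmult_1_r; auto).
  rewrite Cmod_mult, !Cmod_pow. unfold Rdiv. rewrite (Rmult_comm _ (Cmod h ^ 2)).
  apply Rmult_le_compat_l; [apply pow_le, Cmod_ge_0|].
  replace (2 * / d ^ 3) with (/ (d ^ 2 * (d / 2))) by (field; lra).
  apply Rinv_le_contravar; [apply Rmult_lt_0_compat; [apply pow_lt|]; lra|].
  apply Rmult_le_compat; [apply pow_le; lra|lra|apply pow_incr; lra|exact Huh].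
Qed.

(** The remainder is [h^2 (3 u - 2 h) / (u^3 (u - h)^2)]; here [(3 u - 2 h) / u] is at most 4
    because [|h| <= |u| / 2]. *)
Lemma Cinv_diff2 (u h : C) d : 0 < d -> d <= Cmod u -> Cmod h <= d / 2 ->
  Cmod (/ (u - h) ^ 2 - / u ^ 2 - h * (2 * / u ^ 3))%C <= 16 / d ^ 4 * Cmod h ^ 2.
Proof.
  intros Hd Hu Hh.
  assert (Huh : d / 2 <= Cmod (u - h)) by (pose proof (Cmod_rev u h); lra).
  assert (Hun : u <> 0) by (apply Cmod_gt_0; lra).
  assert (Huhn : (u - h)%C <> 0) by (apply Cmod_gt_0; lra).
  replace (/ (u - h) ^ 2 - / u ^ 2 - h * (2 * / u ^ 3))%C
    with (h ^ 2 * ((3 * u - 2 * h) / u * (/ u ^ 2 * / (u - h) ^ 2)))%C by (simpl; field; auto).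
  rewrite !Cmod_mult, Cmod_div, !Cmod_inv, !Cmod_pow; auto.
  2,3: simpl; rewrite Cmult_1_r; apply Cmult_neq; auto.
  rewrite (Rmult_comm _ (Cmod h ^ 2)).
  apply Rmult_le_compat_l; [apply pow_le, Cmod_ge_0|].
  replace (16 / d ^ 4) with (4 * (/ d ^ 2 * / (d / 2) ^ 2)) by (field; lra).
  assert (I1 : / Cmod u ^ 2 <= / d ^ 2) by (apply Rinv_le_contravar; [apply pow_lt; lra|apply pow_incr; lra]).
  assert (I2 : / Cmod (u - h) ^ 2 <= / (d / 2) ^ 2) by (apply Rinv_le_contravar; [apply pow_lt; lra|apply pow_incr; lra]).
  assert (0 < / Cmod u ^ 2) by (apply Rinv_0_lt_compat, pow_lt; lra).
  assert (0 < / Cmod (u - h) ^ 2) by (apply Rinv_0_lt_compat, pow_lt; lra).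
  apply Rmult_le_compat.
  - apply Rmult_le_pos; [apply Cmod_ge_0|left; apply Rinv_0_lt_compat; lra].
  - apply Rmult_le_pos; lra.
  - apply Rmult_le_reg_r with (Cmod u); [lra|]. rewrite Rdiv_mul by lra.
    pose proof (Cmod_triangle (3 * u) (- (2 * h))). rewrite Cmod_opp, !Cmod_mult, !Cmod_R in H1.
    rewrite !Rabs_right in H1 by lra. unfold Cminus. lra.
  - apply Rmult_le_compat; lra.
Qed.

Lemma bounded_02PI (h : R -> C) : (forall t, continuous (h : RU -> CU) t) ->
  exists M, 0 < M /\ forall t, 0 <= t <= 2 * PI -> Cmod (h t) <= M.
Proof.
  intros H. pose proof PI2_pos.
  destruct (continuity_ab_maj (fun t => Cmod (h t)) 0 (2 * PI)) as [x [Hx _]]; [lra| |].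
  - intros t _. apply continuity_pt_filterlim. exact (continuous_Cmod h t (H t)).
  - exists (Cmod (h x) + 1). split; [pose proof (Cmod_ge_0 (h x)); lra|]. intros t Ht.
    specialize (Hx t Ht). lra.
Qed.

Section CauchyTransform.
Variable g : R -> C.
Hypothesis Hg : forall t, continuous (g : RU -> CU) t.

Definition Ctrans (n : nat) (z : C) : C := CInt (fun t => (g t * / (Ecirc t - z) ^ n)%C).

Lemma Ctrans_cont n w : Cmod w < 1 ->
  forall t, continuous (fun t : RU => (g t * / (Ecirc t - w) ^ n)%C : CU) t.
Proof. intros Hw t. apply continuous_Cmult; auto. apply continuous_E_div; auto. Qed.

(** The density is bounded on a period, so a quadratic remainder of the kernel passes to the
    integrand. Half the distance from [z] to the circle keeps [w] inside the disk. *)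
Lemma Ctrans_deriv_gen n c M (z : C) : Cmod z < 1 ->
  (forall u h : C, 1 - Cmod z <= Cmod u -> Cmod h <= (1 - Cmod z) / 2 ->
    Cmod (/ (u - h) ^ n - / u ^ n - h * (c * / u ^ S n))%C <= M * Cmod h ^ 2) ->
  cderiv (Ctrans n) z (c * Ctrans (S n) z).
Proof.
  intros Hz HM. destruct (bounded_02PI g Hg) as [M' [HM'0 HM']].
  unfold Ctrans at 2. rewrite <- CInt_scal by (apply Ctrans_cont; auto).
  apply CInt_deriv with (M := M' * M) (r := (1 - Cmod z) / 2); [lra| | |].
  - intros w t Hw. apply Ctrans_cont. pose proof (Cmod_rev w z). lra.
  - intros t. apply continuous_Cmult; [apply continuous_const|]. apply Ctrans_cont; auto.
  - intros w t Hw Ht.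
    specialize (HM (Ecirc t - z)%C (w - z)%C (Cmod_E_minus z t) ltac:(lra)).
    replace (Ecirc t - z - (w - z))%C with (Ecirc t - w)%C in HM by ring.
    replace (g t * / (Ecirc t - w) ^ n - g t * / (Ecirc t - z) ^ n -
      (w - z) * (c * (g t * / (Ecirc t - z) ^ S n)))%C with
      (g t * (/ (Ecirc t - w) ^ n - / (Ecirc t - z) ^ n - (w - z) * (c * / (Ecirc t - z) ^ S n)))%C
      by ring.
    rewrite Cmod_mult, Rmult_assoc. apply Rmult_le_compat; auto; apply Cmod_ge_0.
Qed.

Lemma Ctrans_deriv1 z : Cmod z < 1 -> cderiv (Ctrans 1) z (Ctrans 2 z).
Proof.
  intros Hz. replace (Ctrans 2 z) with (1 * Ctrans 2 z)%C by ring.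
  apply (Ctrans_deriv_gen 1 1 (2 / (1 - Cmod z) ^ 3)); auto. intros u h Hu Hh.
  replace (1 * / u ^ 2)%C with (/ u ^ 2)%C by ring. apply Cinv_diff1; lra.
Qed.

Lemma Ctrans_deriv2 z : Cmod z < 1 -> cderiv (Ctrans 2) z (2 * Ctrans 3 z).
Proof.
  intros Hz. apply (Ctrans_deriv_gen 2 2 (16 / (1 - Cmod z) ^ 4)); auto. intros u h Hu Hh.
  apply Cinv_diff2; lra.
Qed.
End CauchyTransform.

(** [cauchy_unit] reads [K = f J] with two Cauchy transforms, and [J 0 = 2 PI]; so [f = K / J] near
    0, and Cauchy transforms can be differentiated twice. *)
Lemma deriv_hol_unit (f : C -> C) : hol (fun w => Cmod w <= 1) f ->
  exists l, cderiv (C_derive f) 0 l.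
Proof.
  intros Hf.
  set (g := fun t => (Ecirc t * f (Ecirc t))%C). set (e := Ecirc).
  assert (Hg : forall t, continuous (g : RU -> CU) t).
  { intros t. apply continuous_Cmult; [apply continuous_E|].
    apply (continuous_comp (Ecirc : RU -> CU) (f : CU -> CU)); [apply continuous_E|].
    apply (hol_cont _ _ (Ecirc t) Hf). rewrite Cmod_E; lra. }
  assert (He : forall t, continuous (e : RU -> CU) t) by apply continuous_E.
  set (K := Ctrans g). set (J := Ctrans e).
  assert (HK : forall z, Cmod z < 1 -> K 1%nat z = (f z * J 1%nat z)%C).
  { intros z Hz. pose proof (cauchy_unit f z Hf Hz) as E.
    assert (E2 : CInt (fun t => (Ecirc t / (Ecirc t - z) * (f (Ecirc t) - f z))%C)
       = (K 1%nat z - f z * J 1%nat z)%C).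
    { unfold K, J, Ctrans. rewrite <- CInt_scal by (apply Ctrans_cont; auto).
      rewrite <- CInt_minus.
      - apply CInt_ext. intros t. unfold g, e. simpl. field. apply E_minus_neq; auto.
      - apply Ctrans_cont; auto.
      - intros t. apply continuous_Cmult; [apply continuous_const|]. apply Ctrans_cont; auto. }
    rewrite E in E2. replace (K 1%nat z) with (K 1%nat z - f z * J 1%nat z + f z * J 1%nat z)%C by ring.
    rewrite <- E2. ring. }
  assert (C0 : Cmod 0 < 1) by (rewrite Cmod_0; lra).
  assert (HJ0 : J 1%nat 0 <> 0).
  { assert (EJ : J 1%nat 0 = RtoC (2 * PI)).
    { unfold J, Ctrans. rewrite (CInt_ext _ (fun _ => RtoC 1)).
      - apply Ceq; simpl; rewrite RInt_Rconst; apply Rmult_1_r || apply Rmult_0_r || idtac.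
        rewrite Rmult_1_r, Rminus_0_r. reflexivity.
      - intros t. unfold e. replace (Ecirc t - 0)%C with (Ecirc t) by ring. simpl. field.
        apply Cmod_gt_0. rewrite Cmod_E; lra. }
    rewrite EJ. intros E. apply RtoC_inj in E. pose proof PI2_pos. lra. }
  pose proof (cderiv_cont _ _ _ (Ctrans_deriv1 e He 0 C0)) as CJ.
  destruct (nonzero_near (J 1%nat) 0 CJ HJ0) as [d [Hd HJ']].
  assert (HJ : forall w, Cmod w < d -> J 1%nat w <> 0).
  { intros w Hw. apply HJ'. replace (w - 0)%C with w by ring. auto. }
  set (r := Rmin d 1).
  assert (Hr : 0 < r) by (apply Rmin_glb_lt; lra).
  assert (Hf' : forall z, Cmod z < r ->
     cderiv f z ((K 2%nat z * J 1%nat z - K 1%nat z * J 2%nat z) / (J 1%nat z * J 1%nat z))).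
  { intros z Hz. assert (Hz1 : Cmod z < 1) by (eapply Rlt_le_trans; [apply Hz|apply Rmin_r]).
    assert (Hzd : Cmod z < d) by (eapply Rlt_le_trans; [apply Hz|apply Rmin_l]).
    apply (cderiv_ext_loc (fun z => (K 1%nat z / J 1%nat z)%C) _ _ _ (r - Cmod z)); [lra| |].
    - intros w Hw'. assert (Cmod w < r) by (pose proof (Cmod_rev w z); lra).
      rewrite HK by (eapply Rlt_le_trans; [apply H|apply Rmin_r]). field.
      apply HJ. eapply Rlt_le_trans; [apply H|apply Rmin_l].
    - apply cderiv_div; [auto| |]; apply Ctrans_deriv1; auto. }
  eexists. 
  apply (cderiv_ext_loc (fun z => ((K 2%nat z * J 1%nat z - K 1%nat z * J 2%nat z) / (J 1%nat z * J 1%nat z))%C)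
    _ _ _ r Hr).
  - intros w Hw'. symmetry. apply C_derive_cderiv, Hf'. replace (w - 0)%C with w in Hw' by ring. auto.
  - apply cderiv_div; [apply Cmult_neq; auto| |].
    + exact (cderiv_minus _ _ _ _ _ (cderiv_mult _ _ _ _ _ (Ctrans_deriv2 g Hg 0 C0) (Ctrans_deriv1 e He 0 C0))
        (cderiv_mult _ _ _ _ _ (Ctrans_deriv1 g Hg 0 C0) (Ctrans_deriv2 e He 0 C0))).
    + exact (cderiv_mult _ _ _ _ _ (Ctrans_deriv1 e He 0 C0) (Ctrans_deriv1 e He 0 C0)).
Qed.

Lemma hol_deriv_hol (D : C -> Prop) f : Copen D -> hol D f -> hol D (C_derive f).
Proof.
  intros HD Hf c Hc. destruct (HD c Hc) as [r [Hr Hin]].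
  (* Half the radius, so that the affine map carries all of [|w| < 2], a neighbourhood of the closed
     unit disk, into [D]. *)
  set (a := RtoC (r / 2)).
  assert (Ha : a <> 0) by (intros E; apply RtoC_inj in E; lra).
  assert (Ma : Cmod a = r / 2) by (unfold a; rewrite Cmod_R; apply Rabs_right; lra).
  set (F := fun w => f (c + a * w)%C).
  assert (Haff : forall z, cderiv (fun w => (c + a * w)%C) z a).
  { intros z. eapply cderiv_eq; [apply cderiv_plus; [apply cderiv_const|apply cderiv_scal, cderiv_id]|ring]. }
  assert (Hball : forall w, Cmod w < 2 -> D (c + a * w)%C).
  { intros w Hw. apply Hin. replace (c + a * w - c)%C with (a * w)%C by ring. rewrite Cmod_mult, Ma. nra. }
  assert (HF : forall w, Cmod w < 2 -> cderiv F w (C_derive f (c + a * w) * a)).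
  { intros w Hw. apply (cderiv_comp (fun w => (c + a * w)%C) f); auto. apply (hol_deriv D); auto. }
  destruct (deriv_hol_unit F) as [l Hl].
  { intros w Hw. eexists. apply HF. lra. }
  assert (Haff' : cderiv (fun w => ((w - c) / a)%C) c (/ a)).
  { eapply cderiv_eq; [apply (cderiv_mult (fun w => (w - c)%C) (fun _ => / a)%C)|].
    - apply cderiv_minus; [apply cderiv_id|apply cderiv_const].
    - apply cderiv_const.
    - cbv beta. ring. }
  assert (K := cderiv_comp (fun w => ((w - c) / a)%C) (C_derive F) c (/ a) l Haff').
  cbv beta in K. replace ((c - c) / a)%C with (RtoC 0) in K by (field; auto). specialize (K Hl).
  assert (K2 := cderiv_scal (/ a) _ _ _ K). cbv beta in K2.
  eexists. apply (cderiv_ext_loc _ (C_derive f) _ _ r Hr) in K2; [exact K2|].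
  intros w Hw. rewrite (C_derive_cderiv F _ (C_derive f (c + a * ((w - c) / a)) * a)).
  - replace (c + a * ((w - c) / a))%C with w by (field; auto). field. auto.
  - apply HF. rewrite Cmod_div, Ma by auto. apply Rmult_lt_reg_r with (r / 2); [lra|].
    rewrite Rdiv_mul by lra. lra.
Qed.

(** * Restriction to lines, difference quotients *)

Lemma derivable_Re_line f p e t l : cderiv f (p + RtoC t * e) l ->
  derivable_pt_lim (fun t => Re (f (p + RtoC t * e)%C)) t (Re (l * e)).
Proof.
  intros H. rewrite cderiv_eps in H. apply derivable_eps. intros eps He.
  pose proof (Cmod_ge_0 e) as He0.
  destruct (H (eps / (Cmod e + 1))) as [d [Hd Hw]]; [apply Rdiv_lt_0_compat; lra|].
  exists (d / (Cmod e + 1)). split; [apply Rdiv_lt_0_compat; lra|].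
  intros s Hs. specialize (Hw (p + RtoC s * e)%C).
  replace (p + s * e - (p + t * e))%C with (RtoC (s - t) * e)%C in Hw by (rewrite RtoC_minus; ring).
  rewrite Cmod_mult, Cmod_R in Hw.
  assert (Hlt : Rabs (s - t) * Cmod e < d).
  { apply Rmult_lt_compat_r with (r := Cmod e + 1) in Hs; [|lra]. rewrite Rdiv_mul in Hs by lra. pose proof (Rabs_pos (s - t)). nra. }
  specialize (Hw Hlt).
  replace (Re (f (p + s * e)%C) - Re (f (p + t * e)%C) - Re (l * e) * (s - t))
    with (Re (f (p + s * e) - f (p + t * e) - l * (RtoC (s - t) * e))%C)
    by (unfold Re, Im; simpl; ring).
  eapply Rle_trans; [apply re_le_Cmod|]. eapply Rle_trans; [apply Hw|].
  assert (Cmod e / (Cmod e + 1) <= 1).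
  { apply Rmult_le_reg_r with (Cmod e + 1); [lra|]. rewrite Rdiv_mul by lra. lra. }
  replace (eps / (Cmod e + 1) * (Rabs (s - t) * Cmod e))
    with (eps * Rabs (s - t) * (Cmod e / (Cmod e + 1))) by (field; lra).
  assert (0 <= eps * Rabs (s - t)) by (pose proof (Rabs_pos (s - t)); nra). nra.
Qed.

(** The real mean value theorem is applied to the component [Re (conj D g)] along [D = g w - g c],
    whose increment is [|D|^2]. *)
Lemma mean_value_segment g g' c w M :
  (forall t, 0 <= t <= 1 -> cderiv g (c + RtoC t * (w - c)) (g' (c + RtoC t * (w - c))%C) /\
     Cmod (g' (c + RtoC t * (w - c))%C) <= M) ->
  Cmod (g w - g c) <= M * Cmod (w - c).
Proof.
  intros H. set (D := (g w - g c)%C). set (h := (w - c)%C) in *.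
  set (F := fun z => (Cconj D * g z)%C).
  set (phi := fun t => Re (F (c + RtoC t * h)%C)).
  assert (Hphi : forall t, 0 <= t <= 1 -> derivable_pt_lim phi t (Re (Cconj D * g' (c + RtoC t * h) * h)%C)).
  { intros t Ht. apply derivable_Re_line. apply cderiv_scal, H, Ht. }
  destruct (MVT_gen phi 0 1 (fun t => Re (Cconj D * g' (c + RtoC t * h) * h)%C)) as [t [Ht E]].
  - intros t Ht. rewrite Rmin_left, Rmax_right in Ht by lra. apply is_derive_Reals, Hphi. lra.
  - intros t Ht. rewrite Rmin_left, Rmax_right in Ht by lra. apply derivable_continuous_pt.
    eexists. apply Hphi. lra.
  - rewrite Rmin_left, Rmax_right in Ht by lra. rewrite Rminus_0_r, Rmult_1_r in E.
    assert (E2 : phi 1 - phi 0 = Cmod D ^ 2).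
    { unfold phi, F. replace (c + 1 * h)%C with w by (unfold h; ring). replace (c + 0 * h)%C with c by ring.
      rewrite Cmod_sq. unfold D. reim. ring. }
    rewrite E2 in E. destruct (H t Ht) as [_ HM].
    assert (B : Cmod D ^ 2 <= Cmod D * (M * Cmod h)).
    { rewrite E. eapply Rle_trans; [apply Rle_abs|]. eapply Rle_trans; [apply re_le_Cmod|].
      rewrite !Cmod_mult, Cmod_conj, Rmult_assoc. apply Rmult_le_compat_l; [apply Cmod_ge_0|].
      apply Rmult_le_compat_r; [apply Cmod_ge_0|auto]. }
    pose proof (Cmod_ge_0 (g' (c + RtoC t * h)%C)). pose proof (Cmod_ge_0 h).
    pose proof (Cmod_ge_0 D) as [HD|HD]; nra.
Qed.

Definition quot (f : C -> C) (c w : C) : C :=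
  if Ceq_dec w c then C_derive f c else ((f w - f c) / (w - c))%C.

Lemma quot_spec f c w : f w = (f c + (w - c) * quot f c w)%C.
Proof.
  unfold quot. destruct (Ceq_dec w c) as [->|n]; [ring|]. field. apply Cminus_neq; auto.
Qed.

(** Removability at [c]: with [l] the second derivative, subtracting the quadratic Taylor part
    leaves a function whose derivative is [o(|w - c|)], hence whose increment is [o(|w - c|^2)]; so
    the quotient has derivative [l / 2] at [c]. *)
Lemma quot_hol (D : C -> Prop) f c : Copen D -> hol D f -> D c -> hol D (quot f c).
Proof.
  intros HD Hf Hc z Hz. destruct (Ceq_dec z c) as [->|n].
  - destruct (hol_deriv_hol D f HD Hf c Hc) as [l Hl].
    destruct (HD c Hc) as [r [Hr Hin]].
    exists (l / 2)%C. apply cderiv_eps. intros eps He. 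
    destruct (proj1 (cderiv_eps _ _ _) Hl eps He) as [d [Hd Hw]].
    exists (Rmin d r). split; [apply Rmin_glb_lt; auto|]. intros w Hwd.
    set (g := fun w => (f w - C_derive f c * w - l / 2 * ((w - c) * (w - c)))%C).
    assert (B : Cmod (g w - g c) <= eps * Cmod (w - c) ^ 2).
    { replace (eps * Cmod (w - c) ^ 2) with (eps * Cmod (w - c) * Cmod (w - c)) by ring.
      apply (mean_value_segment g (fun w => (C_derive f w - C_derive f c - l * (w - c))%C)).
      intros t Ht. set (u := (c + RtoC t * (w - c))%C).
      assert (Hu : Cmod (u - c) <= Cmod (w - c)).
      { unfold u. replace (c + t * (w - c) - c)%C with (RtoC t * (w - c))%C by ring.
        rewrite Cmod_mult, Cmod_R, Rabs_right by lra. pose proof (Cmod_ge_0 (w - c)). nra. }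
      split.
      - assert (H : Cmod (u - c) < r) by (eapply Rle_lt_trans; [apply Hu|]; eapply Rlt_le_trans; [apply Hwd|apply Rmin_r]).
        assert (Hid : cderiv (fun w => (w - c)%C) u (1 - 0))
          by (apply (cderiv_minus (fun w => w)); [apply cderiv_id|apply cderiv_const]).
        eapply cderiv_eq.
        + exact (cderiv_minus _ _ _ _ _ (cderiv_minus _ _ _ _ _ (hol_deriv D f u Hf (Hin u H))
             (cderiv_scal (C_derive f c) _ _ _ (cderiv_id u)))
             (cderiv_scal (l / 2) _ _ _ (cderiv_mult _ _ _ _ _ Hid Hid))).
        + cbv beta. field.
      - eapply Rle_trans; [apply Hw|apply Rmult_le_compat_l; lra].
        eapply Rle_lt_trans; [apply Hu|]. eapply Rlt_le_trans; [apply Hwd|apply Rmin_l]. }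
    unfold quot. destruct (Ceq_dec c c) as [_|]; [|congruence].
    destruct (Ceq_dec w c) as [->|n].
    { replace (C_derive f c - C_derive f c - l / 2 * (c - c))%C with (RtoC 0) by ring.
      rewrite Cmod_0. pose proof (Cmod_ge_0 (c - c)). nra. }
    apply Cminus_neq in n. pose proof n as n'. apply Cmod_gt_0 in n'.
    replace ((f w - f c) / (w - c) - C_derive f c - l / 2 * (w - c))%C with ((g w - g c) / (w - c))%C.
    + rewrite Cmod_div by auto. apply Rmult_le_reg_r with (Cmod (w - c)); auto.
      rewrite Rdiv_mul by lra. simpl in B. lra.
    + unfold g. field. auto.
  - destruct (Hf z Hz) as [l Hl]. pose proof (Cminus_neq _ _ n) as n'.
    eexists. apply (cderiv_ext_loc (fun w => ((f w - f c) / (w - c))%C) _ _ _ (Cmod (z - c))).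
    + apply Cmod_gt_0; auto.
    + intros w Hw. unfold quot. destruct (Ceq_dec w c) as [->|]; auto.
      rewrite Cmod_minus_sym in Hw. lra.
    + apply (cderiv_div (fun w => (f w - f c)%C) (fun w => (w - c)%C)); auto.
      * apply cderiv_minus; [exact Hl|apply cderiv_const].
      * apply cderiv_minus; [apply cderiv_id|apply cderiv_const].
Qed.

(** * Extreme values on compact sets *)

Definition Cclosed (K : C -> Prop) : Prop :=
  forall z, (forall eps, 0 < eps -> exists w, K w /\ Cmod (w - z) < eps) -> K z.

(** Without a maximum, each [p] in [K] has a point [up p] of [K] with a larger value, still larger
    than [psi] near [p], while points off [K] have neighbourhoods missing [K]. These neighbourhoods
    form a gauge; a finite subcover leaves finitely many values [psi (up p)], and a point of [K]
    dominating them all lies in one of the neighbourhoods. *)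
Lemma evt_max (K : C -> Prop) (psi : C -> R) :
  Cclosed K -> (exists M, forall z, K z -> Cmod z <= M) -> (exists z, K z) ->
  (forall z, K z -> continuous (psi : CU -> RU) z) ->
  exists p, K p /\ forall z, K z -> psi z <= psi p.
Proof.
  intros Hcl [M HM] [z0 Hz0] Hc. apply NNPP. intros Hn.
  assert (Hup : forall p, exists p', K p -> K p' /\ psi p < psi p').
  { intros p. destruct (classic (K p)) as [Hp|Hp]; [|exists p; tauto].
    apply NNPP. intros H. apply Hn. exists p. split; auto. intros z Hz.
    apply Rnot_lt_le. intros L. apply H. exists z. auto. }
  assert (Hup' : exists up : C -> C, forall p, K p -> K (up p) /\ psi p < psi (up p)).
  { exists (fun p => proj1_sig (constructive_indefinite_description _ (Hup p))).
    intros p. destruct (constructive_indefinite_description _ (Hup p)). auto. }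
  destruct Hup' as [up Hu].
  assert (Hdel : forall p : C, exists d, 0 < d /\ forall w, K w -> Cmod (w - p) < d -> K p /\ psi w < psi (up p)).
  { intros p. destruct (classic (K p)) as [Hp|Hp].
    - destruct (Hu p Hp) as [_ L].
      destruct (proj1 (continuous_C_RU _ _) (Hc p Hp) (psi (up p) - psi p) ltac:(lra)) as [d [Hd Hw]].
      exists d. split; auto. intros w _ Hw'. split; auto. specialize (Hw w Hw'). apply Rabs_def2 in Hw. lra.
    - apply NNPP. intros H. apply Hp, Hcl. intros eps He. apply NNPP. intros H'.
      apply H. exists eps. split; auto. intros w Kw Hw. exfalso. apply H'. eauto. }
  (* Half the radius: the gauge controls the two coordinates separately, and [Cmod] is at most the
     sum of their absolute values. *)
  set (del := fun t : Compactness.Tn 2 R => let '(x, (y, _)) := t in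
     proj1_sig (constructive_indefinite_description _ (Hdel (x, y))) / 2).
  assert (Hdel0 : forall t, 0 < del t).
  { intros [x [y []]]. unfold del. destruct (constructive_indefinite_description _ (Hdel (x, y))) as [d [Hd Hd']].
    simpl. lra. }
  set (delta := fun t => mkposreal (del t) (Hdel0 t)).
  assert (HB : 0 <= M) by (pose proof (HM z0 Hz0); pose proof (Cmod_ge_0 z0); lra).
  apply (compactness_list 2 (- M, (- M, tt)) (M, (M, tt)) delta). intros [l Hl].
  assert (Hmax : forall l : list (Compactness.Tn 2 R), exists p0, K p0 /\
    forall t, In t l -> let '(x, (y, _)) := t in K (x, y) -> psi (up (x, y)) <= psi p0).
  { clear Hl l. induction l as [|[x [y []]] l IH].
    - exists z0. split; auto. intros t [].
    - destruct IH as [p0 [Kp0 Hp0]]. destruct (classic (K (x, y))) as [Kxy|Kxy].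
      + destruct (Hu _ Kxy) as [Ku _]. destruct (Rle_dec (psi (up (x, y))) (psi p0)) as [L|L].
        * exists p0. split; auto. intros t [<-|Ht]; [auto|apply (Hp0 t Ht)].
        * exists (up (x, y)). split; auto. intros t [<-|Ht]; [intros; lra|].
          specialize (Hp0 t Ht). destruct t as [x' [y' []]]. intros Kt. specialize (Hp0 Kt). lra.
      + exists p0. split; auto. intros t [<-|Ht]; [tauto|apply (Hp0 t Ht)]. }
  destruct (Hmax l) as [p0 [Kp0 Hp0]].
  pose proof (HM p0 Kp0) as Hb. pose proof (re_le_Cmod p0) as H1. pose proof (im_le_Cmod p0) as H2.
  destruct (Hl (Re p0, (Im p0, tt))) as [t [Ht [_ Hclose]]].
  { simpl. split; [apply Rabs_le_between; lra|split; auto]. apply Rabs_le_between; lra. }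
  specialize (Hp0 t Ht). destruct t as [x [y []]]. simpl in Hclose. destruct Hclose as [A [B _]].
  destruct (constructive_indefinite_description _ (Hdel (x, y))) as [d [Hd Hw]]. simpl in A, B.
  destruct (Hw p0 Kp0) as [Kxy L].
  - eapply Rle_lt_trans; [apply Cmod_le_abs|]. unfold Re, Im in *. simpl.
    replace (fst p0 + - x) with (fst p0 - x) by ring. replace (snd p0 + - y) with (snd p0 - y) by ring. lra.
  - specialize (Hp0 Kxy). lra.
Qed.

Lemma evt_min (K : C -> Prop) (psi : C -> R) :
  Cclosed K -> (exists M, forall z, K z -> Cmod z <= M) -> (exists z, K z) ->
  (forall z, K z -> continuous (psi : CU -> RU) z) ->
  exists p, K p /\ forall z, K z -> psi p <= psi z.
Proof.
  intros H1 H2 H3 H4. destruct (evt_max K (fun z => - psi z) H1 H2 H3) as [p [Hp Hm]].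
  - intros z Hz. apply continuous_Ropp. auto.
  - exists p. split; auto. intros z Hz. specialize (Hm z Hz). lra.
Qed.

Lemma Cclosed_le (f g : C -> R) : (forall z, continuous (f : CU -> RU) z) ->
  (forall z, continuous (g : CU -> RU) z) -> Cclosed (fun z => f z <= g z).
Proof.
  intros Hf Hg z H. apply Rnot_lt_le. intros L. destruct (lt_near g f z (Hg z) (Hf z) L) as [d [Hd Hw]].
  destruct (H d Hd) as [w [Kw Hwd]]. specialize (Hw w Hwd). lra.
Qed.

Lemma Cclosed_and K K' : Cclosed K -> Cclosed K' -> Cclosed (fun z => K z /\ K' z).
Proof.
  intros H H' z Hz. split; [apply H|apply H']; intros eps He; destruct (Hz eps He) as [w [[A B] E]]; eauto.
Qed.

(** * Second derivatives at a local maximum *)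

(** The restriction to the line [p + t e] has first derivative [a] and second derivative [b] at
    [t = 0]. A Laplacian is the sum of two such [b], so only one-variable calculus is involved. *)
Definition D2 (phi : C -> R) (p e : C) (a b : R) : Prop :=
  exists phi1 : R -> R, phi1 0 = a /\
    (exists r, 0 < r /\ forall t, Rabs t < r ->
       derivable_pt_lim (fun t => phi (p + RtoC t * e)%C) t (phi1 t)) /\
    derivable_pt_lim phi1 0 b.

Lemma line0 (p e : C) : (p + RtoC 0 * e)%C = p.
Proof. ring. Qed.

Lemma line_small (p e : C) t r : 0 < r -> Rabs t < r / (Cmod e + 1) -> Cmod (p + RtoC t * e - p) < r.
Proof.
  intros Hr Ht. pose proof (Cmod_ge_0 e).
  replace (p + t * e - p)%C with (RtoC t * e)%C by ring. rewrite Cmod_mult, Cmod_R.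
  apply Rmult_lt_compat_r with (r := Cmod e + 1) in Ht; [|lra]. rewrite Rdiv_mul in Ht by lra. pose proof (Rabs_pos t). nra.
Qed.

Lemma derivable_ext_loc (f g : R -> R) x l r : 0 < r -> (forall t, Rabs (t - x) < r -> f t = g t) ->
  derivable_pt_lim f x l -> derivable_pt_lim g x l.
Proof.
  intros Hr E H. apply is_derive_Reals. apply is_derive_Reals in H.
  eapply is_derive_ext_loc; [|exact H]. exists (mkposreal r Hr). intros t Ht. apply E, Ht.
Qed.

Lemma D2_Re (D : C -> Prop) f p e : Copen D -> hol D f -> D p ->
  D2 (fun w => Re (f w)) p e (Re (C_derive f p * e)) (Re (C_derive (C_derive f) p * e * e)).
Proof.
  intros HD Hf Hp. pose proof (hol_deriv_hol D f HD Hf) as Hf'.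
  exists (fun t => Re (C_derive f (p + RtoC t * e) * e)%C). split; [rewrite line0; auto|split].
  - destruct (HD p Hp) as [r [Hr Hin]]. pose proof (Cmod_ge_0 e). exists (r / (Cmod e + 1)).
    split; [apply Rdiv_lt_0_compat; lra|]. intros t Ht. apply derivable_Re_line, (hol_deriv D); auto.
    apply Hin, line_small; auto.
  - apply (derivable_Re_line (fun w => (C_derive f w * e)%C) p e 0). rewrite line0.
    eapply cderiv_eq; [apply cderiv_mult; [apply (hol_deriv D); auto|apply cderiv_const]|]. cbv beta. ring.
Qed.

Lemma D2_plus phi psi p e a b a' b' : D2 phi p e a b -> D2 psi p e a' b' ->
  D2 (fun w => phi w + psi w) p e (a + a') (b + b').
Proof.
  intros [f [Ef [[r [Hr Hf]] Df]]] [g [Eg [[r' [Hr' Hg]] Dg]]].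
  exists (fun t => f t + g t). split; [congruence|split].
  - exists (Rmin r r'). split; [apply Rmin_glb_lt; auto|]. intros t Ht.
    apply (derivable_pt_lim_plus (fun t => phi (p + RtoC t * e)%C) (fun t => psi (p + RtoC t * e)%C)).
    + apply Hf. eapply Rlt_le_trans; [apply Ht|apply Rmin_l].
    + apply Hg. eapply Rlt_le_trans; [apply Ht|apply Rmin_r].
  - apply (derivable_pt_lim_plus f g); auto.
Qed.

Lemma D2_mult phi psi p e a b a' b' : D2 phi p e a b -> D2 psi p e a' b' ->
  D2 (fun w => phi w * psi w) p e (a * psi p + phi p * a') (b * psi p + 2 * a * a' + phi p * b').
Proof.
  intros [f [Ef [[r [Hr Hf]] Df]]] [g [Eg [[r' [Hr' Hg]] Dg]]].
  exists (fun t => f t * psi (p + RtoC t * e)%C + phi (p + RtoC t * e)%C * g t).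
  split; [rewrite line0; congruence|split].
  - exists (Rmin r r'). split; [apply Rmin_glb_lt; auto|]. intros t Ht.
    apply (derivable_pt_lim_mult (fun t => phi (p + RtoC t * e)%C) (fun t => psi (p + RtoC t * e)%C)).
    + apply Hf. eapply Rlt_le_trans; [apply Ht|apply Rmin_l].
    + apply Hg. eapply Rlt_le_trans; [apply Ht|apply Rmin_r].
  - specialize (Hf 0 ltac:(rewrite Rabs_R0; auto)). specialize (Hg 0 ltac:(rewrite Rabs_R0; auto)).
    pose proof (derivable_pt_lim_plus _ _ _ _ _ (derivable_pt_lim_mult _ _ _ _ _ Df Hg)
      (derivable_pt_lim_mult _ _ _ _ _ Hf Dg)) as K.
    cbv beta in K. rewrite line0 in K.
    replace (b * psi p + 2 * a * a' + phi p * b') with (b * psi p + f 0 * g 0 + (f 0 * g 0 + phi p * b'))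
      by (rewrite Ef, Eg; ring). exact K.
Qed.

Lemma D2_ext phi psi p e a b : (forall w, phi w = psi w) -> D2 phi p e a b -> D2 psi p e a b.
Proof.
  intros E [f [Ef [[r [Hr Hf]] Df]]]. exists f. split; auto. split; auto. exists r. split; auto.
  intros t Ht. eapply (derivable_ext_loc _ _ _ _ 1); [lra| |apply Hf; auto]. intros; apply E.
Qed.

Lemma D2_const c p e : D2 (fun _ => c) p e 0 0.
Proof.
  exists (fun _ => 0). split; auto. split; [exists 1; split; [lra|intros]|]; apply derivable_pt_lim_const.
Qed.

Lemma D2_ln phi p e a b : 0 < phi p -> D2 phi p e a b ->
  D2 (fun w => ln (phi w)) p e (a / phi p) (b / phi p - a ^ 2 / phi p ^ 2).
Proof.
  intros Hp [f [Ef [[r [Hr Hf]] Df]]].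
  assert (C0 : continuity_pt (fun t => phi (p + RtoC t * e)%C) 0).
  { apply derivable_continuous_pt. eexists. apply Hf. rewrite Rabs_R0; auto. }
  destruct (C0 (phi p) Hp) as [d [Hd Hw]].
  exists (fun t => f t / phi (p + RtoC t * e)%C). split; [rewrite line0, Ef; auto|split].
  - exists (Rmin r d). split; [apply Rmin_glb_lt; auto|]. intros t Ht.
    assert (0 < phi (p + t * e)%C).
    { destruct (Req_dec t 0) as [->|n]; [rewrite line0; auto|].
      specialize (Hw t). rewrite line0 in Hw.
      assert (L : Rabs (phi (p + t * e)%C - phi p) < phi p).
      { apply Hw. split; [split; [exact I|auto]|]. simpl. unfold Rdist. rewrite Rminus_0_r. 
        eapply Rlt_le_trans; [apply Ht|apply Rmin_r]. }
      apply Rabs_def2 in L. lra. }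
    replace (f t / phi (p + t * e)%C) with (/ phi (p + t * e)%C * f t) by (field; lra).
    apply (derivable_pt_lim_comp (fun t => phi (p + RtoC t * e)%C) ln).
    + apply Hf. eapply Rlt_le_trans; [apply Ht|apply Rmin_l].
    + apply derivable_pt_lim_ln; auto.
  - specialize (Hf 0 ltac:(rewrite Rabs_R0; auto)).
    pose proof (derivable_pt_lim_div f (fun t => phi (p + RtoC t * e)%C) 0 _ _ Df Hf) as K.
    cbv beta in K. rewrite line0, Ef in K.
    replace (b / phi p - a ^ 2 / phi p ^ 2) with ((b * phi p - a * a) / Rsqr (phi p))
      by (unfold Rsqr; field; lra). apply K. lra.
Qed.

Lemma D2_max phi p e a b d : 0 < d -> (forall w, Cmod (w - p) < d -> phi w <= phi p) -> D2 phi p e a b -> b <= 0.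
Proof.
  intros Hd Hmax [f [Ef [[r [Hr Hf]] Df]]]. apply Rnot_lt_le. intros Hb.
  pose proof (Cmod_ge_0 e) as He.
  set (h := fun t => phi (p + RtoC t * e)%C) in *.
  set (d1 := d / (Cmod e + 1)).
  assert (Hd1 : 0 < d1) by (apply Rdiv_lt_0_compat; lra).
  assert (Hm : forall t, Rabs t < d1 -> h t <= h 0).
  { intros t Ht. unfold h. rewrite line0. apply Hmax, line_small; auto. }
  destruct (Df (b / 2) ltac:(lra)) as [[d2 Hd2] Hw]. simpl in Hw.
  set (m := Rmin r (Rmin d1 d2)).
  assert (Hm0 : 0 < m) by (repeat apply Rmin_glb_lt; auto).
  assert (m <= r /\ m <= d1 /\ m <= d2).
  { unfold m. pose proof (Rmin_l r (Rmin d1 d2)). pose proof (Rmin_r r (Rmin d1 d2)).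
    pose proof (Rmin_l d1 d2). pose proof (Rmin_r d1 d2). lra. }
  assert (Hf1 : forall t, t <> 0 -> Rabs t < m -> b / 2 < (f t - f 0) / t).
  { intros t Ht Htm. specialize (Hw t Ht ltac:(lra)). rewrite Rplus_0_l in Hw. apply Rabs_def2 in Hw. lra. }
  assert (MV : forall t, 0 < Rabs t < m -> exists s, (0 < s < t \/ t < s < 0) /\ h t - h 0 = f s * t).
  { intros t [Ht Htm].
    assert (Hder : forall x, Rabs x <= Rabs t -> derivable_pt_lim h x (f x)) by (intros; apply Hf; lra).
    destruct (Rle_lt_dec 0 t) as [L|L].
    - assert (t <> 0) by (intros ->; rewrite Rabs_R0 in Ht; lra).
      rewrite (Rabs_right t) in Hder by lra.
      destruct (MVT_cor2 h f 0 t) as [s [E Hs]]; [lra| |].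
      + intros c Hc. apply Hder. rewrite Rabs_right; lra.
      + exists s. split; [left; lra|]. rewrite E. ring.
    - rewrite (Rabs_left t) in Hder by lra.
      destruct (MVT_cor2 h f t 0) as [s [E Hs]]; [lra| |].
      + intros c Hc. apply Hder. rewrite Rabs_left1; lra.
      + exists s. split; [right; lra|]. lra. }
  (* the second derivative being positive, [h] exceeds [h 0] on the side to which [f 0] points *)
  destruct (Rle_lt_dec 0 (f 0)) as [L|L].
  - destruct (MV (m / 2)) as [s [Hs E]]; [rewrite Rabs_right; lra|].
    destruct Hs as [Hs|Hs]; [|lra].
    specialize (Hf1 s ltac:(lra) ltac:(rewrite Rabs_right; lra)).
    specialize (Hm (m / 2) ltac:(rewrite Rabs_right; lra)).
    assert (b / 2 * s < f s - f 0).
    { apply Rmult_lt_compat_r with (r := s) in Hf1; [|lra].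
      replace ((f s - f 0) / s * s) with (f s - f 0) in Hf1 by (field; lra). lra. }
    assert (0 < f s) by nra. nra.
  - destruct (MV (- (m / 2))) as [s [Hs E]]; [rewrite Rabs_left; lra|].
    destruct Hs as [Hs|Hs]; [lra|].
    specialize (Hf1 s ltac:(lra) ltac:(rewrite Rabs_left; lra)).
    specialize (Hm (- (m / 2)) ltac:(rewrite Rabs_left; lra)).
    assert (f s - f 0 < b / 2 * s).
    { apply Rmult_lt_compat_r with (r := - s) in Hf1; [|lra].
      replace ((f s - f 0) / s * - s) with (- (f s - f 0)) in Hf1 by (field; lra). lra. }
    assert (f s < 0) by nra. nra.
Qed.

(* [Lap phi p gx gy L]: gradient and Laplacian of [phi] at [p]. *)
Definition Lap (phi : C -> R) (p : C) (gx gy L : R) : Prop :=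
  exists bx b_y, D2 phi p 1 gx bx /\ D2 phi p Ci gy b_y /\ L = bx + b_y.

Lemma Lap_eq phi p gx gy L gx' gy' L' : Lap phi p gx gy L -> gx = gx' -> gy = gy' -> L = L' ->
  Lap phi p gx' gy' L'.
Proof. intros; subst; auto. Qed.

Lemma Lap_Re (D : C -> Prop) f p : Copen D -> hol D f -> D p ->
  Lap (fun w => Re (f w)) p (Re (C_derive f p)) (- Im (C_derive f p)) 0.
Proof.
  intros HD Hf Hp. eexists _, _. split; [|split].
  - replace (Re (C_derive f p)) with (Re (C_derive f p * 1)%C) by (f_equal; ring).
    apply (D2_Re D); auto.
  - replace (- Im (C_derive f p)) with (Re (C_derive f p * Ci)%C) by (reim; ring).
    apply (D2_Re D); auto.
  - reim; ring.
Qed.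

Lemma Lap_plus phi psi p a b c a' b' c' : Lap phi p a b c -> Lap psi p a' b' c' ->
  Lap (fun w => phi w + psi w) p (a + a') (b + b') (c + c').
Proof.
  intros [x [y [H1 [H2 E]]]] [x' [y' [H1' [H2' E']]]]. eexists _, _.
  split; [apply D2_plus; eauto|split; [apply D2_plus; eauto|]]. lra.
Qed.

Lemma Lap_const k p : Lap (fun _ => k) p 0 0 0.
Proof. exists 0, 0. split; [apply D2_const|split; [apply D2_const|ring]]. Qed.

Lemma Lap_mult phi psi p a b c a' b' c' : Lap phi p a b c -> Lap psi p a' b' c' ->
  Lap (fun w => phi w * psi w) p (a * psi p + phi p * a') (b * psi p + phi p * b')
    (c * psi p + 2 * (a * a' + b * b') + phi p * c').
Proof.
  intros [x [y [H1 [H2 E]]]] [x' [y' [H1' [H2' E']]]]. eexists _, _.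
  split; [apply D2_mult; eauto|split; [apply D2_mult; eauto|]]. subst. ring.
Qed.

Lemma Lap_scal k phi p a b c : Lap phi p a b c -> Lap (fun w => k * phi w) p (k * a) (k * b) (k * c).
Proof. intros H. eapply Lap_eq; [apply Lap_mult; [apply Lap_const|apply H]|cbv beta; ring..]. Qed.

Lemma Lap_ln phi p a b c : 0 < phi p -> Lap phi p a b c ->
  Lap (fun w => ln (phi w)) p (a / phi p) (b / phi p) (c / phi p - (a ^ 2 + b ^ 2) / phi p ^ 2).
Proof.
  intros Hp [x [y [H1 [H2 E]]]]. eexists _, _.
  split; [apply D2_ln; eauto|split; [apply D2_ln; eauto|]]. subst. field. lra.
Qed.

Lemma Lap_ext phi psi p a b c : (forall w, phi w = psi w) -> Lap phi p a b c -> Lap psi p a b c.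
Proof. intros Eq [x [y [H1 [H2 E]]]]. exists x, y. split; [|split]; eauto using D2_ext. Qed.

Lemma Lap_max phi p a b c d : 0 < d -> (forall w, Cmod (w - p) < d -> phi w <= phi p) ->
  Lap phi p a b c -> c <= 0.
Proof.
  intros Hd Hm [x [y [H1 [H2 E]]]]. pose proof (D2_max _ _ _ _ _ _ Hd Hm H1).
  pose proof (D2_max _ _ _ _ _ _ Hd Hm H2). lra.
Qed.

(** [|f|^2] is written as [(Re f)^2 + (Re (- i f))^2], so that [Lap_Re] serves for both squares. *)
Lemma Lap_normsq (D : C -> Prop) f p : Copen D -> hol D f -> D p ->
  Lap (fun w => Cmod (f w) ^ 2) p
    (2 * (Re (f p) * Re (C_derive f p) + Im (f p) * Im (C_derive f p)))
    (2 * (Im (f p) * Re (C_derive f p) - Re (f p) * Im (C_derive f p)))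
    (4 * Cmod (C_derive f p) ^ 2).
Proof.
  intros HD Hf Hp.
  assert (Hg : hol D (fun w => (- Ci * f w)%C)) by (apply hol_mult; auto; apply hol_const).
  assert (Eg : C_derive (fun w => (- Ci * f w)%C) p = (- Ci * C_derive f p)%C).
  { apply C_derive_cderiv, cderiv_scal, (hol_deriv D); auto. }
  pose proof (Lap_Re D f p HD Hf Hp) as L1. pose proof (Lap_Re D _ p HD Hg Hp) as L2.
  rewrite Eg in L2.
  pose proof (Lap_plus _ _ _ _ _ _ _ _ _ (Lap_mult _ _ _ _ _ _ _ _ _ L1 L1) (Lap_mult _ _ _ _ _ _ _ _ _ L2 L2)) as L.
  eapply Lap_ext; [|eapply Lap_eq; [exact L| | |]].
  - intros w. rewrite Cmod_sq. reim. ring.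
  - reim. ring.
  - reim. ring.
  - rewrite Cmod_sq. reim. ring.
Qed.

(** [log |f|] is harmonic off the zeros of [f]. The gradient is left existential, here and in
    [Lap_ln_Re], since at a maximum only the Laplacian is compared. *)
Lemma Lap_ln_normsq (D : C -> Prop) f p : Copen D -> hol D f -> D p -> f p <> 0 ->
  exists a b, Lap (fun w => ln (Cmod (f w) ^ 2)) p a b 0.
Proof.
  intros HD Hf Hp Hn. eexists _, _. eapply Lap_eq; [apply Lap_ln|reflexivity|reflexivity|].
  - apply pow_lt, Cmod_gt_0; auto.
  - apply (Lap_normsq D); auto.
  - assert (E : Cmod (f p) ^ 2 <> 0) by (apply pow_nonzero; apply Cmod_gt_0 in Hn; lra).
    rewrite !Cmod_sq in *. field. auto.
Qed.

Lemma Lap_ln_Re (D : C -> Prop) f p : Copen D -> hol D f -> D p -> 0 < Re (f p) ->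
  exists a b, Lap (fun w => ln (Re (f w))) p a b (- (Cmod (C_derive f p) ^ 2 / Re (f p) ^ 2)).
Proof.
  intros HD Hf Hp Hn. eexists _, _. eapply Lap_eq; [apply Lap_ln|reflexivity|reflexivity|].
  - exact Hn.
  - apply (Lap_Re D); auto.
  - rewrite !Cmod_sq in *. field. lra.
Qed.

(** * Maximum modulus, Schwarz-Pick, zeros *)

Lemma continuous_normsq (D : C -> Prop) q z : hol D q -> D z -> continuous (fun w : CU => Cmod (q w) ^ 2 : RU) z.
Proof. intros Hq Hz. apply continuous_Rpow, continuous_Cmod. apply (hol_cont D); auto. Qed.

(* Adding [del * |w|^2] makes [|q|^2] strictly subharmonic. *)
Lemma max_principle (D K S : C -> Prop) (q : C -> C) (M : R) :
  Copen D -> hol D q -> (forall z, K z -> D z) -> Cclosed K -> (exists A, forall z, K z -> Cmod z <= A) ->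
  (forall z, K z -> S z \/ exists d, 0 < d /\ forall w, Cmod (w - z) < d -> K w) ->
  0 <= M -> (forall z, K z -> S z -> Cmod (q z) <= M) -> forall z, K z -> Cmod (q z) <= M.
Proof.
  intros HD Hq HKD HK [A HA] HS HM HqS z0 Hz0. apply Rnot_lt_le. intros L.
  assert (HA0 : 0 <= A) by (pose proof (HA z0 Hz0); pose proof (Cmod_ge_0 z0); lra).
  (* So small that [del * |w|^2] on [K] stays below the excess [|q z0|^2 - M^2]; then the maximum of
     the sum cannot lie in [S]. *)
  set (del := (Cmod (q z0) ^ 2 - M ^ 2) / (A ^ 2 + 1)).
  assert (Hdel : 0 < del) by (apply Rdiv_lt_0_compat; nra).
  assert (HdA : del * A ^ 2 < Cmod (q z0) ^ 2 - M ^ 2).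
  { replace (Cmod (q z0) ^ 2 - M ^ 2) with (del * (A ^ 2 + 1)) by (unfold del; field; nra). nra. }
  destruct (evt_max K (fun z => Cmod (q z) ^ 2 + del * Cmod z ^ 2) HK (ex_intro _ A HA) (ex_intro _ z0 Hz0))
    as [p [Kp Hp]].
  { intros z Hz. pose proof (continuous_normsq D q z Hq (HKD z Hz)). cont. }
  destruct (HS p Kp) as [Sp|[d [Hd Hdp]]].
  - specialize (HqS p Kp Sp). specialize (Hp z0 Hz0). specialize (HA p Kp).
    pose proof (Cmod_ge_0 (q p)). pose proof (Cmod_ge_0 p). pose proof (Cmod_ge_0 z0).
    assert (Cmod (q p) ^ 2 <= M ^ 2) by (apply pow_incr; lra).
    assert (Cmod p ^ 2 <= A ^ 2) by (apply pow_incr; lra).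
    assert (0 <= Cmod z0 ^ 2) by (apply pow_le; lra). nra.
  - pose proof (Lap_normsq D q p HD Hq (HKD p Kp)) as L1.
    pose proof (Lap_normsq D (fun w => w) p HD (hol_id D) (HKD p Kp)) as L2.
    rewrite (C_derive_cderiv (fun w => w) p 1 (cderiv_id p)), Cmod_1 in L2.
    pose proof (Lap_plus _ _ _ _ _ _ _ _ _ L1 (Lap_scal del _ _ _ _ _ L2)) as L3.
    apply (Lap_max _ _ _ _ _ d Hd) in L3; [|intros w Hw; apply Hp, Hdp, Hw].
    pose proof (pow2_ge_0 (Cmod (C_derive q p))). nra.
Qed.

Lemma limit_ge (h : C -> R) z d : 0 < d -> continuous (h : CU -> RU) z ->
  (forall w, 0 < Cmod (w - z) < d -> 0 <= h w) -> 0 <= h z.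
Proof.
  intros Hd Hc H. apply Rnot_lt_le. intros L.
  destruct (proj1 (continuous_C_RU _ _) Hc (- h z) ltac:(lra)) as [d' [Hd' Hw]].
  set (m := Rmin d d'). assert (Hm : 0 < m) by (apply Rmin_glb_lt; auto).
  assert (m <= d) by apply Rmin_l. assert (m <= d') by apply Rmin_r.
  set (w := (z + RtoC (m / 2))%C).
  assert (E : Cmod (w - z) = m / 2).
  { unfold w. replace (z + RtoC (m / 2) - z)%C with (RtoC (m / 2)) by ring. rewrite Cmod_R. apply Rabs_right. lra. }
  specialize (H w ltac:(lra)). specialize (Hw w ltac:(lra)). apply Rabs_def2 in Hw. lra.
Qed.

(** * The right half-plane, its pseudohyperbolic discs and the Schwarz-Pick inequality *)

Definition RH (w : C) : Prop := 0 < Re w.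

Lemma Copen_RH : Copen RH.
Proof.
  intros z Hz. exists (Re z). split; [exact Hz|]. intros w Hw. unfold RH in *.
  pose proof (re_le_Cmod (w - z)) as H. rewrite Re_minus in H. apply Rabs_le_between in H. lra.
Qed.

Lemma Copen_disk : Copen in_disk.
Proof.
  intros z Hz. exists (1 - Cmod z). unfold in_disk in *. split; [lra|]. intros w Hw.
  pose proof (Cmod_rev w z). lra.
Qed.

(** The pseudohyperbolic distance of the half-plane is [|w - p| / |w + conj p|]; this tells how far
    it is below 1. [disk_identity] plays the same role in the disk. *)
Lemma RH_identity (w p : C) : Cmod (w + Cconj p) ^ 2 = Cmod (w - p) ^ 2 + 4 * Re w * Re p.
Proof. rewrite !Cmod_sq. reim. ring. Qed.

Lemma disk_identity (w c : C) :
  Cmod (1 - Cconj c * w) ^ 2 = Cmod (w - c) ^ 2 + (1 - Cmod w ^ 2) * (1 - Cmod c ^ 2).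
Proof. rewrite !Cmod_sq. reim. ring. Qed.

Lemma RH_add_neq (w p : C) : RH w -> RH p -> (w + Cconj p)%C <> 0.
Proof.
  unfold RH. intros Hw Hp E. apply (f_equal Re) in E. revert E. reim. lra.
Qed.

Section HyperbolicDisc.
Variables (p : C) (R0 : R).
Hypotheses (Hp : RH p) (HR : 0 < R0 < 1).

(** The closed pseudohyperbolic disc of radius [R0] about [p]. Without a division it is visibly
    closed in the whole plane; [HD_RH] shows that it stays in the half-plane. *)
Definition HD (w : C) : Prop := Cmod (w - p) <= R0 * Cmod (w + Cconj p).

Lemma HD_RH w : HD w -> RH w.
Proof.
  unfold HD, RH in *. intros H. apply Rnot_le_lt. intros L.
  pose proof (RH_identity w p) as E. pose proof (Cmod_ge_0 (w - p)). pose proof (Cmod_ge_0 (w + Cconj p)).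
  assert (Re w * Re p <= 0) by nra.
  assert (Cmod (w - p) ^ 2 <= R0 ^ 2 * Cmod (w + Cconj p) ^ 2) by (rewrite <- Rpow_mult_distr; apply pow_incr; lra).
  assert (R0 ^ 2 < 1) by nra.
  assert (E0 : Cmod (w + Cconj p) ^ 2 = 0) by nra.
  assert (E1 : Cmod (w + Cconj p) = 0) by nra. assert (E2 : Cmod (w - p) = 0) by nra.
  apply Cmod_eq_0 in E1, E2. apply (f_equal Re) in E1, E2. revert E1 E2. reim. lra.
Qed.

Lemma HD_closed : Cclosed HD.
Proof.
  apply Cclosed_le; intros z; cont.
Qed.

Lemma HD_bounded : exists A, forall w, HD w -> Cmod w <= A.
Proof.
  exists (2 * Cmod p / (1 - R0)). intros w H. unfold HD in H.
  pose proof (Cmod_triangle w (Cconj p)). rewrite Cmod_conj in H0. pose proof (Cmod_rev w p).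
  apply Rmult_le_reg_r with (1 - R0); [lra|]. rewrite Rdiv_mul by lra.
  pose proof (Cmod_ge_0 p). pose proof (Cmod_ge_0 w). nra.
Qed.

Lemma HD_interior w : Cmod (w - p) < R0 * Cmod (w + Cconj p) ->
  exists d, 0 < d /\ forall u, Cmod (u - w) < d -> Cmod (u - p) < R0 * Cmod (u + Cconj p).
Proof.
  intros L. apply (lt_near (fun u => Cmod (u - p)) (fun u => R0 * Cmod (u + Cconj p)) w); auto; cont.
Qed.
End HyperbolicDisc.

Lemma Rle_of_inv_bounds (x y r : R) : r < 1 -> (forall R0, r <= R0 -> 0 < R0 < 1 -> x * R0 <= y) -> x <= y.
Proof.
  intros Hr H. apply Rnot_lt_le. intros L.
  destruct (Rle_lt_dec y 0) as [Hy|Hy].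
  - set (R0 := Rmax (1/2) r). assert (r <= R0) by apply Rmax_r. assert (1/2 <= R0) by apply Rmax_l.
    assert (R0 < 1) by (apply Rmax_lub_lt; lra).
    specialize (H R0 ltac:(lra) ltac:(lra)). destruct (Rle_lt_dec x 0); nra.
  - assert (Hxy : 0 < y / x < 1).
    { split; [apply Rdiv_lt_0_compat; lra|]. apply Rmult_lt_reg_r with x; [lra|]. rewrite Rdiv_mul by lra. lra. }
    set (R0 := Rmax ((1 + y / x) / 2) r). assert (r <= R0) by apply Rmax_r.
    assert ((1 + y / x) / 2 <= R0) by apply Rmax_l.
    assert (R0 < 1) by (apply Rmax_lub_lt; lra).
    specialize (H R0 ltac:(lra) ltac:(lra)).
    assert (x * (y / x) = y) by (field; lra). nra.
Qed.

(** [N] is [G] followed by the map of the half-plane to the disk that sends [G w0] to 0. Dividing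
    out the zero of [N] at [w0] gives [q], which is at most [1 / R0] on the boundary of the
    pseudohyperbolic disc of radius [R0]; the maximum principle and [R0 -> 1] give [|q| <= 1]. After
    squaring, [RH_identity] cancels the common term. *)
Lemma schwarz_pick (G : C -> C) (w0 w : C) : hol RH G -> (forall w, RH w -> RH (G w)) -> RH w0 -> RH w ->
  Cmod (G w - G w0) ^ 2 * (Re w * Re w0) <= Cmod (w - w0) ^ 2 * (Re (G w) * Re (G w0)).
Proof.
  intros HG HGR Hw0 Hw.
  set (N := fun w => ((G w - G w0) / (G w + Cconj (G w0)))%C).
  assert (HN : hol RH N).
  { apply hol_div.
    - apply hol_minus; [auto|apply hol_const].
    - apply hol_plus; [auto|apply hol_const].
    - intros z Hz. apply RH_add_neq; auto. }
  set (q := fun w => (quot N w0 w * (w + Cconj w0))%C).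
  assert (Hq : hol RH q).
  { apply hol_mult; [apply quot_hol; auto; apply Copen_RH|]. apply hol_plus; [apply hol_id|apply hol_const]. }
  assert (Nw0 : N w0 = 0).
  { unfold N. replace (G w0 - G w0)%C with (RtoC 0) by ring. unfold Cdiv. ring. }
  assert (HNq : forall z, (N z * (z + Cconj w0))%C = ((z - w0) * q z)%C).
  { intros z. unfold q. rewrite (quot_spec N w0 z), Nw0. ring. }
  assert (HN1 : forall z, RH z -> Cmod (N z) <= 1).
  { intros z Hz. pose proof (RH_add_neq _ _ (HGR z Hz) (HGR w0 Hw0)) as Hn. unfold N.
    rewrite Cmod_div by auto. pose proof (RH_identity (G z) (G w0)) as E.
    pose proof (HGR z Hz) as A. pose proof (HGR w0 Hw0) as B. unfold RH in A, B.
    apply Cmod_gt_0 in Hn. apply Rmult_le_reg_r with (Cmod (G z + Cconj (G w0))); auto.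
    rewrite Rdiv_mul by lra. pose proof (Cmod_ge_0 (G z - G w0)). nra. }
  assert (Hwp : forall z, RH z -> 0 < Cmod (z + Cconj w0)) by (intros; apply Cmod_gt_0, RH_add_neq; auto).
  assert (Hr : Cmod (w - w0) / Cmod (w + Cconj w0) < 1).
  { specialize (Hwp w Hw). apply Rmult_lt_reg_r with (Cmod (w + Cconj w0)); auto. rewrite Rdiv_mul by lra. pose proof (RH_identity w w0). pose proof (Cmod_ge_0 (w - w0)).
    unfold RH in *. nra. }
  assert (Q1 : Cmod (q w) <= 1).
  { apply (Rle_of_inv_bounds _ _ _ Hr). intros R0 HrR HR.
    assert (Kw : HD w0 R0 w).
    { unfold HD. specialize (Hwp w Hw). apply Rmult_le_compat_r with (r := Cmod (w + Cconj w0)) in HrR; [|lra].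
      rewrite Rdiv_mul in HrR by lra. lra. }
    assert (B : Cmod (q w) <= / R0).
    { apply (max_principle RH (HD w0 R0) (fun z => Cmod (z - w0) = R0 * Cmod (z + Cconj w0))); auto.
      - apply Copen_RH.
      - apply HD_RH; auto.
      - apply HD_closed.
      - apply HD_bounded; auto.
      - intros z [L|E]; [right|left; auto]. destruct (HD_interior w0 R0 z L) as [d [Hd Hu]].
        exists d. split; auto. intros u Hu'. left. auto.
      - left. apply Rinv_0_lt_compat; lra.
      - intros z Kz Sz. assert (Hz := HD_RH w0 R0 Hw0 HR z Kz). specialize (Hwp z Hz).
        assert (E := f_equal Cmod (HNq z)). rewrite !Cmod_mult, Sz in E.
        specialize (HN1 z Hz). apply Rmult_le_reg_l with (R0 * Cmod (z + Cconj w0)); [nra|].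
        rewrite <- E. replace (R0 * Cmod (z + Cconj w0) * / R0) with (Cmod (z + Cconj w0)) by (field; lra).
        nra. }
    apply Rmult_le_compat_r with (r := R0) in B; [|lra]. rewrite Rinv_l in B by lra. lra. }
  assert (E := f_equal Cmod (HNq w)). rewrite !Cmod_mult in E. unfold N in E.
  pose proof (RH_add_neq _ _ (HGR w Hw) (HGR w0 Hw0)) as Hn.
  rewrite Cmod_div in E by auto. apply Cmod_gt_0 in Hn.
  assert (E2 : Cmod (G w - G w0) * Cmod (w + Cconj w0) <= Cmod (w - w0) * Cmod (G w + Cconj (G w0))).
  { apply Rmult_le_reg_r with (/ Cmod (G w + Cconj (G w0))); [apply Rinv_0_lt_compat; auto|].
    rewrite (Rmult_assoc (Cmod (w - w0))), Rinv_r, Rmult_1_r by lra.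
    unfold Rdiv in E. pose proof (Cmod_ge_0 (w - w0)). nra. }
  pose proof (RH_identity w w0) as I1. pose proof (RH_identity (G w) (G w0)) as I2.
  assert (E3 : (Cmod (G w - G w0) * Cmod (w + Cconj w0)) ^ 2 <= (Cmod (w - w0) * Cmod (G w + Cconj (G w0))) ^ 2).
  { apply pow_incr. split; auto. apply Rmult_le_pos; apply Cmod_ge_0. }
  rewrite !Rpow_mult_distr, I1, I2 in E3. lra.
Qed.

(** Divide the two-point inequality by [|z - w|^2] and let [z] tend to [w]; through [quot] the limit
    is a value of a continuous function. *)
Lemma schwarz_pick_deriv (G : C -> C) (w : C) : hol RH G -> (forall w, RH w -> RH (G w)) -> RH w ->
  Cmod (C_derive G w) * Re w <= Re (G w).
Proof.
  intros HG HGR Hw.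
  set (h := fun z => Re (G z) * Re (G w) - Cmod (quot G w z) ^ 2 * (Re z * Re w)).
  assert (Hq := quot_hol RH G w Copen_RH HG Hw).
  assert (Hh : 0 <= h w).
  { destruct (Copen_RH w Hw) as [d [Hd Hin]]. apply (limit_ge h w d Hd).
    - unfold h. apply continuous_Rminus; apply continuous_Rmult.
      + apply continuous_Re. apply (hol_cont RH); auto.
      + apply continuous_const.
      + apply (continuous_normsq RH); auto.
      + apply continuous_Rmult; [apply continuous_Re, continuous_Cid|apply continuous_const].
    - intros z [Hz1 Hz2]. unfold h. pose proof (schwarz_pick G w z HG HGR Hw (Hin z Hz2)) as SP.
      assert (E : Cmod (G z - G w) = Cmod (z - w) * Cmod (quot G w z)).
      { rewrite <- Cmod_mult. f_equal. rewrite (quot_spec G w z) at 1. ring. }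
      rewrite E, Rpow_mult_distr in SP.
      assert (0 < Cmod (z - w) ^ 2) by (apply pow_lt; auto).
      assert (Cmod (quot G w z) ^ 2 * (Re z * Re w) <= Re (G z) * Re (G w)).
      { apply Rmult_le_reg_l with (Cmod (z - w) ^ 2); auto. lra. }
      lra. }
  unfold h in Hh. replace (quot G w w) with (C_derive G w) in Hh
    by (unfold quot; destruct (Ceq_dec w w); congruence).
  specialize (HGR w Hw). unfold RH in *. pose proof (Cmod_ge_0 (C_derive G w)).
  apply Rnot_lt_le. intros L. nra.
Qed.

(** * Zeros of holomorphic functions in the disk *)

(** Otherwise [g] is divisible by every power [(w - c)^n]. On the boundary of a pseudohyperbolic
    disc about [c] of radius [rho], the cofactor [k] times [(1 - conj c w)^n] is at most
    [M / rho^n], and the maximum principle yields [|g z1| <= M (r1 / rho)^n], which tends to 0.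
    These discs, unlike Euclidean ones about [c], can contain any given [z1]. *)
Lemma finite_multiplicity (g : C -> C) (c : C) : hol in_disk g -> in_disk c ->
  (exists z, in_disk z /\ g z <> 0) ->
  exists m k, hol in_disk k /\ (forall w, in_disk w -> g w = ((w - c) ^ m * k w)%C) /\ k c <> 0.
Proof.
  intros Hg Hc [z1 [Hz1 Hgz1]]. apply NNPP. intros Hno.
  assert (Hall : forall n, exists k, hol in_disk k /\ forall w, in_disk w -> g w = ((w - c) ^ n * k w)%C).
  { induction n as [|n [k [Hk Ek]]].
    - exists g. split; auto. intros; simpl; ring.
    - exists (quot k c). split; [apply quot_hol; auto; apply Copen_disk|].
      intros w Hw. rewrite (Ek w Hw), (quot_spec k c w).
      destruct (Ceq_dec (k c) 0) as [E|E]; [rewrite E; simpl; ring|].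
      exfalso. apply Hno. eauto. }
  unfold in_disk in Hc, Hz1.
  assert (Hcc : 0 < 1 - Cmod c ^ 2) by (pose proof (Cmod_ge_0 c); nra).
  assert (Hneq : forall w, Cmod w < 1 -> 0 < Cmod (1 - Cconj c * w)).
  { intros w Hw. pose proof (disk_identity w c) as I. pose proof (Cmod_ge_0 w).
    assert (0 < (1 - Cmod w ^ 2) * (1 - Cmod c ^ 2)) by (apply Rmult_lt_0_compat; nra).
    pose proof (pow2_ge_0 (Cmod (w - c))). pose proof (Cmod_ge_0 (1 - Cconj c * w)) as [?|E0]; auto.
    rewrite <- E0 in I. nra. }
  pose proof (Hneq z1 Hz1) as Hn1.
  set (r1 := Cmod (z1 - c) / Cmod (1 - Cconj c * z1)).
  assert (Hr1E : Cmod (z1 - c) = r1 * Cmod (1 - Cconj c * z1)) by (unfold r1; field; lra).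
  assert (Hr10 : 0 <= r1) by (apply Rmult_le_pos; [apply Cmod_ge_0|left; apply Rinv_0_lt_compat; auto]).
  assert (Hr1 : r1 < 1).
  { pose proof (disk_identity z1 c) as I. rewrite Hr1E in I. pose proof (Cmod_ge_0 z1).
    assert (0 < (1 - Cmod z1 ^ 2) * (1 - Cmod c ^ 2)) by (apply Rmult_lt_0_compat; nra).
    apply Rnot_le_lt. intros L.
    assert (Cmod (1 - Cconj c * z1) ^ 2 <= (r1 * Cmod (1 - Cconj c * z1)) ^ 2) by (apply pow_incr; nra).
    lra. }
  set (rho := (1 + r1) / 2). assert (Hrho : r1 < rho < 1) by (unfold rho; lra).
  set (K := fun w => Cmod (w - c) <= rho * Cmod (1 - Cconj c * w)).
  assert (Cl : forall z, continuous (fun w : CU => Cmod (w - c) : RU) z).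
  { intros z. cont. }
  assert (Cr : forall z, continuous (fun w : CU => rho * Cmod (1 - Cconj c * w) : RU) z).
  { intros z. cont. }
  assert (HKd : forall w, K w -> in_disk w).
  { unfold K, in_disk. intros w Hw. apply Rnot_le_lt. intros L.
    pose proof (disk_identity w c) as I. pose proof (Cmod_ge_0 (w - c)). pose proof (Cmod_ge_0 (1 - Cconj c * w)).
    assert ((1 - Cmod w ^ 2) * (1 - Cmod c ^ 2) <= 0).
    { assert (1 - Cmod w ^ 2 <= 0) by nra. nra. }
    assert (Cmod (w - c) ^ 2 <= rho ^ 2 * Cmod (1 - Cconj c * w) ^ 2) by (rewrite <- Rpow_mult_distr; apply pow_incr; lra).
    assert (rho ^ 2 < 1) by nra.
    assert (E1 : Cmod (1 - Cconj c * w) ^ 2 = 0) by nra.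
    assert (E2 : Cmod (1 - Cconj c * w) = 0) by nra. assert (E3 : Cmod (w - c) = 0) by nra.
    apply Cmod_eq_0 in E3. assert (w = c) by (replace w with (w - c + c)%C by ring; rewrite E3; ring).
    subst w. lra. }
  assert (HKc : Cclosed K) by (apply Cclosed_le; auto).
  assert (HKb : exists A, forall z, K z -> Cmod z <= A).
  { exists 1. intros z Hz. apply HKd in Hz. unfold in_disk in Hz. lra. }
  assert (Kz1 : K z1) by (unfold K; rewrite Hr1E; nra).
  destruct (evt_max K (fun z => Cmod (g z) : R)) as [pm [_ HM]]; auto; [exists z1; auto| |].
  { intros z Hz. apply continuous_Cmod. apply (hol_cont in_disk); auto. }
  set (M := Cmod (g pm)) in *.
  assert (Hbound : forall n, Cmod (g z1) <= M * (r1 / rho) ^ n).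
  { intros n. destruct (Hall n) as [k [Hk Ek]].
    set (Q := fun w => ((1 - Cconj c * w) ^ n * k w)%C).
    assert (HQ : hol in_disk Q).
    { apply (hol_mult in_disk (fun w => ((1 - Cconj c * w) ^ n)%C)); auto.
      apply (hol_pow in_disk (fun w => (1 - Cconj c * w)%C)). apply hol_minus; [apply hol_const|].
      apply hol_mult; [apply hol_const|apply hol_id]. }
    assert (Hrn : 0 < rho ^ n) by (apply pow_lt; lra).
    assert (B : Cmod (Q z1) <= M / rho ^ n).
    { apply (max_principle in_disk K (fun z => Cmod (z - c) = rho * Cmod (1 - Cconj c * z))); auto.
      - apply Copen_disk.
      - intros z [L|E]; [right|left; auto].
        destruct (lt_near _ _ z (Cl z) (Cr z) L) as [d [Hd Hw]].
        exists d. split; auto. intros u Hu. left. apply Hw, Hu.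
      - apply Rmult_le_pos; [apply Cmod_ge_0|left; apply Rinv_0_lt_compat; auto].
      - intros z Kz Sz. apply Rmult_le_reg_r with (rho ^ n); auto.
        rewrite Rdiv_mul by lra.
        eapply Rle_trans; [|apply (HM z Kz)]. right.
        rewrite (Ek z (HKd z Kz)). unfold Q. rewrite !Cmod_mult, !Cmod_pow, Sz, Rpow_mult_distr. ring. }
    rewrite (Ek z1 Hz1), Cmod_mult, Cmod_pow, Hr1E, Rpow_mult_distr.
    replace (r1 ^ n * Cmod (1 - Cconj c * z1) ^ n * Cmod (k z1)) with (r1 ^ n * Cmod (Q z1))
      by (unfold Q; rewrite Cmod_mult, Cmod_pow; ring).
    replace (M * (r1 / rho) ^ n) with (r1 ^ n * (M / rho ^ n)).
    - apply Rmult_le_compat_l; [apply pow_le; auto|auto].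
    - unfold Rdiv. rewrite Rpow_mult_distr, pow_inv. ring. }
  apply Cmod_gt_0 in Hgz1.
  assert (Hq : Rabs (r1 / rho) < 1).
  { rewrite Rabs_right by (apply Rle_ge, Rmult_le_pos; [auto|left; apply Rinv_0_lt_compat; lra]).
    apply Rmult_lt_reg_r with rho; [lra|]. rewrite Rdiv_mul by lra. lra. }
  assert (HM0 : 0 <= M) by apply Cmod_ge_0.
  destruct (pow_lt_1_zero _ Hq (Cmod (g z1) / (M + 1))) as [n Hn]; [apply Rdiv_lt_0_compat; lra|].
  specialize (Hn n (Nat.le_refl n)). specialize (Hbound n). apply Rabs_def2 in Hn. destruct Hn as [Hn _].
  apply Rmult_lt_compat_r with (r := M + 1) in Hn; [|lra].
  rewrite Rdiv_mul in Hn by lra.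
  assert (0 <= (r1 / rho) ^ n). { apply pow_le, Rmult_le_pos; [auto|left; apply Rinv_0_lt_compat; lra]. }
  nra.
Qed.

Lemma isolated_zeros (g : C -> C) (c : C) : hol in_disk g -> in_disk c ->
  (exists z, in_disk z /\ g z <> 0) ->
  exists d, 0 < d /\ forall w, 0 < Cmod (w - c) < d -> in_disk w /\ g w <> 0.
Proof.
  intros Hg Hc Hn. destruct (finite_multiplicity g c Hg Hc Hn) as [m [k [Hk [Ek Hkc]]]].
  destruct (nonzero_near k c (hol_cont in_disk k c Hk Hc) Hkc) as [d [Hd Hnz]].
  destruct (Copen_disk c Hc) as [r [Hr Hin]].
  exists (Rmin d r). split; [apply Rmin_glb_lt; auto|]. intros w [Hw1 Hw2].
  destruct (Rmin_Rgt_l _ _ _ Hw2) as [Hwd Hwr]. split; [auto|].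
  rewrite (Ek w (Hin w Hwr)). apply Cmult_neq; auto.
  apply Cmod_gt_0. rewrite Cmod_pow. apply pow_lt; auto.
Qed.

Lemma identity_principle (g : C -> C) (c : C) (d : R) : hol in_disk g -> in_disk c -> 0 < d ->
  (forall w, Cmod (w - c) < d -> g w = 0) -> forall z, in_disk z -> g z = 0.
Proof.
  intros Hg Hc Hd H0 z Hz. apply NNPP. intros Hn.
  destruct (isolated_zeros g c Hg Hc) as [d' [Hd' Hnz]]; [eauto|].
  (* A punctured disc about [c] on which [g] both vanishes and does not must be shown nonempty;
     [limit_ge] for the constant -1 does this. *)
  cut (0 <= -1); [lra|]. apply (limit_ge (fun _ => -1) c (Rmin d d')); [apply Rmin_glb_lt; auto|cont|].
  intros w [Hw1 Hw2]. destruct (Rmin_Rgt_l _ _ _ Hw2) as [Hwd Hwd'].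
  destruct (Hnz w (conj Hw1 Hwd')) as [_ []]. auto.
Qed.

Lemma holomorphic_hol f : holomorphic_on_disk f <-> hol in_disk f.
Proof.
  split; intros H z Hz; destruct (H z Hz) as [l Hl]; exists l; apply is_derive_cderiv; auto.
Qed.

(** Near each [z] one has [B' = (w - z)^m k] with [k z <> 0] and [f' = (w - z)^m l], so [l / k]
    continues [f' / B']. The multiplicity condition thus becomes one holomorphic factor. *)
Lemma derivative_quotient (f B : C -> C) : hol in_disk f -> hol in_disk B ->
  (exists z, in_disk z /\ C_derive B z <> 0) -> critical_subcollection B f ->
  exists H, hol in_disk H /\ forall w, in_disk w -> C_derive f w = (H w * C_derive B w)%C.
Proof.
  intros Hf HB Hn Hcrit.
  pose proof (hol_deriv_hol in_disk B Copen_disk HB) as HB'.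
  pose proof (hol_deriv_hol in_disk f Copen_disk Hf) as Hf'.
  assert (Hrep : forall z, exists r : nat * ((C -> C) * (C -> C)), let '(m, (k, l)) := r in
    in_disk z -> hol in_disk k /\ hol in_disk l /\ k z <> 0 /\ (forall w, in_disk w ->
      C_derive B w = ((w - z) ^ m * k w)%C /\ C_derive f w = ((w - z) ^ m * l w)%C)).
  { intros z. destruct (classic (in_disk z)) as [Hz|Hz]; [|exists (O, (B, B)); tauto].
    destruct (finite_multiplicity _ z HB' Hz Hn) as [m [k [Hk [Ek Hkz]]]].
    (* Critical points have multiplicity at least 1, so [m = 0] is outside the hypothesis; then [f']
       itself serves as [l]. *)
    destruct m as [|m].
    - exists (O, (k, C_derive f)). intros _. split; [|split; [|split]]; auto.
      intros w Hw. split; [apply Ek; auto|simpl; ring].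
    - destruct (Hcrit z (S m)) as [_ [l [Hl El]]].
      { split; auto. split; [lia|]. exists k. split; [apply holomorphic_hol; auto|split; auto]. }
      exists (S m, (k, l)). intros _. apply holomorphic_hol in Hl. split; [|split; [|split]]; auto. }
  assert (Hrep' : exists rep : C -> nat * ((C -> C) * (C -> C)), forall z, in_disk z ->
    hol in_disk (fst (snd (rep z))) /\ hol in_disk (snd (snd (rep z))) /\ fst (snd (rep z)) z <> 0 /\
    (forall w, in_disk w -> C_derive B w = ((w - z) ^ fst (rep z) * fst (snd (rep z)) w)%C /\
      C_derive f w = ((w - z) ^ fst (rep z) * snd (snd (rep z)) w)%C)).
  { exists (fun z => proj1_sig (constructive_indefinite_description _ (Hrep z))).
    intros z. destruct (constructive_indefinite_description _ (Hrep z)) as [[m [k l]] P]. exact P. }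
  destruct Hrep' as [rep P].
  (* At a zero of [B'] the value comes from the representation centred at that very point; nearby it
     must agree with [l / k] for the representation centred at [z]. *)
  set (H := fun w => if Ceq_dec (C_derive B w) 0
    then (snd (snd (rep w)) w / fst (snd (rep w)) w)%C else (C_derive f w / C_derive B w)%C).
  exists H. split.
  - intros z Hz. assert (Hzz : H z = H z) by auto. unfold H at 2 in Hzz. specialize (P z Hz).
    destruct (rep z) as [m [k l]]. cbn [fst snd] in Hzz, P. destruct P as [Hk [Hl [Hkz Eq]]].
    destruct (nonzero_near k z (hol_cont in_disk k z Hk Hz) Hkz) as [d [Hd Hnz]].
    destruct (Copen_disk z Hz) as [r [Hr Hin]].
    destruct (Hk z Hz) as [k' Hk']. destruct (Hl z Hz) as [l' Hl'].
    eexists. apply (cderiv_ext_loc (fun w => (l w / k w)%C) _ _ _ (Rmin d r)); [apply Rmin_glb_lt; auto| |].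
    + intros w Hwm. destruct (Rmin_Rgt_l _ _ _ Hwm) as [Hwd Hwr].
      specialize (Hnz w Hwd) as Hkw.
      destruct (Eq w (Hin w Hwr)) as [E1 E2].
      destruct (Ceq_dec w z) as [->|n].
      * rewrite Hzz. destruct (Ceq_dec (C_derive B z) 0) as [e|n]; auto.
        rewrite E1 in n |- *. rewrite E2. field. split; auto. intros E; apply n; rewrite E; ring.
      * apply Cminus_neq in n.
        assert (Hp : ((w - z) ^ m)%C <> 0).
        { apply Cmod_gt_0. rewrite Cmod_pow. apply pow_lt, Cmod_gt_0; auto. }
        unfold H. destruct (Ceq_dec (C_derive B w) 0) as [e|n'].
        { rewrite E1 in e. exfalso. apply (Cmult_neq _ _ Hp Hkw e). }
        rewrite E1, E2. field. auto.
    + apply cderiv_div; eauto.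
  - intros w Hw. unfold H. destruct (Ceq_dec (C_derive B w) 0) as [e|n]; [|field; auto].
    specialize (P w Hw). destruct (rep w) as [m [k l]]. cbn [fst snd] in P.
    destruct P as [Hk [Hl [Hkz Eq]]]. destruct (Eq w Hw) as [E1 E2].
    rewrite e, E2. rewrite e in E1. destruct m as [|m].
    + exfalso. apply Hkz. simpl in E1. rewrite Cmult_1_l in E1. auto.
    + replace (w - w)%C with (RtoC 0) by ring. simpl. ring.
Qed.

(** * A Hopf lemma for the quotient of two hyperbolic derivatives *)

Lemma Cmod_add_conj_le (w p : C) : RH p -> Cmod (w + Cconj p) <= Cmod (w - p) + 2 * Re p.
Proof.
  unfold RH. intros Hp. replace (w + Cconj p)%C with (w - p + RtoC (2 * Re p))%C.
  - eapply Rle_trans; [apply Cmod_triangle|]. rewrite Cmod_R, Rabs_right by lra. lra.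
  - apply Ceq; reim; ring.
Qed.

(** With [t] the pseudohyperbolic distance from [p] this is [t^2 + t^(-2)], and
    [barrier - 2 = (1/t - t)^2] is [4 / sinh^2] of the hyperbolic distance: it vanishes to second
    order at the boundary. Both summands are squared moduli of holomorphic functions, so the
    Laplacian is explicit. *)
Definition barrier (p w : C) : R :=
  Cmod ((w - p) / (w + Cconj p)) ^ 2 + Cmod ((w + Cconj p) / (w - p)) ^ 2.

Lemma barrier_ratio p w t : (w - p)%C <> 0 -> (w + Cconj p)%C <> 0 ->
  Cmod (w - p) = t * Cmod (w + Cconj p) -> barrier p w - 2 = (/ t - t) ^ 2.
Proof.
  intros H1 H2 E. unfold barrier. rewrite !Cmod_div, E by auto. apply Cmod_gt_0 in H1, H2.
  assert (t <> 0) by (intros ->; rewrite E in H1; lra). field. split; lra.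
Qed.

Lemma barrier_Lap p w : RH p -> RH w -> w <> p -> exists a b,
  Lap (barrier p) w a b (16 * Re p ^ 2 * (/ Cmod (w + Cconj p) ^ 4 + / Cmod (w - p) ^ 4)).
Proof.
  intros Hp Hw Hn. set (D := fun w => RH w /\ w <> p).
  assert (HD : Copen D).
  { intros z [Hz Hzn]. destruct (Copen_RH z Hz) as [r [Hr Hin]].
    apply Cminus_neq, Cmod_gt_0 in Hzn. exists (Rmin r (Cmod (z - p))).
    split; [apply Rmin_glb_lt; auto|]. intros u Hu. split.
    - apply Hin. eapply Rlt_le_trans; [apply Hu|apply Rmin_l].
    - intros ->. assert (L := Rlt_le_trans _ _ _ Hu (Rmin_r _ _)). rewrite Cmod_minus_sym in L. lra. }
  assert (Hnum : forall z, cderiv (fun w => (w - p)%C) z 1).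
  { intros z. eapply cderiv_eq; [apply (cderiv_minus (fun w => w)); [apply cderiv_id|apply cderiv_const]|ring]. }
  assert (Hden : forall z, cderiv (fun w => (w + Cconj p)%C) z 1).
  { intros z. eapply cderiv_eq; [apply (cderiv_plus (fun w => w)); [apply cderiv_id|apply cderiv_const]|ring]. }
  assert (H1 : forall z, D z -> cderiv (fun w => ((w - p) / (w + Cconj p))%C) z
     (RtoC (2 * Re p) / ((z + Cconj p) * (z + Cconj p)))).
  { intros z [Hz Hzn]. eapply cderiv_eq; [apply cderiv_div; [apply RH_add_neq; auto|auto|auto]|].
    cbv beta. unfold Cdiv. f_equal. apply Ceq; reim; ring. }
  assert (H2 : forall z, D z -> cderiv (fun w => ((w + Cconj p) / (w - p))%C) z
     (- RtoC (2 * Re p) / ((z - p) * (z - p)))).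
  { intros z [Hz Hzn]. eapply cderiv_eq; [apply cderiv_div; [apply Cminus_neq; auto|auto|auto]|].
    cbv beta. unfold Cdiv. f_equal. apply Ceq; reim; ring. }
  assert (Dw : D w) by (split; auto).
  eexists _, _. eapply Lap_eq; [apply Lap_plus; apply (Lap_normsq D); auto|reflexivity|reflexivity|].
  - intros z Hz. eexists. apply H1; auto.
  - intros z Hz. eexists. apply H2; auto.
  - rewrite (C_derive_cderiv _ _ _ (H1 w Dw)), (C_derive_cderiv _ _ _ (H2 w Dw)).
    pose proof (RH_add_neq _ _ Hw Hp) as N1. pose proof (Cminus_neq _ _ Hn) as N2.
    rewrite !Cmod_div, Cmod_opp, !Cmod_mult, Cmod_R by (apply Cmult_neq; auto).
    unfold RH in Hp. rewrite Rabs_right by lra. apply Cmod_gt_0 in N1, N2. field. split; lra.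
Qed.

Section Hopf.
Variables F G Hq : C -> C.
Hypotheses (HF : hol RH F) (HG : hol RH G) (HHq : hol RH Hq).
Hypotheses (HFR : forall w, RH w -> RH (F w)) (HGR : forall w, RH w -> RH (G w)).
Hypothesis Hfac : forall w, RH w -> C_derive F w = (Hq w * C_derive G w)%C.
Hypothesis Hle : forall w, RH w -> Cmod (Hq w) * Re (G w) <= Re (F w).

(** The quotient of the hyperbolic derivatives of [F] and [G], with [Hq] in place of [F' / G'] so
    that it is meaningful at critical points of [G]. *)
Let U (w : C) : R := Cmod (Hq w) * Re (G w) / Re (F w).

Lemma U_le1 w : RH w -> 0 <= U w <= 1.
Proof.
  intros Hw. specialize (HFR w Hw). specialize (HGR w Hw). specialize (Hle w Hw). unfold RH in *. unfold U.
  split.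
  - apply Rmult_le_pos; [apply Rmult_le_pos; [apply Cmod_ge_0|lra]|left; apply Rinv_0_lt_compat; auto].
  - apply Rmult_le_reg_r with (Re (F w)); auto. rewrite Rdiv_mul by lra. lra.
Qed.

Lemma U_cont w : RH w -> continuous (U : CU -> RU) w.
Proof.
  intros Hw. pose proof (HFR w Hw) as A. unfold RH in A. unfold U. apply continuous_Rmult; [apply continuous_Rmult|].
  - apply continuous_Cmod, (hol_cont RH); auto.
  - apply continuous_Re, (hol_cont RH); auto.
  - apply (continuous_Rinv (fun w : CU => Re (F w))); [lra|]. apply continuous_Re, (hol_cont RH); auto.
Qed.

(* Since [Delta log U = |F'|^2/(Re F)^2 - |G'|^2/(Re G)^2 = (U^2 - 1) |G'|^2/(Re G)^2], an interior
   maximum of [log U + eps * barrier] contradicts Schwarz-Pick. *)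
Lemma no_interior_max p eps w d : RH p -> 0 < eps -> RH w -> w <> p -> 0 < d ->
  1 < U w * exp (eps * (barrier p w - 2)) ->
  (forall z, Cmod (z - w) < d -> RH z /\
     U z * exp (eps * (barrier p z - 2)) <= U w * exp (eps * (barrier p w - 2))) -> False.
Proof.
  intros Hp Heps Hw Hn Hd H1 Hmax.
  assert (HUw : 0 < U w) by (pose proof (exp_pos (eps * (barrier p w - 2))); nra).
  pose proof (HFR w Hw) as HFw. pose proof (HGR w Hw) as HGw. unfold RH in HFw, HGw.
  assert (Hq0 : Hq w <> 0).
  { intros E. unfold U in HUw. rewrite E, Cmod_0, Rmult_0_l in HUw. unfold Rdiv in HUw. lra. }
  destruct (nonzero_near Hq w (hol_cont RH Hq w HHq Hw) Hq0) as [d' [Hd' Hnear]].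
  (* Up to the constant [2 eps] this is [log U + eps (barrier - 2)]; [log |Hq|] is written as half
     of [log |Hq|^2], so that every summand has a known Laplacian. *)
  set (Psi := fun z => / 2 * ln (Cmod (Hq z) ^ 2) + (ln (Re (G z)) + (-1 * ln (Re (F z)) + eps * barrier p z))).
  assert (HPsi : forall z, RH z -> Hq z <> 0 -> ln (U z * exp (eps * (barrier p z - 2))) = Psi z - 2 * eps).
  { intros z Hz Hqz. apply Cmod_gt_0 in Hqz. pose proof (HFR z Hz) as A. pose proof (HGR z Hz) as B.
    unfold RH in A, B. unfold U, Psi.
    rewrite ln_mult, ln_exp; [| |apply exp_pos].
    2: { apply Rdiv_lt_0_compat; auto. apply Rmult_lt_0_compat; auto. }
    unfold Rdiv. rewrite ln_mult, ln_mult, ln_Rinv; auto.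
    - replace (Cmod (Hq z) ^ 2) with (Cmod (Hq z) * Cmod (Hq z)) by ring. rewrite ln_mult by auto. lra.
    - apply Rmult_lt_0_compat; auto.
    - apply Rinv_0_lt_compat; auto. }
  assert (Hloc : forall z, Cmod (z - w) < Rmin d d' -> Psi z <= Psi w).
  { intros z Hz. destruct (Rmin_Rgt_l _ _ _ Hz) as [L1 L2]. destruct (Hmax z L1) as [Hzr Hzm].
    specialize (Hnear z L2) as Hqz.
    cut (Psi z - 2 * eps <= Psi w - 2 * eps); [lra|]. rewrite <- !HPsi by auto.
    apply ln_le; [|auto]. apply Rmult_lt_0_compat; [|apply exp_pos]. unfold U.
    pose proof (HFR z Hzr) as A. pose proof (HGR z Hzr) as B. apply Cmod_gt_0 in Hqz.
    apply Rdiv_lt_0_compat; auto. apply Rmult_lt_0_compat; auto. }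
  destruct (Lap_ln_normsq RH Hq w Copen_RH HHq Hw Hq0) as [a1 [b1 L1]].
  destruct (Lap_ln_Re RH G w Copen_RH HG Hw HGw) as [a2 [b2 L2]].
  destruct (Lap_ln_Re RH F w Copen_RH HF Hw HFw) as [a3 [b3 L3]].
  destruct (barrier_Lap p w Hp Hw Hn) as [a4 [b4 L4]].
  pose proof (Lap_plus _ _ _ _ _ _ _ _ _ (Lap_scal (/ 2) _ _ _ _ _ L1)
    (Lap_plus _ _ _ _ _ _ _ _ _ L2
    (Lap_plus _ _ _ _ _ _ _ _ _ (Lap_scal (-1) _ _ _ _ _ L3) (Lap_scal eps _ _ _ _ _ L4)))) as L.
  apply (Lap_max _ _ _ _ _ (Rmin d d')) in L; [|apply Rmin_glb_lt; auto|exact Hloc].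
  rewrite (Hfac w Hw), Cmod_mult in L.
  pose proof (schwarz_pick_deriv G w HG HGR Hw) as SP.
  pose proof (U_le1 w Hw) as HU1.
  set (x := Re w) in *. set (y := Re p) in *. unfold RH in Hw, Hp. fold x in Hw. fold y in Hp.
  set (g := Cmod (C_derive G w) / Re (G w)).
  assert (Hg0 : 0 <= g) by (apply Rmult_le_pos; [apply Cmod_ge_0|left; apply Rinv_0_lt_compat; auto]).
  assert (Hg : g * x <= 1).
  { unfold g. apply Rmult_le_reg_r with (Re (G w)); auto. 
    replace (Cmod (C_derive G w) / Re (G w) * x * Re (G w)) with (Cmod (C_derive G w) * x) by (field; lra). lra. }
  set (A := Cmod (w + Cconj p) ^ 2). set (b := Cmod (w - p) ^ 2).
  assert (HA : 0 < A) by (apply pow_lt, Cmod_gt_0, RH_add_neq; auto).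
  assert (Hb : 0 < b) by (apply pow_lt, Cmod_gt_0, Cminus_neq; auto).
  assert (HAb : A = b + 4 * x * y) by apply RH_identity.
  replace (Cmod (w + Cconj p) ^ 4) with (A ^ 2) in L by (unfold A; ring).
  replace (Cmod (w - p) ^ 4) with (b ^ 2) in L by (unfold b; ring).
  assert (EL : / 2 * 0 + (- (Cmod (C_derive G w) ^ 2 / Re (G w) ^ 2) + (-1 * - ((Cmod (Hq w) * Cmod (C_derive G w)) ^ 2 / Re (F w) ^ 2)
    + eps * (16 * y ^ 2 * (/ A ^ 2 + / b ^ 2)))) = - ((1 - U w ^ 2) * g ^ 2) + eps * (16 * y ^ 2 * (/ A ^ 2 + / b ^ 2))).
  { unfold U, g. field. repeat split; lra. }
  rewrite EL in L. clear EL.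
  (* From [U exp s > 1] follows [U^2 > exp (- 2 s) >= 1 - 2 s]. *)
  assert (HU2 : 1 - U w ^ 2 < 2 * eps * (barrier p w - 2)).
  { set (s := eps * (barrier p w - 2)) in *.
    assert (E1 : 1 < (U w * exp s) * (U w * exp s)) by nra.
    assert (E2 : exp (- (2 * s)) < U w ^ 2).
    { replace (- (2 * s)) with (- s + - s) by ring. rewrite exp_plus, exp_Ropp.
      pose proof (exp_pos s). apply Rmult_lt_reg_r with (exp s * exp s); [nra|].
      replace (/ exp s * / exp s * (exp s * exp s)) with 1 by (field; lra). lra. }
    pose proof (exp_ineq1_le (- (2 * s))). unfold s in *. lra. }
  assert (Hbar : barrier p w - 2 = 16 * x ^ 2 * y ^ 2 / (A * b)).
  { unfold barrier. rewrite !Cmod_div by (try apply RH_add_neq; try apply Cminus_neq; auto).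
    assert (E : (A - b) ^ 2 = 16 * x ^ 2 * y ^ 2) by (rewrite HAb; ring).
    rewrite <- E. unfold A, b. apply pow_lt with (n := 1%nat) in HA.
    assert (0 < Cmod (w + Cconj p)) by (apply Cmod_gt_0, RH_add_neq; auto).
    assert (0 < Cmod (w - p)) by (apply Cmod_gt_0, Cminus_neq; auto). field. split; lra. }
  (* Here Schwarz-Pick enters, as [g x <= 1]. *)
  assert (K1 : (1 - U w ^ 2) * (g * x) ^ 2 <= 1 - U w ^ 2).
  { assert ((g * x) ^ 2 <= 1) by (assert (0 <= g * x) by nra; nra). assert (0 <= 1 - U w ^ 2) by nra. nra. }
  assert (K2 : x ^ 2 * (eps * (16 * y ^ 2 * (/ A ^ 2 + / b ^ 2))) <= (1 - U w ^ 2) * (g * x) ^ 2) by nra.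
  rewrite Hbar in HU2.
  assert (K3 : x ^ 2 * (eps * (16 * y ^ 2 * (/ A ^ 2 + / b ^ 2))) < 2 * eps * (16 * x ^ 2 * y ^ 2 / (A * b))) by lra.
  (* The special form of the barrier pays off: [1/A^2 + 1/b^2 >= 2/(A b)], so the lower bound that
     the maximum gives for [1 - U^2] is at least the strict upper bound [HU2]. *)
  assert (E : x ^ 2 * (eps * (16 * y ^ 2 * (/ A ^ 2 + / b ^ 2))) - 2 * eps * (16 * x ^ 2 * y ^ 2 / (A * b))
    = 16 * eps * x ^ 2 * y ^ 2 * (/ A - / b) ^ 2) by (field; lra).
  assert (0 <= 16 * eps * x ^ 2 * y ^ 2 * (/ A - / b) ^ 2).
  { apply Rmult_le_pos; [|apply pow2_ge_0]. apply Rmult_le_pos; [|apply pow2_ge_0].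
    apply Rmult_le_pos; [lra|apply pow2_ge_0]. }
  lra.
Qed.

Lemma barrier_cont p w : RH p -> RH w -> w <> p -> continuous (barrier p : CU -> RU) w.
Proof.
  intros Hp Hw Hn. pose proof (RH_add_neq _ _ Hw Hp). pose proof (Cminus_neq _ _ Hn). unfold barrier.
  apply continuous_Rplus; apply continuous_Rpow, continuous_Cmod; apply continuous_Cdiv; auto; cont.
Qed.

(** Let [W = U exp (eps (barrier - 2))] on a pseudohyperbolic annulus about [p]. If [W q > 1], its
    maximum is not on the inner circle, where [eps] makes [W <= 1], nor on the outer one, where the
    barrier is nearly 2 and [W < W q]; and [no_interior_max] excludes the interior. *)
Lemma hopf p : RH p -> Cmod (Hq p) * Re (G p) < Re (F p) ->
  exists eps r, 0 < eps /\ 0 < r < 1 /\ forall w, RH w -> r * Cmod (w + Cconj p) <= Cmod (w - p) ->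
    U w * exp (eps * (barrier p w - 2)) <= 1.
Proof.
  intros Hp Hlt.
  assert (HUp : U p < 1).
  { pose proof (HFR p Hp) as A. unfold RH in A. unfold U.
    apply Rmult_lt_reg_r with (Re (F p)); auto. rewrite Rdiv_mul by lra. lra. }
  pose proof (U_le1 p Hp) as [HUp0 _].
  set (U0 := (1 + U p) / 2). assert (HU0 : U p < U0 < 1) by (unfold U0; lra).
  assert (HU0pos : 0 < U0) by (unfold U0; lra).
  destruct (lt_near U (fun _ => U0) p (U_cont p Hp)) as [d [Hd Hnear]]; [cont|lra|].
  assert (Hp' : 0 < Re p) by exact Hp.
  (* [|w - p| = r |w + conj p|] with [r <= 1/2] gives [|w - p| <= 4 r Re p], which is below [d]: on
     the inner circle [U < U0]. *)
  set (r := Rmin (1 / 2) (d / (8 * Re p))).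
  assert (Hr0 : 0 < r) by (apply Rmin_glb_lt; [lra|apply Rdiv_lt_0_compat; lra]).
  assert (Hr1 : r <= 1 / 2) by apply Rmin_l.
  assert (Hr2 : r * (8 * Re p) <= d).
  { assert (L : r <= d / (8 * Re p)) by apply Rmin_r. apply Rmult_le_compat_r with (r := 8 * Re p) in L; [|lra].
    rewrite Rdiv_mul in L by lra. lra. }
  assert (Hphir : 0 < (/ r - r) ^ 2).
  { apply pow_lt. assert (2 <= / r) by (rewrite <- (Rinv_inv 2); apply Rinv_le_contravar; lra). lra. }
  (* On the inner circle [barrier - 2 = (1/r - r)^2], so the exponential equals [1 / U0] there. *)
  set (eps := - ln U0 / (/ r - r) ^ 2).
  assert (HlnU0 : ln U0 < 0) by (rewrite <- ln_1; apply ln_increasing; lra).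
  assert (Heps : 0 < eps) by (apply Rdiv_lt_0_compat; lra).
  exists eps, r. split; [auto|split; [lra|]].
  intros q Hqr Hqin. apply Rnot_lt_le. intros Hbig.
  set (W := fun w => U w * exp (eps * (barrier p w - 2))) in *. fold (W q) in Hbig.
  assert (Hneq : forall w, RH w -> r * Cmod (w + Cconj p) <= Cmod (w - p) -> w <> p).
  { intros w Hw L ->. replace (p - p)%C with (RtoC 0) in L by ring. rewrite Cmod_0 in L.
    pose proof (RH_add_neq _ _ Hp Hp) as N. apply Cmod_gt_0 in N. nra. }
  set (lam := ln (W q)). assert (Hlam : 0 < lam) by (unfold lam; rewrite <- ln_1; apply ln_increasing; lra).
  pose proof (RH_add_neq _ _ Hqr Hp) as Nq. apply Cmod_gt_0 in Nq.
  set (tq := Cmod (q - p) / Cmod (q + Cconj p)).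
  assert (Htq : Cmod (q - p) = tq * Cmod (q + Cconj p)) by (unfold tq; field; lra).
  assert (Htq1 : tq < 1).
  { pose proof (RH_identity q p) as I. rewrite Htq in I. pose proof (Cmod_ge_0 (q - p)).
    unfold RH in Hqr. assert (0 < Re q * Re p) by nra. apply Rnot_le_lt. intros L.
    assert (Cmod (q + Cconj p) ^ 2 <= (tq * Cmod (q + Cconj p)) ^ 2) by (apply pow_incr; nra). lra. }
  (* The outer radius encloses [q] and is so near 1 that the exponent stays below [lam = ln (W q)]:
     for [R1 >= 3/4] one has [(1/R1 - R1)^2 <= 16 (1 - R1)], which gives at most [lam / 2]. *)
  set (R1 := Rmax (Rmax (3 / 4) tq) (1 - lam / (32 * eps))).
  assert (HR1a : 3 / 4 <= R1) by (eapply Rle_trans; [apply Rmax_l|apply Rmax_l]).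
  assert (HR1b : tq <= R1) by (eapply Rle_trans; [apply Rmax_r|apply Rmax_l]).
  assert (HR1c : 1 - lam / (32 * eps) <= R1) by apply Rmax_r.
  assert (Hle0 : 0 < lam / (32 * eps)) by (apply Rdiv_lt_0_compat; lra).
  assert (HR1 : R1 < 1) by (repeat apply Rmax_lub_lt; lra).
  assert (Hphi1 : eps * (/ R1 - R1) ^ 2 < lam).
  { assert (A : / R1 <= / (3/4)) by (apply Rinv_le_contravar; lra).
    assert (B : / R1 - R1 = (1 - R1) * (1 + R1) * / R1) by (field; lra).
    assert (C1 : 0 < / R1) by (apply Rinv_0_lt_compat; lra).
    assert (Cc : (1 + R1) * / R1 <= 4) by nra.
    assert (C2 : 0 <= / R1 - R1 <= 4 * (1 - R1)).
    { replace (/ R1 - R1) with ((1 - R1) * ((1 + R1) * / R1)) by (rewrite B; ring).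
      assert (0 <= (1 + R1) * / R1) by (apply Rmult_le_pos; lra). split; [apply Rmult_le_pos; lra|].
      rewrite (Rmult_comm 4). apply Rmult_le_compat_l; lra. }
    assert (D : (/ R1 - R1) ^ 2 <= 16 * (1 - R1)).
    { apply Rle_trans with ((4 * (1 - R1)) ^ 2); [apply pow_incr; lra|nra]. }
    assert (E1 : eps * (1 - R1) <= lam / 32).
    { apply Rle_trans with (eps * (lam / (32 * eps))); [apply Rmult_le_compat_l; lra|]. right; field; lra. }
    nra. }
  set (K := fun w => r * Cmod (w + Cconj p) <= Cmod (w - p) /\ HD p R1 w).
  assert (HKR : forall w, K w -> RH w) by (intros w [_ Hw]; apply (HD_RH p R1); auto; lra).
  assert (C1 : forall w, continuous (fun w : CU => Cmod (w - p) : RU) w).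
  { intros. cont. }
  assert (C2 : forall w, continuous (fun w : CU => r * Cmod (w + Cconj p) : RU) w).
  { intros. cont. }
  destruct (evt_max K W) as [w [Kw Hw]].
  { apply Cclosed_and; [apply Cclosed_le; auto|apply HD_closed]. }
  { destruct (HD_bounded p R1 ltac:(lra)) as [A HA]. exists A. intros z [_ Hz]; auto. }
  { exists q. split; auto. unfold HD. rewrite Htq. nra. }
  { intros z Kz. pose proof (HKR z Kz) as Hz. destruct Kz as [Kz _].
    apply continuous_Rmult; [apply U_cont; auto|]. apply continuous_Rexp, continuous_Rmult; [apply continuous_const|].
    apply continuous_Rminus; [apply barrier_cont; auto|apply continuous_const]. }
  assert (Kq : K q) by (split; auto; unfold HD; rewrite Htq; nra).
  specialize (Hw q Kq) as Hwq. pose proof (HKR w Kw) as Hwr. destruct Kw as [Kw1 Kw2].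
  assert (Hwp := Hneq w Hwr Kw1).
  pose proof (RH_add_neq _ _ Hwr Hp) as Nw. pose proof (Cminus_neq _ _ Hwp) as Nw2.
  pose proof (U_le1 w Hwr) as HUw.
  destruct Kw1 as [L1|E1].
  2: { assert (B := barrier_ratio p w r Nw2 Nw (eq_sym E1)).
       assert (HUw' : U w <= U0).
       { assert (Hcl : Cmod (w - p) < d).
         { pose proof (Cmod_add_conj_le w p Hp). pose proof (Cmod_ge_0 (w + Cconj p)). nra. }
         specialize (Hnear w Hcl). cbv beta in Hnear. lra. }
       assert (E : W w <= 1); [|lra].
       unfold W. rewrite B. replace (eps * (/ r - r) ^ 2) with (- ln U0) by (unfold eps, Rdiv; rewrite Rmult_assoc, Rinv_l by lra; ring).
       rewrite exp_Ropp, exp_ln by auto. apply Rmult_le_reg_r with U0; auto.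
       rewrite Rmult_assoc, Rinv_l by lra. lra. }
  unfold HD in Kw2. destruct Kw2 as [L2|E2].
  2: { assert (B := barrier_ratio p w R1 Nw2 Nw E2).
       assert (E : W w < W q); [|lra].
       unfold W at 1. rewrite B. apply Rle_lt_trans with (1 * exp (eps * (/ R1 - R1) ^ 2)).
       - apply Rmult_le_compat_r; [left; apply exp_pos|lra].
       - rewrite Rmult_1_l, <- (exp_ln (W q)) by lra. apply exp_increasing. exact Hphi1. }
  destruct (HD_interior p R1 w L2) as [d1 [Hd1 Hin1]].
  destruct (lt_near _ _ w (C2 w) (C1 w) L1) as [d2 [Hd2 Hin2]].
  apply (no_interior_max p eps w (Rmin d1 d2)); auto.
  - apply Rmin_glb_lt; auto.
  - fold (W w). lra.
  - intros z Hz. destruct (Rmin_Rgt_l _ _ _ Hz) as [Hz1 Hz2].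
    assert (Kz : K z).
    { split; left; [apply Hin2|apply Hin1]; auto. }
    split; [apply HKR; auto|]. apply (Hw z Kz).
Qed.
End Hopf.

(** * Angular derivatives in the half-plane *)

Lemma schwarz_pick_plus (G : C -> C) (w0 w : C) : hol RH G -> (forall w, RH w -> RH (G w)) -> RH w0 -> RH w ->
  Cmod (G w + Cconj (G w0)) ^ 2 * (Re w * Re w0) <= Cmod (w + Cconj w0) ^ 2 * (Re (G w) * Re (G w0)).
Proof.
  intros HG HGR Hw0 Hw. pose proof (schwarz_pick G w0 w HG HGR Hw0 Hw) as SP.
  rewrite (RH_identity (G w) (G w0)), (RH_identity w w0). lra.
Qed.

(** The theorem of Julia and Caratheodory at infinity, with [a] the infimum of [Re G / Re w].
    Subtracting [a w] leaves a self-map of the half-plane, up to [del], with [Re g <= e Re w0] at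
    some [w0]; Schwarz-Pick based at [w0] carries this smallness to far points of every sector. *)
Lemma angular_derivative (G : C -> C) : hol RH G -> (forall w, RH w -> RH (G w)) ->
  exists a, 0 <= a /\ (forall w, RH w -> a * Re w <= Re (G w)) /\
    (forall b, (forall w, RH w -> b * Re w <= Re (G w)) -> b <= a) /\
    forall S eps, 0 < S -> 0 < eps -> exists X, 0 < X /\ forall w, X <= Re w -> Cmod w <= S * Re w ->
      Cmod (G w - a * w) <= eps * Re w /\ Cmod (C_derive G w - a) <= eps.
Proof.
  intros HG HGR.
  (* The infimum is obtained as minus the supremum of the negatives. *)
  destruct (completeness (fun y => exists w, RH w /\ y = - (Re (G w) / Re w))) as [m [Hm1 Hm2]].
  { exists 0. intros y [w [Hw ->]]. specialize (HGR w Hw). unfold RH in *.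
    assert (0 < Re (G w) / Re w) by (apply Rdiv_lt_0_compat; auto). lra. }
  { exists (- (Re (G 1) / Re 1)), 1. split; auto. unfold RH. rewrite Re_RtoC. lra. }
  set (a := - m).
  assert (Ha : forall w, RH w -> a * Re w <= Re (G w)).
  { intros w Hw. specialize (Hm1 _ (ex_intro _ w (conj Hw eq_refl))). unfold RH in Hw. unfold a.
    apply Rmult_le_compat_r with (r := Re w) in Hm1; [|lra].
    replace (- (Re (G w) / Re w) * Re w) with (- Re (G w)) in Hm1 by (field; lra). lra. }
  assert (Hinf : forall b, (forall w, RH w -> b * Re w <= Re (G w)) -> b <= a).
  { intros b Hb. unfold a. cut (m <= - b); [lra|]. apply Hm2. intros y [w [Hw ->]]. specialize (Hb w Hw).
    unfold RH in Hw. apply Ropp_le_contravar. apply Rmult_le_reg_r with (Re w); auto.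
    rewrite Rdiv_mul by lra. lra. }
  exists a. split; [|split; [auto|split; [auto|]]].
  { apply Hinf. intros w Hw. specialize (HGR w Hw). unfold RH in HGR. lra. }
  intros S eps HS Heps. set (e := eps / (2 * (S + 1) ^ 2 + 1)).
  assert (HS2 : 0 < 2 * (S + 1) ^ 2 + 1) by nra.
  assert (He : 0 < e) by (apply Rdiv_lt_0_compat; auto).
  assert (Hee : e * (2 * (S + 1) ^ 2 + 1) = eps) by (unfold e; field; lra).
  assert (Hw0 : exists w0, RH w0 /\ Re (G w0) < (a + e) * Re w0).
  { apply NNPP. intros Hn. assert (a + e <= a); [|lra]. apply Hinf. intros w Hw. apply Rnot_lt_le.
    intros L. apply Hn. eauto. }
  destruct Hw0 as [w0 [Hw0 L0]].
  (* [Re G - a Re w] is only nonnegative; [del] moves [g] into the open half-plane, and half of the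
     slack keeps [Re (g w0) <= e Re w0]. *)
  set (del := ((a + e) * Re w0 - Re (G w0)) / 2). assert (Hdel : 0 < del) by (unfold del; lra).
  set (g := fun w => (G w - (a * w - RtoC del))%C).
  assert (Hgd : forall w, RH w -> cderiv g w (C_derive G w - a)).
  { intros w Hw. eapply cderiv_eq; [apply cderiv_minus; [apply (hol_deriv RH); auto|]|].
    - apply cderiv_minus; [apply cderiv_scal, cderiv_id|apply cderiv_const].
    - ring. }
  assert (Hg : hol RH g) by (intros w Hw; eexists; apply Hgd; auto).
  assert (HgRe : forall w, Re (g w) = Re (G w) - a * Re w + del).
  { intros w. unfold g. reim. ring. }
  assert (HgR : forall w, RH w -> RH (g w)).
  { intros w Hw. unfold RH. rewrite HgRe. specialize (Ha w Hw). lra. }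
  assert (Hg0 : Re (g w0) <= e * Re w0) by (rewrite HgRe; unfold del; lra).
  exists (Cmod w0 + 1 + Cmod (g w0) / e + del / e).
  assert (P1 : 0 <= Cmod (g w0) / e) by (apply Rmult_le_pos; [apply Cmod_ge_0|left; apply Rinv_0_lt_compat; auto]).
  assert (P2 : 0 < del / e) by (apply Rdiv_lt_0_compat; auto). pose proof (Cmod_ge_0 w0) as P3.
  split; [lra|]. intros w HX HSw. assert (Hw : RH w) by (unfold RH; lra).
  pose proof (schwarz_pick_plus g w0 w Hg HgR Hw0 Hw) as SP.
  pose proof (schwarz_pick_deriv g w Hg HgR Hw) as SD.
  rewrite (C_derive_cderiv _ _ _ (Hgd w Hw)) in SD.
  set (N := Cmod (g w + Cconj (g w0))) in *.
  assert (HN1 : Re (g w) <= N).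
  { unfold N. eapply Rle_trans; [|apply re_le_Cmod]. eapply Rle_trans; [|apply Rle_abs].
    reim. specialize (HgR w0 Hw0). unfold RH in HgR. lra. }
  assert (HN0 : 0 < N) by (pose proof (HgR w Hw) as Q; unfold RH in Q; lra).
  set (q := Cmod (w + Cconj w0)) in *. unfold RH in Hw, Hw0.
  assert (Hq : q <= (S + 1) * Re w).
  { unfold q. eapply Rle_trans; [apply Cmod_triangle|]. rewrite Cmod_conj. lra. }
  assert (Hq0 : 0 <= q) by apply Cmod_ge_0.
  (* Schwarz-Pick reads [N^2 Re w Re w0 <= q^2 Re (g w) Re (g w0)]; use [Re (g w) <= N] and
     [Re (g w0) <= e Re w0], and cancel [N Re w0]. *)
  assert (HNw : N * Re w <= e * q ^ 2).
  { apply Rmult_le_reg_r with (N * Re w0); [apply Rmult_lt_0_compat; auto|].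
    replace (N * Re w * (N * Re w0)) with (N ^ 2 * (Re w * Re w0)) by ring.
    eapply Rle_trans; [apply SP|].
    replace (e * q ^ 2 * (N * Re w0)) with (q ^ 2 * (N * (e * Re w0))) by ring.
    apply Rmult_le_compat_l; [apply pow2_ge_0|]. specialize (HgR w Hw). unfold RH in HgR.
    pose proof (HgR : 0 < Re (g w)).
    apply Rmult_le_compat; auto; [lra|]. rewrite HgRe. specialize (Ha w0 Hw0). lra. }
  assert (HN2 : N <= e * (S + 1) ^ 2 * Re w).
  { apply Rmult_le_reg_r with (Re w); auto. eapply Rle_trans; [apply HNw|].
    assert (q ^ 2 <= ((S + 1) * Re w) ^ 2) by (apply pow_incr; lra).
    replace (e * (S + 1) ^ 2 * Re w * Re w) with (e * ((S + 1) * Re w) ^ 2) by ring. nra. }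
  split.
  - replace (G w - a * w)%C with ((g w + Cconj (g w0)) - Cconj (g w0) - RtoC del)%C by (unfold g; ring).
    eapply Rle_trans; [apply Cmod_triangle|]. rewrite Cmod_opp, Cmod_R, (Rabs_right del) by lra.
    assert (T : Cmod (g w + Cconj (g w0) - Cconj (g w0)) <= N + Cmod (g w0)).
    { eapply Rle_trans; [apply Cmod_triangle|]. rewrite Cmod_opp, Cmod_conj. unfold N. lra. }
    assert (E1 : Cmod (g w0) + del <= e * Re w).
    { apply Rle_trans with (e * (Cmod (g w0) / e + del / e)); [right; field; lra|].
      apply Rmult_le_compat_l; lra. }
    assert (E2 : 0 <= e * (S + 1) ^ 2 * Re w) by nra.
    rewrite <- Hee. lra.
  - apply Rmult_le_reg_r with (Re w); auto. eapply Rle_trans; [apply SD|].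
    eapply Rle_trans; [apply HN1|]. eapply Rle_trans; [apply HN2|]. apply Rmult_le_compat_r; [lra|].
    rewrite <- Hee. nra.
Qed.

(** * Cayley transforms *)

Definition cay (eta u : C) : C := ((eta + u) / (eta - u))%C.
Definition icay (xi w : C) : C := (xi * ((w - 1) / (w + 1)))%C.

Lemma cay_den (eta u : C) : on_circle eta -> in_disk u -> (eta - u)%C <> 0.
Proof.
  unfold on_circle, in_disk. intros He Hu. apply Cmod_gt_0. pose proof (Cmod_rev eta u). lra.
Qed.

Lemma circle_neq (eta : C) : on_circle eta -> eta <> 0.
Proof. intros H. apply Cmod_gt_0. unfold on_circle in H. lra. Qed.

Lemma circle_sq (eta : C) : on_circle eta -> Re eta ^ 2 + Im eta ^ 2 = 1.
Proof. unfold on_circle. intros H. rewrite <- Cmod_sq, H. ring. Qed.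

Lemma Re_cay eta u : on_circle eta -> in_disk u -> Re (cay eta u) = (1 - Cmod u ^ 2) / Cmod (eta - u) ^ 2.
Proof.
  intros He Hu. unfold cay. rewrite Re_Cdiv_sq by (apply cay_den; auto).
  f_equal. rewrite Cmod_sq. pose proof (circle_sq eta He). reim. lra.
Qed.

Lemma disk_sq u : in_disk u -> 0 < 1 - Cmod u ^ 2.
Proof. unfold in_disk. intros H. pose proof (Cmod_ge_0 u). nra. Qed.

Lemma cay_RH eta u : on_circle eta -> in_disk u -> RH (cay eta u).
Proof.
  intros He Hu. unfold RH. rewrite Re_cay by auto. pose proof (disk_sq u Hu).
  apply Rdiv_lt_0_compat; auto. apply pow_lt, Cmod_gt_0, cay_den; auto.
Qed.

Lemma icay_den w : RH w -> (w + 1)%C <> 0.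
Proof. unfold RH. intros Hw E. apply (f_equal Re) in E. revert E. reim. lra. Qed.

Lemma icay_disk xi w : on_circle xi -> RH w -> in_disk (icay xi w).
Proof.
  intros Hx Hw. pose proof (icay_den w Hw) as Hd. unfold in_disk, icay.
  rewrite Cmod_mult, Hx, Rmult_1_l, Cmod_div by auto. apply Cmod_gt_0 in Hd.
  apply Rmult_lt_reg_r with (Cmod (w + 1)); auto. rewrite Rdiv_mul by lra.
  rewrite Rmult_1_l. unfold RH in Hw.
  assert (E : Cmod (w + 1) ^ 2 = Cmod (w - 1) ^ 2 + 4 * Re w) by (rewrite !Cmod_sq; reim; ring).
  pose proof (Cmod_ge_0 (w - 1)). apply Rnot_le_lt. intros L.
  assert (Cmod (w + 1) ^ 2 <= Cmod (w - 1) ^ 2) by (apply pow_incr; lra). lra.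
Qed.

Lemma cay_icay xi w : on_circle xi -> RH w -> cay xi (icay xi w) = w.
Proof.
  intros Hx Hw. pose proof (icay_den w Hw). pose proof (circle_neq xi Hx).
  pose proof (cay_den xi _ Hx (icay_disk xi w Hx Hw)) as Hd. unfold cay.
  replace (xi - icay xi w)%C with (xi * 2 / (w + 1))%C by (unfold icay; field; auto).
  replace (xi + icay xi w)%C with (xi * 2 * w / (w + 1))%C by (unfold icay; field; auto).
  field. split; [auto|auto].
Qed.

Lemma icay_cay xi z : on_circle xi -> in_disk z -> icay xi (cay xi z) = z.
Proof.
  intros Hx Hz. pose proof (circle_neq xi Hx). pose proof (cay_den xi z Hx Hz) as Hd. unfold icay.
  replace (cay xi z - 1)%C with (2 * z / (xi - z))%C by (unfold cay; field; auto).
  replace (cay xi z + 1)%C with (2 * xi / (xi - z))%C by (unfold cay; field; auto).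
  field. split; auto.
Qed.

Lemma cay_deriv eta u : on_circle eta -> in_disk u -> cderiv (cay eta) u (2 * eta / ((eta - u) * (eta - u))).
Proof.
  intros He Hu. pose proof (cay_den eta u He Hu). eapply cderiv_eq.
  - apply (cderiv_div (fun u => (eta + u)%C) (fun u => (eta - u)%C)); auto.
    + apply cderiv_plus; [apply cderiv_const|apply cderiv_id].
    + apply cderiv_minus; [apply cderiv_const|apply cderiv_id].
  - cbv beta. field. auto.
Qed.

Lemma icay_deriv xi w : RH w -> cderiv (icay xi) w (2 * xi / ((w + 1) * (w + 1))).
Proof.
  intros Hw. pose proof (icay_den w Hw). eapply cderiv_eq.
  - apply cderiv_scal. apply (cderiv_div (fun w => (w - 1)%C) (fun w => (w + 1)%C)); auto.
    + apply cderiv_minus; [apply cderiv_id|apply cderiv_const].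
    + apply cderiv_plus; [apply cderiv_id|apply cderiv_const].
  - cbv beta. field. auto.
Qed.

(** The conjugate of [f] with [xi] in the source and [eta] in the target both sent to infinity. *)
Definition lift (eta xi : C) (f : C -> C) (w : C) : C := cay eta (f (icay xi w)).

Section Lift.
Variables (eta xi : C) (f : C -> C).
Hypotheses (He : on_circle eta) (Hx : on_circle xi) (Hf : hol in_disk f)
  (Hfd : forall z, in_disk z -> in_disk (f z)).

Lemma lift_RH w : RH w -> RH (lift eta xi f w).
Proof. intros Hw. apply cay_RH; auto. apply Hfd, icay_disk; auto. Qed.

Lemma lift_deriv w : RH w -> cderiv (lift eta xi f) w
  (2 * eta / ((eta - f (icay xi w)) * (eta - f (icay xi w))) *
    (C_derive f (icay xi w) * (2 * xi / ((w + 1) * (w + 1))))).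
Proof.
  intros Hw. pose proof (icay_disk xi w Hx Hw) as Hz.
  apply (cderiv_comp (fun w => f (icay xi w)) (cay eta)).
  - apply (cderiv_comp (icay xi) f); [apply icay_deriv; auto|]. apply (hol_deriv in_disk); auto.
  - apply cay_deriv; auto.
Qed.

Lemma lift_hol : hol RH (lift eta xi f).
Proof. intros w Hw. eexists. apply lift_deriv; auto. Qed.
End Lift.

Lemma on_circle_1 : on_circle 1.
Proof. apply Cmod_1. Qed.

(** Conformal invariance of [cosh^2] of half the hyperbolic distance, which is [|1 - u conj v|^2 /
    ((1 - |u|^2) (1 - |v|^2))] in the disk and [|p + conj q|^2 / (4 Re p Re q)] in the
    half-plane. *)
Lemma Cayley_cross (u v : C) : in_disk u -> in_disk v ->
  Cmod (cay 1 u + Cconj (cay 1 v)) ^ 2 * ((1 - Cmod u ^ 2) * (1 - Cmod v ^ 2)) =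
  4 * Cmod (1 - u * Cconj v) ^ 2 * (Re (cay 1 u) * Re (cay 1 v)).
Proof.
  intros Hu Hv. pose proof on_circle_1 as H1.
  pose proof (cay_den 1 u H1 Hu) as Du. pose proof (cay_den 1 v H1 Hv) as Dv.
  assert (Hv' : in_disk (Cconj v)) by (unfold in_disk; rewrite Cmod_conj; auto).
  pose proof (cay_den 1 _ H1 Hv') as Dv'.
  rewrite !Re_cay by auto.
  assert (E : (cay 1 u + Cconj (cay 1 v))%C = (2 * (1 - u * Cconj v) / ((1 - u) * (1 - Cconj v)))%C).
  { unfold cay. rewrite Cdiv_conj, Cplus_conj, Cminus_conj by auto.
    replace (Cconj 1) with (RtoC 1) by (apply Ceq; simpl; ring). field. auto. }
  rewrite E, Cmod_div by (apply Cmult_neq; auto). rewrite !Cmod_mult, Cmod_R, Rabs_right by lra.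
  replace (Cmod (1 - Cconj v)) with (Cmod (1 - v)).
  2: { rewrite <- (Cmod_conj (1 - v)). f_equal. apply Ceq; reim; ring. }
  apply Cmod_gt_0 in Du, Dv. field. split; lra.
Qed.

(** In this form the inequality can be divided by [1 - |z0|^2] and passed to the limit as [z0] tends
    to the circle, as [julia] does. *)
Lemma schwarz_pick_disk (B : C -> C) (z z0 : C) : hol in_disk B -> (forall z, in_disk z -> in_disk (B z)) ->
  in_disk z -> in_disk z0 ->
  Cmod (1 - B z * Cconj (B z0)) ^ 2 * ((1 - Cmod z ^ 2) * (1 - Cmod z0 ^ 2)) <=
  Cmod (1 - z * Cconj z0) ^ 2 * ((1 - Cmod (B z) ^ 2) * (1 - Cmod (B z0) ^ 2)).
Proof.
  intros HB HBd Hz Hz0. pose proof on_circle_1 as H1.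
  pose proof (schwarz_pick_plus (lift 1 1 B) (cay 1 z0) (cay 1 z) (lift_hol 1 1 B H1 H1 HB HBd)
    (lift_RH 1 1 B H1 H1 HBd) (cay_RH 1 z0 H1 Hz0) (cay_RH 1 z H1 Hz)) as SP.
  unfold lift in SP. rewrite !icay_cay in SP by auto.
  pose proof (Cayley_cross z z0 Hz Hz0) as Q1. pose proof (Cayley_cross _ _ (HBd z Hz) (HBd z0 Hz0)) as Q2.
  pose proof (cay_RH 1 z H1 Hz) as R1. pose proof (cay_RH 1 z0 H1 Hz0) as R2.
  pose proof (cay_RH 1 _ H1 (HBd z Hz)) as R3. pose proof (cay_RH 1 _ H1 (HBd z0 Hz0)) as R4.
  unfold RH in *.
  pose proof (disk_sq _ Hz) as S1. pose proof (disk_sq _ Hz0) as S2.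
  pose proof (disk_sq _ (HBd z Hz)) as S3. pose proof (disk_sq _ (HBd z0 Hz0)) as S4.
  set (p := (1 - Cmod z ^ 2) * (1 - Cmod z0 ^ 2)) in *.
  set (q := (1 - Cmod (B z) ^ 2) * (1 - Cmod (B z0) ^ 2)) in *.
  set (x := Re (cay 1 z) * Re (cay 1 z0)) in *. set (y := Re (cay 1 (B z)) * Re (cay 1 (B z0))) in *.
  assert (0 < p) by (apply Rmult_lt_0_compat; auto). assert (0 < q) by (apply Rmult_lt_0_compat; auto).
  assert (0 < x) by (apply Rmult_lt_0_compat; auto). assert (0 < y) by (apply Rmult_lt_0_compat; auto).
  set (A := Cmod (cay 1 z + Cconj (cay 1 z0)) ^ 2) in *.
  set (A' := Cmod (cay 1 (B z) + Cconj (cay 1 (B z0))) ^ 2) in *.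
  apply Rmult_le_reg_r with (4 * (x * y)); [nra|].
  replace (Cmod (1 - B z * Cconj (B z0)) ^ 2 * p * (4 * (x * y)))
    with (4 * Cmod (1 - B z * Cconj (B z0)) ^ 2 * y * (p * x)) by ring.
  replace (Cmod (1 - z * Cconj z0) ^ 2 * q * (4 * (x * y)))
    with (4 * Cmod (1 - z * Cconj z0) ^ 2 * x * (q * y)) by ring.
  rewrite <- Q1, <- Q2.
  replace (A' * q * (p * x)) with (A' * x * (p * q)) by ring.
  replace (A * p * (q * y)) with (A * y * (p * q)) by ring.
  apply Rmult_le_compat_r; auto. left. apply Rmult_lt_0_compat; auto.
Qed.

(** * Julia's lemma *)

Lemma C_cauchy_complete (u : nat -> C) :
  (forall eps, 0 < eps -> exists N, forall j k, (N <= j)%nat -> (N <= k)%nat -> Cmod (u j - u k) < eps) ->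
  exists l, forall eps, 0 < eps -> exists N, forall n, (N <= n)%nat -> Cmod (u n - l) < eps.
Proof.
  intros H.
  assert (HR : Cauchy_crit (fun n => Re (u n))).
  { intros eps He. destruct (H eps He) as [N HN]. exists N. intros j k Hj Hk. unfold Rdist.
    rewrite <- Re_minus. eapply Rle_lt_trans; [apply re_le_Cmod|]. apply HN; auto. }
  assert (HI : Cauchy_crit (fun n => Im (u n))).
  { intros eps He. destruct (H eps He) as [N HN]. exists N. intros j k Hj Hk. unfold Rdist.
    rewrite <- Im_minus. eapply Rle_lt_trans; [apply im_le_Cmod|]. apply HN; auto. }
  destruct (Rcomplete.R_complete _ HR) as [a Ha]. destruct (Rcomplete.R_complete _ HI) as [b Hb].
  exists (a, b). intros eps He. destruct (Ha (eps / 2) ltac:(lra)) as [N1 H1].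
  destruct (Hb (eps / 2) ltac:(lra)) as [N2 H2]. exists (Nat.max N1 N2). intros n Hn.
  specialize (H1 n ltac:(lia)). specialize (H2 n ltac:(lia)). unfold Rdist in *.
  eapply Rle_lt_trans; [apply Cmod_le_abs|]. rewrite Re_minus, Im_minus. change (Re (a, b)) with a. change (Im (a, b)) with b. lra.
Qed.

(** A passage to the limit in explicit form: for [e <= 1] the replacement of [p'], [q'] by [p], [q]
    costs at most [e K]. *)
Lemma le_of_approx (p q c d : R) : 0 <= p -> 0 <= q -> 0 <= c -> 0 <= d ->
  (forall e, 0 < e -> exists p' q', Rabs (p' - p) <= e /\ Rabs (q' - q) <= e /\ p' ^ 2 * c <= q' ^ 2 * d) ->
  p ^ 2 * c <= q ^ 2 * d.
Proof.
  intros Hp Hq Hc Hd H. apply Rnot_lt_le. intros L.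
  set (K := 2 * p * c + 2 * q * d + d + 1). assert (HK : 0 < K) by (unfold K; nra).
  set (e := Rmin 1 ((p ^ 2 * c - q ^ 2 * d) / (2 * K))).
  assert (He : 0 < e) by (apply Rmin_glb_lt; [lra|apply Rdiv_lt_0_compat; lra]).
  assert (He1 : e <= 1) by apply Rmin_l.
  assert (HeK : e * K <= (p ^ 2 * c - q ^ 2 * d) / 2).
  { apply Rle_trans with ((p ^ 2 * c - q ^ 2 * d) / (2 * K) * K).
    - apply Rmult_le_compat_r; [lra|apply Rmin_r].
    - right. field. lra. }
  destruct (H e He) as [p' [q' [H1 [H2 H3]]]].
  apply Rabs_le_between in H1, H2.
  assert (A : p ^ 2 - 2 * p * e <= p' ^ 2).
  { assert (0 <= p' ^ 2) by apply pow2_ge_0. destruct (Rle_lt_dec p e); [nra|].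
    assert ((p - e) ^ 2 <= p' ^ 2) by (apply pow_incr; lra). nra. }
  assert (B : q' ^ 2 <= q ^ 2 + 2 * q * e + e).
  { assert (0 <= (q + e - q') * (q + e + q')) by (apply Rmult_le_pos; lra).
    assert (e * e <= e * 1) by (apply Rmult_le_compat_l; lra). lra. }
  assert (A' : (p ^ 2 - 2 * p * e) * c <= p' ^ 2 * c) by (apply Rmult_le_compat_r; auto).
  assert (B' : q' ^ 2 * d <= (q ^ 2 + 2 * q * e + e) * d) by (apply Rmult_le_compat_r; auto).
  unfold K in HeK. nra.
Qed.

Lemma conj_cross (u v : C) : Cmod (1 - u * Cconj v) ^ 2 = Cmod (u - v) ^ 2 + (1 - Cmod u ^ 2) * (1 - Cmod v ^ 2).
Proof. rewrite !Cmod_sq. reim. ring. Qed.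

Lemma circle_cross (u v : C) : on_circle v -> Cmod (1 - u * Cconj v) = Cmod (v - u).
Proof.
  intros Hv. pose proof (conj_cross u v) as E. unfold on_circle in Hv. rewrite Hv in E.
  rewrite pow1, Rminus_diag, Rmult_0_r, Rplus_0_r in E.
  rewrite (Cmod_minus_sym v u). pose proof (Cmod_ge_0 (u - v)). pose proof (Cmod_ge_0 (1 - u * Cconj v)).
  apply Rle_antisym; apply Rnot_lt_le; intros L; nra.
Qed.

(* The Schwarz-Pick inequality for the pairs (z_j, z_k) bounds |1 - B(z_j) conj(B(z_k))|, so the
   B(z_k) converge without passing to a subsequence. *)
Lemma julia (B : C -> C) (xi : C) (A : R) : hol in_disk B -> (forall z, in_disk z -> in_disk (B z)) ->
  on_circle xi -> 0 < A ->
  (forall r, 0 < r -> exists z, in_disk z /\ Cmod (z - xi) < r /\ 1 - Cmod (B z) <= A * (1 - Cmod z)) ->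
  exists eta, on_circle eta /\ forall z, in_disk z ->
    Cmod (eta - B z) ^ 2 * (1 - Cmod z ^ 2) <= Cmod (xi - z) ^ 2 * (2 * A * (1 - Cmod (B z) ^ 2)).
Proof.
  intros HB HBd Hxi HA Hz.
  assert (Hpos : forall n, 0 < / (INR n + 1)) by (intros; apply Rinv_0_lt_compat; pose proof (pos_INR n); lra).
  assert (Hch : exists z : nat -> C, forall n, in_disk (z n) /\ Cmod (z n - xi) < / (INR n + 1) /\
     1 - Cmod (B (z n)) <= A * (1 - Cmod (z n))).
  { exists (fun n => proj1_sig (constructive_indefinite_description _ (Hz _ (Hpos n)))).
    intros n. destruct (constructive_indefinite_description _ (Hz _ (Hpos n))). auto. }
  destruct Hch as [z Hzn].
  assert (Hd : forall n, in_disk (z n)) by (intros; apply Hzn).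
  (* The factor 2 comes from [1 - |B|^2 <= 2 (1 - |B|)], together with [1 - |z| <= 1 - |z|^2]. *)
  assert (Hb : forall n, 1 - Cmod (B (z n)) ^ 2 <= 2 * A * (1 - Cmod (z n) ^ 2)).
  { intros n. destruct (Hzn n) as [H1 [_ H3]]. pose proof (HBd _ H1) as H4. unfold in_disk in *.
    pose proof (Cmod_ge_0 (z n)). pose proof (Cmod_ge_0 (B (z n))).
    apply Rle_trans with (2 * (1 - Cmod (B (z n)))); [nra|].
    apply Rle_trans with (2 * (A * (1 - Cmod (z n)))); [lra|].
    assert (1 - Cmod (z n) <= 1 - Cmod (z n) ^ 2) by nra. nra. }
  assert (Hcross : forall u v, in_disk v -> Cmod (1 - u * Cconj v) <= Cmod (xi - u) + Cmod (xi - v)).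
  { intros u v Hv. unfold in_disk in Hv.
    assert (E : (1 - u * Cconj v)%C = ((xi - u) * Cconj v + xi * Cconj (xi - v))%C).
    { rewrite Cminus_conj.
      replace (RtoC 1) with (xi * Cconj xi)%C; [ring|].
      rewrite <- Cmod2_conj. unfold on_circle in Hxi. rewrite Hxi. f_equal. ring. }
    rewrite E. eapply Rle_trans; [apply Cmod_triangle|]. rewrite !Cmod_mult, !Cmod_conj.
    unfold on_circle in Hxi. rewrite Hxi. pose proof (Cmod_ge_0 (xi - u)). nra. }
  assert (HBc : forall j k, Cmod (B (z j) - B (z k)) <= 2 * A * (/ (INR j + 1) + / (INR k + 1))).
  { intros j k. pose proof (schwarz_pick_disk B (z j) (z k) HB HBd (Hd j) (Hd k)) as SP.
    pose proof (disk_sq _ (Hd j)) as D1. pose proof (disk_sq _ (Hd k)) as D2.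
    pose proof (disk_sq _ (HBd _ (Hd j))) as D3. pose proof (disk_sq _ (HBd _ (Hd k))) as D4.
    pose proof (Hb j) as B1. pose proof (Hb k) as B2.
    pose proof (Hcross (z j) (z k) (Hd k)) as X.
    destruct (Hzn j) as [_ [Xj _]]. destruct (Hzn k) as [_ [Xk _]].
    rewrite Cmod_minus_sym in Xj, Xk.
    set (c := Cmod (1 - z j * Cconj (z k))) in *. set (b := Cmod (1 - B (z j) * Cconj (B (z k)))) in *.
    assert (Hc0 : 0 <= c) by apply Cmod_ge_0. assert (Hb0 : 0 <= b) by apply Cmod_ge_0.
    set (d1 := 1 - Cmod (z j) ^ 2) in *. set (d2 := 1 - Cmod (z k) ^ 2) in *.
    assert (Hbc : b ^ 2 <= (2 * A * c) ^ 2).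
    { apply Rmult_le_reg_r with (d1 * d2); [apply Rmult_lt_0_compat; auto|].
      eapply Rle_trans; [apply SP|].
      replace ((2 * A * c) ^ 2 * (d1 * d2)) with (c ^ 2 * ((2 * A * d1) * (2 * A * d2))) by ring.
      apply Rmult_le_compat_l; [apply pow2_ge_0|]. apply Rmult_le_compat; lra. }
    assert (Hbc' : b <= 2 * A * c) by (apply Rnot_lt_le; intros L; assert (0 <= 2 * A * c) by nra; nra).
    pose proof (conj_cross (B (z j)) (B (z k))) as I. fold b in I.
    pose proof (Cmod_ge_0 (B (z j) - B (z k))).
    assert (Cmod (B (z j) - B (z k)) <= b).
    { apply Rnot_lt_le; intros L. assert (0 < (1 - Cmod (B (z j)) ^ 2) * (1 - Cmod (B (z k)) ^ 2)) by (apply Rmult_lt_0_compat; auto). nra. }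
    nra. }
  assert (Hsmall : forall e, 0 < e -> exists N, forall n, (N <= n)%nat -> / (INR n + 1) < e).
  { intros e He. destruct (archimed_cor1 e He) as [N [HN HN0]]. exists N. intros n Hn.
    eapply Rle_lt_trans; [|apply HN]. apply Rinv_le_contravar; [apply lt_0_INR; auto|].
    apply le_INR in Hn. lra. }
  destruct (C_cauchy_complete (fun n => B (z n))) as [eta Heta].
  { intros e He. destruct (Hsmall (e / (4 * A)) ltac:(apply Rdiv_lt_0_compat; lra)) as [N HN].
    exists N. intros j k Hj Hk. eapply Rle_lt_trans; [apply HBc|]. specialize (HN j Hj) as Hj'. specialize (HN k Hk).
    apply Rlt_le_trans with (2 * A * (e / (4 * A) + e / (4 * A))).
    - apply Rmult_lt_compat_l; lra.
    - right. field. lra. }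
  (* [1 - |B (z n)| <= A (1 - |z n|)] tends to 0, so the limit is unimodular. *)
  assert (Hon : on_circle eta).
  { unfold on_circle. apply Rminus_diag_uniq, small_zero. intros e He.
    set (e' := e / (A + 1)). assert (He' : 0 < e') by (apply Rdiv_lt_0_compat; lra).
    destruct (Heta e' He') as [N1 HN1]. destruct (Hsmall e' He') as [N2 HN2].
    set (n := Nat.max N1 N2). specialize (HN1 n ltac:(lia)). specialize (HN2 n ltac:(lia)).
    destruct (Hzn n) as [H1 [H2 H3]]. pose proof (HBd _ H1) as H4. unfold in_disk in *.
    pose proof (Cmod_rev eta (B (z n))). pose proof (Cmod_rev (B (z n)) eta).
    rewrite (Cmod_minus_sym eta) in *. pose proof (Cmod_rev xi (z n)) as H5.
    rewrite Cmod_minus_sym in H5. unfold on_circle in Hxi.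
    assert (A * (1 - Cmod (z n)) <= A * e') by (apply Rmult_le_compat_l; lra).
    assert (e' * (A + 1) = e) by (unfold e'; field; lra).
    apply Rabs_le. nra. }
  exists eta. split; auto. intros w Hw.
  rewrite <- (circle_cross (B w) eta Hon), <- (circle_cross w xi Hxi).
  pose proof (disk_sq _ Hw) as D1. pose proof (disk_sq _ (HBd _ Hw)) as D2.
  apply le_of_approx; try apply Cmod_ge_0; [lra| nra|].
  intros e He. destruct (Heta e He) as [N1 HN1]. destruct (Hsmall e He) as [N2 HN2].
  set (n := Nat.max N1 N2). specialize (HN1 n ltac:(lia)). specialize (HN2 n ltac:(lia)).
  exists (Cmod (1 - B w * Cconj (B (z n)))), (Cmod (1 - w * Cconj (z n))).
  assert (Hdiff : forall u v v' : C, in_disk u -> Cmod (v - v') < e ->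
    Rabs (Cmod (1 - u * Cconj v) - Cmod (1 - u * Cconj v')) <= e).
  { intros u v v' Hu Hv. unfold in_disk in Hu.
    pose proof (Cmod_rev (1 - u * Cconj v) (1 - u * Cconj v')) as R1.
    pose proof (Cmod_rev (1 - u * Cconj v') (1 - u * Cconj v)) as R2.
    rewrite (Cmod_minus_sym (1 - u * Cconj v')) in R2.
    replace (1 - u * Cconj v - (1 - u * Cconj v'))%C with (- (u * Cconj (v - v')))%C in R1, R2
      by (rewrite Cminus_conj; ring).
    rewrite Cmod_opp, Cmod_mult, Cmod_conj in R1, R2.
    pose proof (Cmod_ge_0 u). pose proof (Cmod_ge_0 (v - v')).
    assert (Cmod u * Cmod (v - v') <= e) by nra. apply Rabs_le. lra. }
  split; [apply Hdiff; auto|]. split; [apply Hdiff; auto; destruct (Hzn n) as [_ [? _]]; lra|].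
  (* Schwarz-Pick for the pair [w], [z n]; by [Hb] the factor [1 - |B (z n)|^2] is at most [2 A]
     times the factor to be cancelled. *)
  pose proof (schwarz_pick_disk B w (z n) HB HBd Hw (Hd n)) as SP.
  pose proof (disk_sq _ (Hd n)) as D3. specialize (Hb n).
  apply Rmult_le_reg_r with (1 - Cmod (z n) ^ 2); auto.
  eapply Rle_trans; [|eapply Rle_trans; [apply SP|]]; [right; ring|].
  rewrite (Rmult_assoc (Cmod (1 - w * Cconj (z n)) ^ 2)).
  apply Rmult_le_compat_l; [apply pow2_ge_0|].
  replace (2 * A * (1 - Cmod (B w) ^ 2) * (1 - Cmod (z n) ^ 2))
    with ((1 - Cmod (B w) ^ 2) * (2 * A * (1 - Cmod (z n) ^ 2))) by ring.
  apply Rmult_le_compat_l; lra.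
Qed.

(** * Comparison along cones *)

(* [V = log (Re F / Re G)] strictly decreases in the direction [conj (G' w)], which points into the
   cone with vertex [w0]; so [V - k / (Re w)^2], which tends to 0 at infinity, cannot have a
   negative minimum on that cone. *)
Lemma cone_comparison (F G : C -> C) (S b k X : R) : hol RH F -> hol RH G ->
  (forall w, RH w -> RH (F w)) -> (forall w, RH w -> RH (G w)) ->
  1 <= S -> 0 < X -> 0 <= b -> 2 * k < b ->
  (forall w, X <= Re w -> Rabs (Im w) <= S * Re w ->
    2 * Rabs (Im (C_derive G w)) < Re (C_derive G w) /\
    Cmod (C_derive F w) / Re (F w) <= Cmod (C_derive G w) / Re (G w) - b / Re w ^ 3) ->
  (forall eps, 0 < eps -> exists Y, forall w, Y <= Re w -> Rabs (Im w) <= S * Re w ->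
    Rabs (ln (Re (F w)) - ln (Re (G w))) <= eps) ->
  forall w, X <= Re w -> Rabs (Im w) <= S * Re w -> k / Re w ^ 2 <= ln (Re (F w)) - ln (Re (G w)).
Proof.
  intros HF HG HFR HGR HS HX Hb Hk Hder Hlim w0 HX0 HS0. apply Rnot_lt_le. intros Hneg.
  set (W := fun w => ln (Re (F w)) - ln (Re (G w)) - k * / Re w ^ 2).
  assert (HW0 : W w0 < 0) by (unfold W; unfold Rdiv in Hneg; lra).
  (* The cone with vertex [w0] and slope 1 stays in the sector because [S >= 1]. *)
  set (K0 := fun w => Rabs (Im w - Im w0) <= Re w - Re w0).
  assert (HK0 : forall w, K0 w -> X <= Re w /\ Re w0 <= Re w /\ Rabs (Im w) <= S * Re w).
  { intros w Hw. unfold K0 in Hw. pose proof (Rabs_pos (Im w - Im w0)). split; [lra|split; [lra|]].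
    pose proof (Rabs_triang (Im w - Im w0) (Im w0)) as T. replace (Im w - Im w0 + Im w0) with (Im w) in T by ring.
    nra. }
  (* Beyond [Y] the function [W] exceeds [W w0], as it tends to 0 while [W w0 < 0]; so the minimum
     over the cone cut at [Y] is not on the cut. *)
  assert (HY : exists Y, Re w0 < Y /\ forall w, Y <= Re w -> Rabs (Im w) <= S * Re w -> W w0 < W w).
  { destruct (Hlim (- W w0 / 4) ltac:(lra)) as [Y1 HY1].
    set (Y2 := 4 * Rabs k / (- W w0) + 1).
    assert (HY2 : 1 <= Y2).
    { assert (0 <= 4 * Rabs k / - W w0); [|unfold Y2; lra].
      apply Rmult_le_pos; [pose proof (Rabs_pos k); lra|left; apply Rinv_0_lt_compat; lra]. }
    exists (Rmax (Rmax Y1 Y2) (Re w0 + 1)). split; [pose proof (Rmax_r (Rmax Y1 Y2) (Re w0 + 1)); lra|].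
    intros w Hw Hw2. assert (L1 := Rmax_l (Rmax Y1 Y2) (Re w0 + 1)). assert (L2 := Rmax_l Y1 Y2). assert (L3 := Rmax_r Y1 Y2).
    specialize (HY1 w ltac:(lra) Hw2). apply Rabs_le_between in HY1.
    assert (Hkw : k * / Re w ^ 2 <= - W w0 / 4).
    { assert (Hw1 : Y2 <= Re w) by lra. assert (1 <= Re w) by lra.
      apply Rle_trans with (Rabs k * / Re w ^ 2).
      - apply Rmult_le_compat_r; [left; apply Rinv_0_lt_compat, pow_lt; lra|apply Rle_abs].
      - apply Rmult_le_reg_r with (Re w ^ 2); [apply pow_lt; lra|]. rewrite Rmult_assoc, Rinv_l by (apply pow_nonzero; lra).
        assert (4 * Rabs k <= - W w0 * Re w).
        { apply Rle_trans with (- W w0 * (4 * Rabs k / (- W w0))); [right; field; lra|].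
          apply Rmult_le_compat_l; [lra|]. unfold Y2 in Hw1. lra. }
        assert (- W w0 * Re w <= - W w0 * Re w ^ 2) by (apply Rmult_le_compat_l; nra). lra. }
    unfold W at 2. lra. }
  destruct HY as [Y [HY0 HY]].
  set (K := fun w => Rabs (Im w - Im w0) <= Re w - Re w0 /\ Re w <= Y).
  assert (CRe : forall z, continuous (fun w : CU => Re w : RU) z) by (intros; apply continuous_Re, continuous_Cid).
  assert (CIm : forall z, continuous (fun w : CU => Im w : RU) z) by (intros; apply continuous_Im, continuous_Cid).
  destruct (evt_min K W) as [p [Kp Hp]].
  - apply Cclosed_and; apply Cclosed_le; intros z; auto.
    + apply (continuous_Rfun Rabs); [apply Rcontinuity_abs|]. apply continuous_Rminus; [auto|apply continuous_const].
    + apply continuous_Rminus; [auto|apply continuous_const].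
    + apply continuous_const.
  - exists (Y + (Y - Re w0 + Rabs (Im w0))). intros z [Kz1 Kz2]. eapply Rle_trans; [apply Cmod_le_abs|].
    pose proof (Rabs_triang (Im z - Im w0) (Im w0)) as T. replace (Im z - Im w0 + Im w0) with (Im z) in T by ring.
    pose proof (Rabs_pos (Im z - Im w0)). rewrite (Rabs_right (Re z)) by lra. lra.
  - exists w0. split; [|lra]. rewrite !Rminus_diag, Rabs_R0. lra.
  - intros z [Kz1 Kz2]. destruct (HK0 z Kz1) as [Z1 [Z2 Z3]]. assert (Hz : RH z) by (unfold RH; lra).
    pose proof (HFR z Hz) as A1. pose proof (HGR z Hz) as A2. unfold RH in A1, A2.
    apply continuous_Rminus; [apply continuous_Rminus|apply continuous_Rmult; [apply continuous_const|]].
    + apply (continuous_Rln (fun z : CU => Re (F z))); auto. apply continuous_Re, (hol_cont RH); auto.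
    + apply (continuous_Rln (fun z : CU => Re (G z))); auto. apply continuous_Re, (hol_cont RH); auto.
    + apply (continuous_Rinv (fun z : CU => Re z ^ 2)); [apply pow_nonzero; lra|]. apply continuous_Rpow; auto.
  - assert (Kw0 : K w0) by (split; [rewrite !Rminus_diag, Rabs_R0|]; lra).
    pose proof (Hp w0 Kw0) as Hpw0. destruct Kp as [Kp1 Kp2]. destruct (HK0 p Kp1) as [P1 [P2 P3]].
    assert (HpY : Re p < Y).
    { apply Rnot_le_lt. intros L. specialize (HY p L P3). lra. }
    assert (HpR : RH p) by (unfold RH; lra).
    pose proof (HFR p HpR) as A1. pose proof (HGR p HpR) as A2. unfold RH in A1, A2.
    destruct (Hder p P1 P3) as [D1 D2]. set (g := C_derive G p) in *. set (f := C_derive F p) in *.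
    set (e := Cconj g).
    assert (He : Re e = Re g /\ Im e = - Im g) by (unfold e; reim; auto). destruct He as [He1 He2].
    pose proof (Rabs_pos (Im g)) as Ig0.
    assert (dF : derivable_pt_lim (fun t => Re (F (p + RtoC t * e)%C)) 0 (Re (f * e))).
    { apply derivable_Re_line. rewrite line0. apply (hol_deriv RH); auto. }
    assert (dG : derivable_pt_lim (fun t => Re (G (p + RtoC t * e)%C)) 0 (Re (g * e))).
    { apply derivable_Re_line. rewrite line0. apply (hol_deriv RH); auto. }
    assert (dI : derivable_pt_lim (fun t => Re (p + RtoC t * e)%C) 0 (Re (1 * e))).
    { apply (derivable_Re_line (fun w => w)). apply cderiv_id. }
    assert (dlnF : derivable_pt_lim (fun t => ln (Re (F (p + RtoC t * e)%C))) 0 (/ Re (F p) * Re (f * e))).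
    { apply (derivable_pt_lim_comp (fun t => Re (F (p + RtoC t * e)%C)) ln); auto. rewrite line0.
      apply derivable_pt_lim_ln; auto. }
    assert (dlnG : derivable_pt_lim (fun t => ln (Re (G (p + RtoC t * e)%C))) 0 (/ Re (G p) * Re (g * e))).
    { apply (derivable_pt_lim_comp (fun t => Re (G (p + RtoC t * e)%C)) ln); auto. rewrite line0.
      apply derivable_pt_lim_ln; auto. }
    assert (dinv : derivable_pt_lim (fun t => / Re (p + RtoC t * e)%C ^ 2) 0 (- (2 * Re e) / Re p ^ 3)).
    { replace (- (2 * Re e) / Re p ^ 3) with (- 2 / Re p ^ 3 * Re (1 * e)) by (rewrite Cmult_1_l; field; lra).
      apply (derivable_pt_lim_comp (fun t => Re (p + RtoC t * e)%C) (fun x => / x ^ 2)); auto.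
      rewrite line0. apply is_derive_Reals. auto_derive; [nra|]. field. lra. }
    pose proof (derivable_pt_lim_minus _ _ _ _ _ (derivable_pt_lim_minus _ _ _ _ _ dlnF dlnG)
      (derivable_pt_lim_scal _ k _ _ dinv)) as dW.
    set (s := / Re (F p) * Re (f * e) - / Re (G p) * Re (g * e) - k * (- (2 * Re e) / Re p ^ 3)) in dW.
    assert (Hp3 : 0 < / Re p ^ 3) by (apply Rinv_0_lt_compat, pow_lt; lra).
    assert (Hg : Re g <= Cmod g) by (eapply Rle_trans; [apply Rle_abs|apply re_le_Cmod]).
    assert (Hs : s < 0).
    { assert (E1 : Re (g * e) = Cmod g ^ 2) by (unfold e; rewrite Cmod_sq; reim; ring).
      assert (E2 : Re (f * e) <= Cmod f * Cmod g).
      { eapply Rle_trans; [apply Rle_abs|]. eapply Rle_trans; [apply re_le_Cmod|].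
        unfold e. rewrite Cmod_mult, Cmod_conj. lra. }
      assert (E3 : / Re (F p) * Re (f * e) <= Cmod g * (Cmod f / Re (F p))).
      { replace (Cmod g * (Cmod f / Re (F p))) with (/ Re (F p) * (Cmod f * Cmod g)) by (unfold Rdiv; ring).
        apply Rmult_le_compat_l; auto. left. apply Rinv_0_lt_compat; auto. }
      assert (E4 : Cmod g * (Cmod f / Re (F p)) <= Cmod g * (Cmod g / Re (G p) - b / Re p ^ 3)).
      { apply Rmult_le_compat_l; [apply Cmod_ge_0|auto]. }
      assert (E5 : s <= (2 * k * Re g - b * Cmod g) * / Re p ^ 3).
      { unfold s. rewrite E1, He1.
        replace (Cmod g * (Cmod g / Re (G p) - b / Re p ^ 3)) with
          (/ Re (G p) * Cmod g ^ 2 - b * Cmod g * / Re p ^ 3) in E4 by (unfold Rdiv; ring).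
        replace (k * (- (2 * Re g) / Re p ^ 3)) with (- (2 * k * Re g * / Re p ^ 3)) by (unfold Rdiv; ring). lra. }
      eapply Rle_lt_trans; [apply E5|].
      (* For [k >= 0] use [Re g <= |g|] and [2 k < b]; for [k < 0] the left side is negative. *)
      assert (2 * k * Re g < b * Cmod g) by (destruct (Rle_lt_dec 0 k); nra). nra. }
    destruct (dW (- s / 2) ltac:(lra)) as [[d Hd] Hw]. cbn [pos] in Hw.
    (* A step along [e] keeps the point in the cone, as [|Im e| <= Re e]; the second bound keeps it
       before the cut, the first makes the difference quotient less than [s / 2]. *)
    set (t := Rmin (d / 2) ((Y - Re p) / (2 * Re e))).
    assert (Hre : 0 < Re e) by lra.
    assert (Ht0 : 0 < t) by (apply Rmin_glb_lt; [lra|apply Rdiv_lt_0_compat; lra]).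
    assert (Ht1 : t <= d / 2) by apply Rmin_l.
    assert (Ht2 : t * Re e <= (Y - Re p) / 2).
    { apply Rle_trans with ((Y - Re p) / (2 * Re e) * Re e); [apply Rmult_le_compat_r; [lra|apply Rmin_r]|].
      right; field; lra. }
    specialize (Hw t ltac:(lra) ltac:(rewrite Rabs_right; lra)).
    assert (Kt : K (p + RtoC t * e)%C).
    { assert (R1 : Re (p + RtoC t * e)%C = Re p + t * Re e) by (reim; ring).
      assert (I1 : Im (p + RtoC t * e)%C = Im p - t * Im g) by (rewrite <- (Ropp_involutive (Im g)), <- He2; reim; ring).
      split; rewrite R1; [|lra]. rewrite I1.
      replace (Im p - t * Im g - Im w0) with ((Im p - Im w0) + - (t * Im g)) by ring.
      eapply Rle_trans; [apply Rabs_triang|]. rewrite Rabs_Ropp, Rabs_mult, (Rabs_right t) by lra.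
      assert (t * Rabs (Im g) <= t * Re e) by (apply Rmult_le_compat_l; lra). lra. }
    specialize (Hp _ Kt).
    assert (Hquot : (W (p + RtoC t * e)%C - W p) / t < s / 2).
    { rewrite Rplus_0_l in Hw. unfold minus_fct, mult_real_fct in Hw. rewrite line0 in Hw.
      apply Rabs_def2 in Hw. destruct Hw as [Hw _]. unfold W. lra. }
    assert (0 <= (W (p + RtoC t * e)%C - W p) / t).
    { apply Rmult_le_pos; [lra|left; apply Rinv_0_lt_compat; auto]. }
    lra.
Qed.

(** * Rigidity in the half-plane *)

Lemma ln_le_minus1 (x y : R) : 0 < x -> 0 < y -> ln x - ln y <= (x - y) / y.
Proof.
  intros Hx Hy. pose proof (exp_ineq1_le (ln (x / y))) as H.
  assert (0 < x / y) by (apply Rdiv_lt_0_compat; auto). rewrite exp_ln in H by auto.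
  unfold Rdiv in H at 1. rewrite ln_mult, ln_Rinv in H by (auto; apply Rinv_0_lt_compat; auto).
  replace ((x - y) / y) with (x / y - 1) by (field; lra). lra.
Qed.

Lemma ln_close (x y a e t : R) : 0 < a -> 0 < t -> e <= a / 2 ->
  Rabs (x - a * t) <= e * t -> Rabs (y - a * t) <= e * t -> Rabs (ln x - ln y) <= 4 * e / a.
Proof.
  intros Ha Ht He Hx Hy. apply Rabs_le_between in Hx, Hy.
  assert (Het : e * t <= a / 2 * t) by (apply Rmult_le_compat_r; lra).
  assert (Hat : 0 < a * t) by (apply Rmult_lt_0_compat; auto).
  assert (Hone : forall u v, a * t / 2 <= v -> 0 < u -> u - v <= 2 * (e * t) -> ln u - ln v <= 4 * e / a).
  { intros u v Hv Hu Huv. eapply Rle_trans; [apply ln_le_minus1; lra|].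
    apply Rmult_le_reg_r with v; [lra|]. rewrite Rdiv_mul by lra.
    assert (0 <= 4 * e / a) by (apply Rmult_le_pos; [nra|left; apply Rinv_0_lt_compat; auto]).
    apply Rle_trans with (4 * e / a * (a * t / 2)); [|apply Rmult_le_compat_l; auto].
    replace (4 * e / a * (a * t / 2)) with (2 * (e * t)) by (field; lra). lra. }
  assert (A := Hone x y ltac:(lra) ltac:(lra) ltac:(lra)).
  assert (B := Hone y x ltac:(lra) ltac:(lra) ltac:(lra)). apply Rabs_le. lra.
Qed.

Lemma convex_lt (x a b t : R) : 0 <= t <= 1 -> x < a -> x < b -> x < (1 - t) * a + t * b.
Proof.
  intros Ht Ha Hb. destruct (Rle_lt_dec a b).
  - assert (0 <= t * (b - a)) by (apply Rmult_le_pos; lra). lra.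
  - assert (0 <= (1 - t) * (a - b)) by (apply Rmult_le_pos; lra). lra.
Qed.

Lemma Re_close (z : C) a x e : Cmod (z - RtoC a * x) <= e * Re x -> Rabs (Re z - a * Re x) <= e * Re x.
Proof.
  intros H. eapply Rle_trans; [|apply H].
  replace (Re z - a * Re x) with (Re (z - RtoC a * x)) by (reim; ring). apply re_le_Cmod.
Qed.

Lemma sector_Cmod w S : 0 < Re w -> Rabs (Im w) <= S * Re w -> Cmod w <= (1 + S) * Re w.
Proof. intros H1 H2. eapply Rle_trans; [apply Cmod_le_abs|]. rewrite (Rabs_right (Re w)) by lra. lra. Qed.

Lemma near_real_direction (a : R) (g : C) : 0 < a -> Cmod (g - a) <= a / 8 -> 2 * Rabs (Im g) < Re g.
Proof.
  intros Ha Hg. pose proof (re_le_Cmod (g - a)) as B1. pose proof (im_le_Cmod (g - a)) as B2.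
  rewrite Re_minus, Re_RtoC in B1. rewrite Im_minus, Im_RtoC, Rminus_0_r in B2.
  assert (B1' := Rle_trans _ _ _ B1 Hg). apply Rabs_le_between in B1'. lra.
Qed.

Section HalfPlaneRigidity.
Variables (F G Hq : C -> C) (c0 S : R) (u : nat -> C).
Hypotheses (HF : hol RH F) (HG : hol RH G) (HHq : hol RH Hq).
Hypotheses (HFR : forall w, RH w -> RH (F w)) (HGR : forall w, RH w -> RH (G w)).
Hypothesis Hfac : forall w, RH w -> C_derive F w = (Hq w * C_derive G w)%C.
Hypothesis Hle : forall w, RH w -> Cmod (Hq w) * Re (G w) <= Re (F w).
Hypotheses (Hc0 : 0 < c0) (HcG : forall w, RH w -> c0 * Re w <= Re (G w)).
Hypotheses (HS : 0 <= S) (HuS : forall n, RH (u n) /\ Rabs (Im (u n)) <= S * Re (u n)).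
Hypothesis Hu : forall X, exists N, forall n, (N <= n)%nat -> X <= Re (u n).
Hypothesis HFG : forall e, 0 < e -> exists N, forall n, (N <= n)%nat ->
  Cmod (F (u n) - G (u n)) * Cmod (u n) <= e.

(** [F - G] tends to 0 along [u] while [Re (u n)] tends to infinity, so the two coefficients
    coincide; the common value is at least [c0], hence positive. *)
Lemma same_angular_derivative : exists a, 0 < a /\ forall S' eps, 0 < S' -> 0 < eps ->
  exists X, 0 < X /\ forall w, X <= Re w -> Rabs (Im w) <= S' * Re w ->
    (Cmod (F w - a * w) <= eps * Re w /\ Cmod (C_derive F w - a) <= eps) /\
    (Cmod (G w - a * w) <= eps * Re w /\ Cmod (C_derive G w - a) <= eps).
Proof.
  destruct (angular_derivative F HF HFR) as [aF [HaF0 [HaF [_ HlF]]]].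
  destruct (angular_derivative G HG HGR) as [a [Ha0 [Ha [Hinf HlG]]]].
  assert (Hac : c0 <= a) by (apply Hinf; auto).
  assert (E : aF = a).
  { apply Rminus_diag_uniq, small_zero. intros e He.
    destruct (HlF (1 + S) (e / 3) ltac:(lra) ltac:(lra)) as [X1 [HX1 K1]].
    destruct (HlG (1 + S) (e / 3) ltac:(lra) ltac:(lra)) as [X2 [HX2 K2]].
    destruct (Hu (Rmax 1 (Rmax X1 X2))) as [N1 HN1]. destruct (HFG (e / 3) ltac:(lra)) as [N2 HN2].
    set (n := Nat.max N1 N2). specialize (HN1 n ltac:(lia)). specialize (HN2 n ltac:(lia)).
    set (w := u n) in *. destruct (HuS n) as [Hw HSw]. fold w in Hw, HSw. unfold RH in Hw.
    pose proof (Rmax_l 1 (Rmax X1 X2)). pose proof (Rmax_r 1 (Rmax X1 X2)).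
    pose proof (Rmax_l X1 X2). pose proof (Rmax_r X1 X2).
    pose proof (sector_Cmod w S Hw HSw) as HC.
    destruct (K1 w ltac:(lra) HC) as [L1 _]. destruct (K2 w ltac:(lra) HC) as [L2 _].
    apply Re_close in L1, L2. apply Rabs_le_between in L1, L2.
    assert (Hw1 : 1 <= Cmod w) by (pose proof (re_le_Cmod w) as Q; rewrite Rabs_right in Q by lra; lra).
    pose proof (Cmod_ge_0 (F w - G w)). assert (HD : Cmod (F w - G w) <= e / 3) by nra.
    pose proof (re_le_Cmod (F w - G w)) as Q. rewrite Re_minus in Q.
    assert (Q2 := Rle_trans _ _ _ Q HD). apply Rabs_le_between in Q2.
    assert (T : Rabs (aF - a) * Re w <= e * Re w).
    { rewrite <- (Rabs_right (Re w)) at 1 by lra. rewrite <- Rabs_mult. apply Rabs_le.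
      assert (e / 3 <= e / 3 * Re w) by nra. split; lra. }
    apply Rmult_le_reg_r in T; auto. }
  subst aF. exists a. split; [lra|]. intros S' eps HS' He.
  destruct (HlF (1 + S') eps ltac:(lra) He) as [X1 [HX1 K1]].
  destruct (HlG (1 + S') eps ltac:(lra) He) as [X2 [HX2 K2]].
  exists (Rmax X1 X2). pose proof (Rmax_l X1 X2). pose proof (Rmax_r X1 X2). split; [lra|].
  intros w Hw HSw. assert (HC := sector_Cmod w S' ltac:(lra) HSw). split; [apply K1|apply K2]; auto; lra.
Qed.

Lemma log_ratio_limit S' e : 0 < S' -> 0 < e -> exists Y, forall w, Y <= Re w -> Rabs (Im w) <= S' * Re w ->
  Rabs (ln (Re (F w)) - ln (Re (G w))) <= e.
Proof.
  intros HS' He. destruct same_angular_derivative as [a [Ha Hang]].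
  set (e' := Rmin (a / 2) (e * a / 4)). assert (He' : 0 < e') by (apply Rmin_glb_lt; nra).
  destruct (Hang S' e' HS' He') as [Y [HY KY]]. exists Y. intros w HwY HwS.
  destruct (KY w HwY HwS) as [[L1 _] [L2 _]]. apply Re_close in L1, L2.
  eapply Rle_trans; [apply (ln_close _ _ a e' (Re w)); auto; [lra|apply Rmin_l]|].
  apply Rmult_le_reg_r with a; auto. rewrite Rdiv_mul by lra.
  assert (e' <= e * a / 4) by apply Rmin_r. lra.
Qed.

Lemma Cmod_derive_F w : RH w -> Cmod (C_derive F w) = Cmod (Hq w) * Cmod (C_derive G w).
Proof. intros Hw. rewrite Hfac, Cmod_mult; auto. Qed.

(* A strict inequality would, by the Hopf lemma, push [Re F] above [Re G] by at least a multiple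
   of 1/|w| along the sequence. *)
Lemma hyperbolic_derivatives_agree p : RH p -> Cmod (Hq p) * Re (G p) = Re (F p).
Proof.
  intros Hp. apply Rle_antisym; auto. apply Rnot_lt_le. intros Hlt.
  destruct (hopf F G Hq HF HG HHq HFR HGR Hfac Hle p Hp Hlt) as [eps [r [Heps [Hr Hbar]]]].
  destruct same_angular_derivative as [a [Ha Hang]].
  (* [cone_comparison] asks for an opening of at least 1. *)
  set (S1 := S + 1).
  destruct (Hang S1 (a / 8) ltac:(unfold S1; lra) ltac:(lra)) as [X1 [HX1 K1]].
  set (y := Re p). assert (Hy : 0 < y) by exact Hp.
  (* In the sector [barrier p w - 2 = (4 x y)^2 / (A B)^2 >= m / x^2] with [B = |w - p|], since [B]
     and [A = |w + conj p|] are at most [(S1 + 2) x]. *)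
  set (m := 16 * y ^ 2 / (S1 + 2) ^ 4).
  assert (Hm : 0 < m).
  { apply Rdiv_lt_0_compat; [|apply pow_lt; unfold S1; lra]. assert (0 < y ^ 2) by (apply pow_lt; auto). lra. }
  (* The 8 collects [1 - U >= s / 2] with [s = eps m / x^2], and [|G'| / Re G >= 1 / (4 x)], which
     follows from [|G'| >= a / 2] and [Re G <= 2 a x]. *)
  set (b := eps * m / 8). assert (Hb : 0 < b) by (unfold b; assert (0 < eps * m) by nra; lra).
  (* The summands serve, in order: the angular estimates, the bound [A <= (S1 + 2) x], the exit from
     the inner disc of radius [r], and [s <= 1]. *)
  set (X := X1 + Cmod p + 2 * y / (1 - r) + eps * m + 1).
  assert (Q1 : 0 < 2 * y / (1 - r)) by (apply Rdiv_lt_0_compat; lra).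
  assert (Q2 : 0 < eps * m) by (apply Rmult_lt_0_compat; auto). pose proof (Cmod_ge_0 p) as Q3.
  assert (Hcone : forall w, X <= Re w -> Rabs (Im w) <= S1 * Re w -> b / 4 / Re w ^ 2 <= ln (Re (F w)) - ln (Re (G w))).
  { apply (cone_comparison F G S1 b (b / 4) X); auto; try (unfold X, S1; lra).
    - intros w HX HSw. destruct (K1 w ltac:(unfold X in HX; lra) HSw) as [_ [G1 G2]].
      assert (Hx : 0 < Re w) by (unfold X in HX; lra). assert (Hw : RH w) by exact Hx.
      set (x := Re w) in *. pose proof (HFR w Hw) as A1. pose proof (HGR w Hw) as A2. unfold RH in A1, A2.
      pose proof (near_real_direction a _ Ha G2) as Hdir. split; [auto|].
      pose proof (re_le_Cmod (C_derive G w - a)) as B1. rewrite Re_minus, Re_RtoC in B1.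
      assert (B1' := Rle_trans _ _ _ B1 G2). apply Rabs_le_between in B1'.
      assert (HgR : a / 2 <= Cmod (C_derive G w)).
      { eapply Rle_trans; [|apply re_le_Cmod]. eapply Rle_trans; [|apply Rle_abs]. lra. }
      assert (HGx : Re (G w) <= 2 * a * x).
      { apply Re_close in G1. fold x in G1. apply Rabs_le_between in G1. nra. }
      set (A := Cmod (w + Cconj p)).
      assert (HA0 : x <= A).
      { unfold A. eapply Rle_trans; [|apply re_le_Cmod]. eapply Rle_trans; [|apply Rle_abs]. reim. unfold x, y in *. lra. }
      assert (HA1 : A <= (S1 + 2) * x).
      { unfold A. eapply Rle_trans; [apply Cmod_triangle|]. rewrite Cmod_conj.
        pose proof (sector_Cmod w S1 Hx HSw). unfold X in HX. fold x in H. lra. }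
      assert (Hout : r * A <= Cmod (w - p)).
      { pose proof (Cmod_add_conj_le w p Hp) as T. fold A y in T.
        assert (2 * y <= (1 - r) * A).
        { apply Rle_trans with ((1 - r) * (2 * y / (1 - r))); [right; field; lra|].
          apply Rmult_le_compat_l; [lra|]. unfold X in HX. lra. }
        lra. }
      specialize (Hbar w Hw Hout).
      assert (Hwp : 0 < Cmod (w - p)) by nra.
      set (phi := barrier p w - 2) in *.
      assert (Hphi : m / x ^ 2 <= phi).
      { set (B := Cmod (w - p)) in *. assert (EAB : A ^ 2 = B ^ 2 + 4 * x * y) by apply RH_identity.
        assert (Ephi : phi = (4 * x * y) ^ 2 / (A ^ 2 * B ^ 2)).
        { unfold phi. rewrite (barrier_ratio p w (B / A)).
          - replace (4 * x * y) with (A ^ 2 - B ^ 2) by lra. field. lra.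
          - apply Cmod_gt_0; auto.
          - apply RH_add_neq; auto.
          - fold A B. field. lra. }
        rewrite Ephi.
        assert (HB : A ^ 2 * B ^ 2 <= ((S1 + 2) * x) ^ 4).
        { assert (B ^ 2 <= A ^ 2) by nra. assert (A ^ 2 <= ((S1 + 2) * x) ^ 2) by (apply pow_incr; lra).
          pose proof (pow2_ge_0 B). pose proof (pow2_ge_0 A).
          replace (((S1 + 2) * x) ^ 4) with (((S1 + 2) * x) ^ 2 * ((S1 + 2) * x) ^ 2) by ring.
          apply Rmult_le_compat; lra. }
        assert (HAB0 : 0 < A ^ 2 * B ^ 2) by (apply Rmult_lt_0_compat; apply pow_lt; lra).
        replace (m / x ^ 2) with ((4 * x * y) ^ 2 / ((S1 + 2) * x) ^ 4)
          by (unfold m; field; unfold S1; lra).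
        apply Rmult_le_compat_l; [apply pow2_ge_0|]. apply Rinv_le_contravar; auto. }
      set (s := eps * (m / x ^ 2)).
      assert (Hs : 0 < s) by (apply Rmult_lt_0_compat; [auto|apply Rdiv_lt_0_compat; [auto|apply pow_lt; auto]]).
      assert (Hs1 : s <= 1).
      { unfold s. apply Rmult_le_reg_r with (x ^ 2); [apply pow_lt; auto|].
        replace (eps * (m / x ^ 2) * x ^ 2) with (eps * m) by (field; lra).
        assert (eps * m <= x) by (unfold X in HX; lra). assert (1 <= x) by (unfold X in HX; lra). nra. }
      set (U := Cmod (Hq w) * Re (G w) / Re (F w)) in *.
      assert (HU0 : 0 <= U) by (apply Rmult_le_pos; [apply Rmult_le_pos; [apply Cmod_ge_0|lra]|left; apply Rinv_0_lt_compat; auto]).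
      (* [U <= exp (- eps phi) <= 1 / (1 + s)], and this is at most [1 - s / 2] for [s <= 1]. *)
      assert (HU : U <= 1 - s / 2).
      { assert (1 + s <= exp (eps * phi)).
        { eapply Rle_trans; [|apply exp_ineq1_le]. apply Rplus_le_compat_l. unfold s. apply Rmult_le_compat_l; lra. }
        nra. }
      replace (Cmod (C_derive F w) / Re (F w)) with (U * (Cmod (C_derive G w) / Re (G w)))
        by (rewrite Cmod_derive_F by auto; unfold U; field; lra).
      set (q := Cmod (C_derive G w) / Re (G w)).
      assert (Hq0 : / (4 * x) <= q).
      { unfold q. apply Rmult_le_reg_r with (Re (G w)); auto. unfold Rdiv. rewrite (Rmult_assoc (Cmod _)), Rinv_l by lra.
        apply Rle_trans with (/ (4 * x) * (2 * a * x)); [apply Rmult_le_compat_l; [left; apply Rinv_0_lt_compat; lra|lra]|].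
        replace (/ (4 * x) * (2 * a * x)) with (a / 2) by (field; lra). lra. }
      replace (b / x ^ 3) with (s / 2 * / (4 * x)) by (unfold b, s; field; lra).
      assert (0 < / (4 * x)) by (apply Rinv_0_lt_compat; lra). nra.
    - intros e He. apply log_ratio_limit; auto. unfold S1; lra. }
  (* The cone estimate makes [|F - G| |w|] at least [b a / 8]; half of that is the contradiction. *)
  destruct (Hu X) as [N1 HN1]. destruct (HFG (b * a / 16) ltac:(nra)) as [N2 HN2].
  set (n := Nat.max N1 N2). specialize (HN1 n ltac:(lia)). specialize (HN2 n ltac:(lia)).
  set (w := u n) in *. destruct (HuS n) as [Hw HSw]. fold w in Hw, HSw.
  assert (Hx : 0 < Re w) by exact Hw. set (x := Re w) in *.
  assert (HSw1 : Rabs (Im w) <= S1 * Re w) by (fold x; unfold S1; lra).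
  specialize (Hcone w HN1 HSw1). fold x in Hcone.
  destruct (K1 w ltac:(fold x; unfold X in HN1; lra) HSw1) as [_ [G1 _]].
  apply Re_close in G1. fold x in G1. apply Rabs_le_between in G1.
  pose proof (HFR w Hw) as A1. pose proof (HGR w Hw) as A2. unfold RH in A1, A2.
  pose proof (ln_le_minus1 _ _ A1 A2) as L.
  assert (L2 : b / 4 / x ^ 2 * Re (G w) <= Re (F w) - Re (G w)).
  { apply Rle_trans with ((Re (F w) - Re (G w)) / Re (G w) * Re (G w)).
    - apply Rmult_le_compat_r; lra.
    - right. field. lra. }
  assert (Hb4 : 0 < b / 4 / x ^ 2) by (apply Rdiv_lt_0_compat; [lra|apply pow_lt; auto]).
  assert (L3 : b / 4 / x ^ 2 * (a / 2 * x) <= Re (F w) - Re (G w)).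
  { eapply Rle_trans; [|apply L2]. apply Rmult_le_compat_l; lra. }
  replace (b / 4 / x ^ 2 * (a / 2 * x)) with (b * a / 8 / x) in L3 by (field; lra).
  pose proof (re_le_Cmod (F w - G w)) as R1. rewrite Re_minus in R1. pose proof (Rle_abs (Re (F w) - Re (G w))).
  assert (Hxc : x <= Cmod w) by (eapply Rle_trans; [apply Rle_abs|apply re_le_Cmod]).
  assert (L4 : b * a / 8 / x * x <= Cmod (F w - G w) * Cmod w).
  { apply Rmult_le_compat; try lra. left. apply Rdiv_lt_0_compat; [nra|auto]. }
  replace (b * a / 8 / x * x) with (b * a / 8) in L4 by (field; lra).
  assert (0 < b * a) by (apply Rmult_lt_0_compat; auto). lra.
Qed.

Lemma hyperbolic_ratio w : RH w -> Cmod (C_derive F w) / Re (F w) = Cmod (C_derive G w) / Re (G w).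
Proof.
  intros Hw. pose proof (HFR w Hw) as A1. pose proof (HGR w Hw) as A2. unfold RH in A1, A2.
  rewrite Cmod_derive_F by auto. pose proof (hyperbolic_derivatives_agree w Hw) as E.
  apply Rmult_eq_reg_r with (Re (F w) * Re (G w)); [|nra].
  replace (Cmod (Hq w) * Cmod (C_derive G w) / Re (F w) * (Re (F w) * Re (G w)))
    with (Cmod (C_derive G w) * (Cmod (Hq w) * Re (G w))) by (field; lra).
  rewrite E. field. lra.
Qed.

(** Equal hyperbolic derivatives allow [cone_comparison] with [b = 0] and every [k < 0], for [F, G]
    and for [G, F]; [k -> 0] gives equal real parts on a sector. So [F - G] is constant there, and
    its values along [u] tend to 0. *)
Lemma half_plane_rigidity : exists p d, RH p /\ 0 < d /\ forall w, Cmod (w - p) < d -> RH w /\ F w = G w.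
Proof.
  destruct same_angular_derivative as [a [Ha Hang]].
  set (S1 := S + 1).
  destruct (Hang S1 (a / 8) ltac:(unfold S1; lra) ltac:(lra)) as [X [HX K1]].
  assert (Hcone : forall k, k < 0 -> forall w, X <= Re w -> Rabs (Im w) <= S1 * Re w ->
     k / Re w ^ 2 <= ln (Re (F w)) - ln (Re (G w)) /\ k / Re w ^ 2 <= ln (Re (G w)) - ln (Re (F w))).
  { assert (Hlim := fun e => log_ratio_limit S1 e ltac:(unfold S1; lra)). intros k Hk w HwX HwS. split.
    - apply (cone_comparison F G S1 0 k X); auto; try (unfold S1; lra).
      intros z HzX HzS. destruct (K1 z HzX HzS) as [[_ F2] [_ G2]]. split; [apply (near_real_direction a); auto|].
      rewrite hyperbolic_ratio by (unfold RH; lra). unfold Rdiv. lra.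
    - apply (cone_comparison G F S1 0 k X); auto; try (unfold S1; lra).
      + intros z HzX HzS. destruct (K1 z HzX HzS) as [[_ F2] [_ G2]]. split; [apply (near_real_direction a); auto|].
        rewrite hyperbolic_ratio by (unfold RH; lra). unfold Rdiv. lra.
      + intros e He. destruct (Hlim e He) as [Y HY]. exists Y. intros z HzY HzS.
        rewrite Rabs_minus_sym. apply HY; auto. }
  assert (HRe : forall w, X <= Re w -> Rabs (Im w) <= S1 * Re w -> Re (F w) = Re (G w)).
  { intros w HwX HwS. assert (Hx : 0 < Re w) by lra.
    pose proof (HFR w Hx) as A1. pose proof (HGR w Hx) as A2. unfold RH in A1, A2.
    apply ln_inv; auto. apply Rminus_diag_uniq, small_zero. intros e He.
    (* [k] may depend on the point: this choice turns [k / (Re w)^2] into [- e]. *)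
    assert (Hk : - (e * Re w ^ 2) < 0) by (assert (0 < e * Re w ^ 2) by (apply Rmult_lt_0_compat; [auto|apply pow_lt; auto]); lra).
    destruct (Hcone _ Hk w HwX HwS) as [C1 C2].
    replace (- (e * Re w ^ 2) / Re w ^ 2) with (- e) in C1, C2 by (field; lra). apply Rabs_le. lra. }
  set (Dg := fun w => (F w - G w)%C).
  set (Om := fun w => X < Re w /\ Rabs (Im w) < S1 * Re w).
  assert (HOm : Copen Om).
  { intros w [Hw1 Hw2]. set (d := Rmin (Re w - X) ((S1 * Re w - Rabs (Im w)) / (S1 + 1))).
    assert (HS1 : 0 < S1 + 1) by (unfold S1; lra).
    exists d. split; [apply Rmin_glb_lt; [lra|apply Rdiv_lt_0_compat; lra]|]. intros z Hz.
    pose proof (re_le_Cmod (z - w)) as B1. pose proof (im_le_Cmod (z - w)) as B2.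
    rewrite Re_minus in B1. rewrite Im_minus in B2.
    assert (D1 : d <= Re w - X) by apply Rmin_l.
    assert (D2 : d * (S1 + 1) <= S1 * Re w - Rabs (Im w)).
    { apply Rle_trans with ((S1 * Re w - Rabs (Im w)) / (S1 + 1) * (S1 + 1)); [apply Rmult_le_compat_r; [lra|apply Rmin_r]|].
      right; field; lra. }
    apply Rabs_le_between in B1.
    pose proof (Rabs_triang (Im z - Im w) (Im w)) as T. replace (Im z - Im w + Im w) with (Im z) in T by ring.
    split; [lra|]. assert (S1 * (Re w - d) <= S1 * Re z) by (apply Rmult_le_compat_l; unfold S1 in *; lra). lra. }
  assert (HDg : hol RH Dg) by (apply hol_minus; auto).
  assert (HOR : forall w, Om w -> RH w) by (intros w [Hw _]; unfold RH; lra).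
  assert (Hre0 : forall w, Om w -> Re (Dg w) = 0).
  { intros w [Hw1 Hw2]. unfold Dg. rewrite Re_minus, HRe; lra. }
  assert (Hder0 : forall w, Om w -> C_derive Dg w = 0).
  { intros w Hw. destruct (HOm w Hw) as [d [Hd Hin]].
    (* The real part vanishes along every short segment; directions 1 and i then give both parts of
       the derivative. *)
    assert (Hline : forall e, Re (C_derive Dg w * e) = 0).
    { intros e. pose proof (Cmod_ge_0 e).
      assert (D1 : derivable_pt_lim (fun t => Re (Dg (w + RtoC t * e)%C)) 0 (Re (C_derive Dg w * e))).
      { apply derivable_Re_line. rewrite line0. apply (hol_deriv RH); auto. }
      apply (derivable_ext_loc _ (fun _ => 0) _ _ (d / (Cmod e + 1))) in D1; [|apply Rdiv_lt_0_compat; lra|].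
      - eapply uniqueness_limite; [exact D1|apply derivable_pt_lim_const].
      - intros t Ht. rewrite Rminus_0_r in Ht. apply Hre0, Hin, line_small; auto. }
    apply Ceq.
    - rewrite <- (Cmult_1_r (C_derive Dg w)). exact (Hline 1).
    - pose proof (Hline Ci) as Q. revert Q. reim. intros Q. change (Im (RtoC 0)) with 0. lra. }
  assert (Hconst : forall w w', Om w -> Om w' -> Dg w' = Dg w).
  (* The open sector is convex, so the mean value estimate applies to any two of its points. *)
  { intros w w' Hw Hw'.
    assert (M : Cmod (Dg w' - Dg w) <= 0 * Cmod (w' - w)).
    { apply (mean_value_segment Dg (C_derive Dg)). intros t Ht.
      assert (Hz : Om (w + RtoC t * (w' - w))%C).
      { destruct Hw as [W1 W2], Hw' as [W1' W2']. unfold Om.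
        replace (Re (w + RtoC t * (w' - w))%C) with ((1 - t) * Re w + t * Re w') by (reim; ring).
        replace (Im (w + RtoC t * (w' - w))%C) with ((1 - t) * Im w + t * Im w') by (reim; ring).
        split; [apply convex_lt; auto|].
        eapply Rle_lt_trans; [apply Rabs_triang|]. rewrite !Rabs_mult, (Rabs_right (1 - t)), (Rabs_right t) by lra.
        pose proof (convex_lt 0 (S1 * Re w - Rabs (Im w)) (S1 * Re w' - Rabs (Im w')) t Ht ltac:(lra) ltac:(lra)).
        lra. }
      split; [apply (hol_deriv RH); auto|]. rewrite Hder0, Cmod_0 by auto. lra. }
    rewrite Rmult_0_l in M. pose proof (Cmod_ge_0 (Dg w' - Dg w)).
    assert (E : (Dg w' - Dg w)%C = 0) by (apply Cmod_eq_0; lra).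
    replace (Dg w') with (Dg w' - Dg w + Dg w)%C by ring. rewrite E. ring. }
  assert (HuO : exists N, forall n, (N <= n)%nat -> Om (u n) /\ 1 <= Re (u n)).
  { destruct (Hu (X + 1)) as [N HN]. exists N. intros n Hn. specialize (HN n Hn). destruct (HuS n) as [U1 U2].
    unfold RH in U1. split; [split; [lra|unfold S1; lra]|lra]. }
  destruct HuO as [N HN]. set (p := u N). destruct (HN N (Nat.le_refl N)) as [HpO _]. fold p in HpO.
  assert (HDp : Dg p = 0).
  { apply Cmod_eq_0, small_zero. intros e He. rewrite Rabs_right by apply Rle_ge, Cmod_ge_0.
    destruct (HFG e He) as [N2 HN2]. set (n := Nat.max N N2). specialize (HN2 n ltac:(lia)).
    destruct (HN n ltac:(lia)) as [HnO Hn1]. rewrite (Hconst (u n) p HnO HpO). unfold Dg.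
    pose proof (re_le_Cmod (u n)) as Q. rewrite Rabs_right in Q by lra.
    pose proof (Cmod_ge_0 (F (u n) - G (u n))). nra. }
  destruct (HOm p HpO) as [d [Hd Hin]]. exists p, d. split; [auto|split; [auto|]]. intros w Hw.
  split; [auto|]. pose proof (Hconst p w HpO (Hin w Hw)) as E. rewrite HDp in E. unfold Dg in E.
  replace (F w) with (F w - G w + G w)%C by ring. rewrite E. ring.
Qed.
End HalfPlaneRigidity.

(** * From the disk to the half-plane *)

(** The finite lower limit [l] is the supremum of the infima over small discs, so none of them
    reaches [l + 1], and values below [l + 1] occur arbitrarily near [xi]. *)
Lemma LimInf_disk_bound (phi : C -> R) (xi : C) :
  Rbar_lt 0 (LimInf_disk phi xi) -> Rbar_lt (LimInf_disk phi xi) p_infty ->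
  exists A, 0 < A /\ forall r, 0 < r -> exists z, in_disk z /\ Cmod (z - xi) < r /\ phi z <= A.
Proof.
  unfold LimInf_disk, Rbar_lub.
  destruct (Rbar_ex_lub _) as [[l| |] [Hub Hleast]]; cbn [proj1_sig]; intros H0 Hoo; try (simpl in *; tauto).
  simpl in H0. exists (l + 1). split; [lra|]. intros r Hr. apply NNPP. intros Hn.
  pose proof (Hub _ (ex_intro _ (mkposreal r Hr) eq_refl)) as L.
  match type of L with Rbar_le (Glb_Rbar ?E) _ => destruct (Glb_Rbar_correct E) as [_ Hglb] end.
  assert (L2 : Rbar_le (Finite (l + 1)) (Finite l)); [|simpl in L2; lra].
  eapply Rbar_le_trans; [|exact L]. apply Hglb. intros y [z [Hz [Hzr ->]]]. simpl. apply Rnot_lt_le. intros Hlt.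
  apply Hn. exists z. split; [auto|split; [auto|lra]].
Qed.

Lemma artanh_bound (x m : R) : 0 <= x < 1 -> 2 * artanh x < m -> x <= (exp m - 1) / (exp m + 1).
Proof.
  intros Hx Hm. unfold artanh in Hm.
  assert (H : ln ((1 + x) / (1 - x)) < m) by lra.
  assert (Hp : 0 < (1 + x) / (1 - x)) by (apply Rdiv_lt_0_compat; lra).
  apply exp_increasing in H. rewrite exp_ln in H by auto.
  pose proof (exp_pos m). apply Rmult_lt_compat_r with (r := 1 - x) in H; [|lra].
  rewrite Rdiv_mul in H by lra.
  apply Rmult_le_reg_r with (exp m + 1); [lra|]. rewrite Rdiv_mul by lra. lra.
Qed.

(** The constant must not depend on the centre [y]. Squaring gives [v^2 + x^2 + y^2 <= c x y] for
    [w = x + i v]; hence [y <= c x], and then [v^2 <= c x y <= (c x)^2]. *)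
Lemma pseudo_disc_sector (w : C) (y k : R) : 0 < y -> RH w -> 0 <= k < 1 ->
  Cmod (w - y) <= k * Cmod (w + y) -> Rabs (Im w) <= 2 * (1 + k ^ 2) / (1 - k ^ 2) * Re w.
Proof.
  intros Hy Hw Hk H. unfold RH in Hw.
  assert (H2 : Cmod (w - y) ^ 2 <= k ^ 2 * Cmod (w + y) ^ 2).
  { rewrite <- Rpow_mult_distr. apply pow_incr. split; [apply Cmod_ge_0|auto]. }
  rewrite !Cmod_sq, Re_minus, Im_minus, Re_plus, Im_plus, Re_RtoC, Im_RtoC in H2.
  set (x := Re w) in *. set (v := Im w) in *. set (s := k ^ 2) in *.
  assert (Hs : 0 <= s < 1) by (unfold s; nra).
  set (c := 2 * (1 + s) / (1 - s)).
  assert (Hc : c * (1 - s) = 2 * (1 + s)) by (unfold c; field; lra).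
  assert (Hc0 : 0 < c) by (apply Rdiv_lt_0_compat; lra).
  assert (E : (1 - s) * (v ^ 2 + x ^ 2 + y ^ 2) <= 2 * (1 + s) * (x * y)) by lra.
  rewrite <- Hc in E.
  assert (E2 : v ^ 2 + x ^ 2 + y ^ 2 <= c * (x * y)) by (apply Rmult_le_reg_l with (1 - s); lra).
  pose proof (pow2_ge_0 v). pose proof (pow2_ge_0 x).
  assert (Hyx : y <= c * x) by (apply Rmult_le_reg_r with y; auto; lra).
  assert (Hv : v ^ 2 <= (c * x) ^ 2).
  { assert (c * (x * y) <= c * (x * (c * x))) by (apply Rmult_le_compat_l; [lra|apply Rmult_le_compat_l; lra]).
    pose proof (pow2_ge_0 y). lra. }
  assert (0 < c * x) by (apply Rmult_lt_0_compat; auto). rewrite <- (pow2_abs v) in Hv.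
  pose proof (Rabs_pos v). apply Rnot_lt_le. intros L. nra.
Qed.

(** The Cayley transform takes the diameter to the positive real axis, [t xi] to
    [(1 + t) / (1 - t)]. A point within [m] of the diameter lies in a pseudohyperbolic disc of fixed
    radius about a point of that axis, and [pseudo_disc_sector] applies. *)
Lemma hyp_sector_cay (m : R) (xi : C) : on_circle xi -> 0 < m -> exists S, 0 <= S /\ forall z,
  hyp_sector m xi z -> Rabs (Im (cay xi z)) <= S * Re (cay xi z).
Proof.
  (* [k = tanh (m / 2)], the pseudohyperbolic radius belonging to the hyperbolic distance [m]. *)
  intros Hxi Hm. set (k := (exp m - 1) / (exp m + 1)).
  assert (He : 1 < exp m) by (rewrite <- exp_0; apply exp_increasing; auto).
  assert (Hk : 0 < k < 1).
  { split; [apply Rdiv_lt_0_compat; lra|]. apply Rmult_lt_reg_r with (exp m + 1); [lra|].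
    unfold k, Rdiv. rewrite Rmult_assoc, Rinv_l by lra. lra. }
  exists (2 * (1 + k ^ 2) / (1 - k ^ 2)). split.
  { apply Rmult_le_pos; [nra|left; apply Rinv_0_lt_compat; nra]. }
  intros z [Hz Hd].
  assert (Hex : exists t, -1 < t < 1 /\ hyp_dist z (RtoC t * xi)%C < m).
  { apply NNPP. intros Hn. apply (Rbar_lt_not_le _ _ Hd). unfold hyp_dist_to_set.
    apply Glb_Rbar_correct. intros y [w [[t [Ht ->]] ->]]. simpl. apply Rnot_lt_le. intros L.
    apply Hn. exists t. auto. }
  destruct Hex as [t [Ht Hdist]]. set (zt := (RtoC t * xi)%C) in *.
  assert (Hzt : in_disk zt).
  { unfold in_disk, zt. rewrite Cmod_mult, Cmod_R, Hxi, Rmult_1_r. apply Rabs_def1; lra. }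
  pose proof (conj_cross zt z) as I. pose proof (disk_sq _ Hz) as S1. pose proof (disk_sq _ Hzt) as S2.
  assert (S12 : 0 < (1 - Cmod zt ^ 2) * (1 - Cmod z ^ 2)) by (apply Rmult_lt_0_compat; auto).
  rewrite Cmult_comm in I. rewrite (Cmod_minus_sym zt z) in I.
  assert (Hden : 0 < Cmod (1 - Cconj z * zt)).
  { pose proof (Cmod_ge_0 (1 - Cconj z * zt)) as [P|P]; auto. rewrite <- P in I.
    pose proof (pow2_ge_0 (Cmod (z - zt))). lra. }
  assert (Hlt : Cmod (z - zt) < Cmod (1 - Cconj z * zt)).
  { apply Rnot_le_lt. intros L. assert (Cmod (1 - Cconj z * zt) ^ 2 <= Cmod (z - zt) ^ 2) by (apply pow_incr; lra). lra. }
  assert (Hk2 : Cmod (z - zt) <= k * Cmod (1 - Cconj z * zt)).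
  { unfold hyp_dist in Hdist. rewrite Cmod_div in Hdist by (apply Cmod_gt_0; auto).
    apply artanh_bound in Hdist.
    - fold k in Hdist. apply Rmult_le_compat_r with (r := Cmod (1 - Cconj z * zt)) in Hdist; [|lra].
      rewrite Rdiv_mul in Hdist by lra. lra.
    - split; [apply Rmult_le_pos; [apply Cmod_ge_0|left; apply Rinv_0_lt_compat; auto]|].
      apply Rmult_lt_reg_r with (Cmod (1 - Cconj z * zt)); auto. rewrite Rdiv_mul by lra. lra. }
  set (y := (1 + t) / (1 - t)). assert (Hy : 0 < y) by (apply Rdiv_lt_0_compat; lra).
  apply (pseudo_disc_sector (cay xi z) y k); auto; [apply cay_RH; auto|lra|].
  pose proof (cay_den xi z Hxi Hz) as D1.
  assert (D2 : RtoC (1 - t) <> 0) by (intros E; apply RtoC_inj in E; lra).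
  assert (Ey : RtoC y = (RtoC (1 + t) / RtoC (1 - t))%C) by (unfold y; rewrite RtoC_div by lra; auto).
  assert (E1 : (cay xi z - y)%C = (2 * (z - zt) / ((xi - z) * RtoC (1 - t)))%C).
  { rewrite Ey. unfold cay, zt. rewrite RtoC_plus, RtoC_minus in *. field. auto. }
  assert (E2 : (cay xi z + y)%C = (2 * (xi - RtoC t * z) / ((xi - z) * RtoC (1 - t)))%C).
  { rewrite Ey. unfold cay. rewrite RtoC_plus, RtoC_minus in *. field. auto. }
  assert (E3 : Cmod (xi - RtoC t * z) = Cmod (1 - Cconj z * zt)).
  { rewrite <- (Cmod_conj (1 - Cconj z * zt)).
    replace (xi - RtoC t * z)%C with (xi * Cconj (1 - Cconj z * zt))%C.
    - rewrite Cmod_mult, Hxi. ring.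
    - rewrite Cminus_conj, Cmult_conj, Cconj_conj. unfold zt. rewrite Cmult_conj.
      replace (Cconj (RtoC t)) with (RtoC t) by (apply Ceq; simpl; ring).
      replace (Cconj 1) with (RtoC 1) by (apply Ceq; simpl; ring).
      replace (xi * (1 - z * (t * Cconj xi)))%C with (xi - t * z * (xi * Cconj xi))%C by ring.
      rewrite <- Cmod2_conj. rewrite Hxi. replace (RtoC (1 ^ 2)) with (RtoC 1) by (f_equal; ring). ring. }
  rewrite E1, E2, !Cmod_div, !Cmod_mult, E3 by (apply Cmult_neq; auto).
  assert (P1 : 0 < Cmod 2) by (rewrite Cmod_R, Rabs_right; lra).
  assert (P2 : 0 < Cmod (xi - z) * Cmod (RtoC (1 - t))) by (apply Rmult_lt_0_compat; apply Cmod_gt_0; auto).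
  unfold Rdiv. rewrite <- Rmult_assoc. apply Rmult_le_compat_r; [left; apply Rinv_0_lt_compat; auto|].
  replace (k * (Cmod 2 * Cmod (1 - Cconj z * zt))) with (Cmod 2 * (k * Cmod (1 - Cconj z * zt))) by ring.
  apply Rmult_le_compat_l; lra.
Qed.

Lemma locally_Cmod (xi : C) eps : 0 < eps -> locally (xi : CU) (fun w : CU => Cmod (w - xi) < eps).
Proof.
  intros He. assert (Hs : 0 < eps / sqrt 2) by (apply Rdiv_lt_0_compat; [lra|apply sqrt_lt_R0; lra]).
  exists (mkposreal _ Hs). intros w Hb.
  eapply Rlt_le_trans; [apply (C_NormedModule_mixin_compat2 xi w (mkposreal _ Hs)); exact Hb|].
  simpl. assert (0 < sqrt 2) by (apply sqrt_lt_R0; lra). right. field. lra.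
Qed.

(** Off the critical points of [B] one divides by [|B'|]; these points are isolated, and both sides
    are continuous. *)
Lemma quotient_bound (f B h : C -> C) : hol in_disk f -> hol in_disk B -> hol in_disk h ->
  (forall z, in_disk z -> in_disk (f z)) -> (forall z, in_disk z -> in_disk (B z)) ->
  (forall z, in_disk z -> C_derive f z = (h z * C_derive B z)%C) ->
  (exists z, in_disk z /\ C_derive B z <> 0) ->
  (forall z, in_disk z ->
     Cmod (C_derive f z) / (1 - Cmod (f z) ^ 2) <= Cmod (C_derive B z) / (1 - Cmod (B z) ^ 2)) ->
  forall z, in_disk z -> Cmod (h z) * (1 - Cmod (B z) ^ 2) <= 1 - Cmod (f z) ^ 2.
Proof.
  intros Hf HB Hh Hfd HBd Hfac Hn Hmax z Hz.
  destruct (isolated_zeros _ z (hol_deriv_hol in_disk B Copen_disk HB) Hz Hn) as [d [Hd Hnz]].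
  set (phi := fun z => (1 - Cmod (f z) ^ 2) - Cmod (h z) * (1 - Cmod (B z) ^ 2)).
  cut (0 <= phi z); [unfold phi; lra|].
  apply (limit_ge phi z d Hd).
  - pose proof (continuous_normsq in_disk f z Hf Hz). pose proof (continuous_normsq in_disk B z HB Hz).
    pose proof (hol_cont in_disk h z Hh Hz). unfold phi. cont.
  - intros w Hw. destruct (Hnz w Hw) as [Hwr HBw]. apply Cmod_gt_0 in HBw.
    specialize (Hmax w Hwr). rewrite (Hfac w Hwr), Cmod_mult in Hmax.
    pose proof (disk_sq _ (Hfd w Hwr)) as A1. pose proof (disk_sq _ (HBd w Hwr)) as A2. unfold phi.
    set (x := 1 - Cmod (f w) ^ 2) in *. set (y := 1 - Cmod (B w) ^ 2) in *.
    assert (Cmod (h w) * y <= x); [|lra].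
    apply Rmult_le_reg_r with (Cmod (C_derive B w) * / (x * y)).
    { apply Rmult_lt_0_compat; auto. apply Rinv_0_lt_compat, Rmult_lt_0_compat; auto. }
    replace (Cmod (h w) * y * (Cmod (C_derive B w) * / (x * y))) with (Cmod (h w) * Cmod (C_derive B w) / x) by (field; lra).
    replace (x * (Cmod (C_derive B w) * / (x * y))) with (Cmod (C_derive B w) / y) by (field; lra). auto.
Qed.

(** [cay eta u + 1 = 2 eta / (eta - u)]: an exact exchange between distance to the boundary point
    and size in the half-plane. *)
Lemma Cmod_cay_plus1 eta u : on_circle eta -> in_disk u -> Cmod (cay eta u + 1) * Cmod (eta - u) = 2.
Proof.
  intros He Hu. pose proof (cay_den eta u He Hu) as Hd. rewrite <- Cmod_mult.
  replace ((cay eta u + 1) * (eta - u))%C with (2 * eta)%C by (unfold cay; field; auto).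
  rewrite Cmod_mult, Cmod_R, Rabs_right, He by lra. ring.
Qed.

Lemma Cmod_le_plus1 w : RH w -> Cmod w <= Cmod (w + 1).
Proof.
  unfold RH. intros Hw. apply Rnot_lt_le. intros L.
  assert (Cmod (w + 1) ^ 2 <= Cmod w ^ 2) by (apply pow_incr; split; [apply Cmod_ge_0|lra]).
  rewrite !Cmod_sq in H. revert H. reim. change (Re 1) with 1. change (Im 1) with 0. lra.
Qed.

Theorem theorem1p1 (f : C -> C) (xi : C) (B : C -> C)
  (hf : holomorphic_self_map f)
  (hxi : on_circle xi)
  (hB : maximal_blaschke_product f B)
  (hL0 : Rbar_lt 0 (LimInf_disk (fun z => (1 - Cmod (B z)) / (1 - Cmod z)) xi))
  (hLoo : Rbar_lt (LimInf_disk (fun z => (1 - Cmod (B z)) / (1 - Cmod z)) xi) p_infty)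
  (hseq : exists z : nat -> C,
     (forall n, in_disk (z n)) /\
     converges_nontangentially z xi /\
     @is_domin nat R_AbsRing C_AbsRing R_NormedModule C_NormedModule eventually
       (fun n => Cmod (xi - z n) ^ 3)
       (fun n => (f (z n) - B (z n))%C)) :
  forall z : C, in_disk z -> f z = B z.
Proof.
  destruct hB as [_ [[HB HBd] [Hcrit Hmax]]]. specialize (Hmax f hf Hcrit). destruct hf as [Hf Hfd].
  apply holomorphic_hol in HB, Hf.
  destruct (LimInf_disk_bound _ xi hL0 hLoo) as [A [HA HAr]].
  destruct (julia B xi A HB HBd hxi HA) as [eta [Heta Hjul]].
  { intros r Hr. destruct (HAr r Hr) as [z [Hz [Hzr Hzq]]]. exists z. split; [auto|split; [auto|]].
    unfold in_disk in Hz. apply Rmult_le_compat_r with (r := 1 - Cmod z) in Hzq; [|lra].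
    rewrite Rdiv_mul in Hzq by lra. lra. }
  set (F := lift eta xi f). set (G := lift eta xi B).
  assert (HF : hol RH F) by (apply lift_hol; auto). assert (HG : hol RH G) by (apply lift_hol; auto).
  assert (HFR : forall w, RH w -> RH (F w)) by (apply lift_RH; auto).
  assert (HGR : forall w, RH w -> RH (G w)) by (apply lift_RH; auto).
  (* In the half-plane, [julia] becomes [Re w <= 2 A Re (G w)]. *)
  set (c0 := / (2 * A)). assert (Hc0 : 0 < c0) by (apply Rinv_0_lt_compat; lra).
  assert (HcG : forall w, RH w -> c0 * Re w <= Re (G w)).
  { intros w Hw. pose proof (icay_disk xi w hxi Hw) as Hz. set (z := icay xi w) in *.
    assert (Ew : Re w = Re (cay xi z)) by (unfold z; rewrite cay_icay; auto).
    rewrite Ew. change (Re (G w)) with (Re (cay eta (B z))). rewrite !Re_cay by auto.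
    specialize (Hjul z Hz).
    assert (D1 : 0 < Cmod (xi - z)) by (apply Cmod_gt_0, cay_den; auto).
    assert (D2 : 0 < Cmod (eta - B z)) by (apply Cmod_gt_0, cay_den; auto).
    assert (P1 : 0 < Cmod (xi - z) ^ 2) by (apply pow_lt; auto).
    assert (P2 : 0 < Cmod (eta - B z) ^ 2) by (apply pow_lt; auto).
    apply Rmult_le_reg_r with (2 * A * (Cmod (xi - z) ^ 2 * Cmod (eta - B z) ^ 2)).
    { apply Rmult_lt_0_compat; [lra|apply Rmult_lt_0_compat; auto]. }
    unfold c0.
    replace (/ (2 * A) * ((1 - Cmod z ^ 2) / Cmod (xi - z) ^ 2) * (2 * A * (Cmod (xi - z) ^ 2 * Cmod (eta - B z) ^ 2)))
      with (Cmod (eta - B z) ^ 2 * (1 - Cmod z ^ 2)) by (field; lra).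
    replace ((1 - Cmod (B z) ^ 2) / Cmod (eta - B z) ^ 2 * (2 * A * (Cmod (xi - z) ^ 2 * Cmod (eta - B z) ^ 2)))
      with (Cmod (xi - z) ^ 2 * (2 * A * (1 - Cmod (B z) ^ 2))) by (field; lra). auto. }
  destruct (angular_derivative G HG HGR) as [a [Ha0 [_ [Hinf Hang]]]].
  assert (Ha : c0 <= a) by (apply Hinf; auto).
  (* If [B'] vanished identically, so would [G'], whereas [G'] tends to [a > 0] along the positive
     real axis. *)
  assert (HnB : exists z, in_disk z /\ C_derive B z <> 0).
  { apply NNPP. intros Hn. destruct (Hang 1 (a / 2) ltac:(lra) ltac:(lra)) as [X [HX K]].
    assert (HXR : RH (RtoC X)) by (unfold RH; rewrite Re_RtoC; auto).
    destruct (K (RtoC X)) as [_ K2].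
    - rewrite Re_RtoC; lra.
    - rewrite Cmod_R, Re_RtoC, Rabs_right by lra. lra.
    - rewrite (C_derive_cderiv G (RtoC X) 0) in K2.
      + replace (0 - a)%C with (- RtoC a)%C in K2 by ring. rewrite Cmod_opp, Cmod_R, Rabs_right in K2 by lra. lra.
      + eapply cderiv_eq; [apply lift_deriv; auto|].
        assert (E : C_derive B (icay xi (RtoC X)) = 0).
        { apply NNPP. intros E. apply Hn. eexists. split; [|exact E]. apply icay_disk; auto. }
        rewrite E. ring. }
  destruct (derivative_quotient f B Hf HB HnB Hcrit) as [h [Hh Hfac]].
  pose proof (quotient_bound f B h Hf HB Hh Hfd HBd Hfac HnB Hmax) as Hhb.
  (* The ratio of the chain rule factors of the two lifts; those of [icay] cancel. *)
  set (Hq := fun w => ((eta - B (icay xi w)) * (eta - B (icay xi w)) /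
    ((eta - f (icay xi w)) * (eta - f (icay xi w))) * h (icay xi w))%C).
  assert (Hic : hol RH (icay xi)) by (intros w Hw; eexists; apply icay_deriv; auto).
  assert (Hicd : forall w, RH w -> in_disk (icay xi w)) by (intros; apply icay_disk; auto).
  assert (HHq : hol RH Hq).
  { assert (H1 : hol RH (fun w => (eta - B (icay xi w))%C)).
    { apply hol_minus; [apply hol_const|]. apply (hol_comp RH in_disk (icay xi) B); auto. }
    assert (H2 : hol RH (fun w => (eta - f (icay xi w))%C)).
    { apply hol_minus; [apply hol_const|]. apply (hol_comp RH in_disk (icay xi) f); auto. }
    apply hol_mult; [|apply (hol_comp RH in_disk (icay xi) h); auto].
    apply hol_div; [apply hol_mult; auto|apply hol_mult; auto|].
    intros w Hw. apply Cmult_neq; apply cay_den; auto. }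
  assert (HFG' : forall w, RH w -> C_derive F w = (Hq w * C_derive G w)%C).
  { intros w Hw. unfold F, G. rewrite (C_derive_cderiv _ _ _ (lift_deriv eta xi f Heta hxi Hf Hfd w Hw)).
    rewrite (C_derive_cderiv _ _ _ (lift_deriv eta xi B Heta hxi HB HBd w Hw)).
    rewrite (Hfac _ (Hicd w Hw)). unfold Hq.
    pose proof (icay_den w Hw). pose proof (cay_den eta _ Heta (Hfd _ (Hicd w Hw))).
    pose proof (cay_den eta _ Heta (HBd _ (Hicd w Hw))). field. auto. }
  assert (Hle : forall w, RH w -> Cmod (Hq w) * Re (G w) <= Re (F w)).
  { intros w Hw. pose proof (Hicd w Hw) as Hz. unfold F, G, Hq, lift. set (z := icay xi w) in *.
    pose proof (cay_den eta _ Heta (Hfd _ Hz)) as D1. pose proof (cay_den eta _ Heta (HBd _ Hz)) as D2.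
    rewrite !Re_cay, Cmod_mult, Cmod_div, !Cmod_mult by (auto; apply Cmult_neq; auto).
    specialize (Hhb z Hz). apply Cmod_gt_0 in D1, D2.
    replace (Cmod (eta - B z) * Cmod (eta - B z) / (Cmod (eta - f z) * Cmod (eta - f z)) * Cmod (h z) *
      ((1 - Cmod (B z) ^ 2) / Cmod (eta - B z) ^ 2))
      with (Cmod (h z) * (1 - Cmod (B z) ^ 2) / Cmod (eta - f z) ^ 2) by (field; lra).
    apply Rmult_le_compat_r; auto. left. apply Rinv_0_lt_compat, pow_lt; auto. }
  destruct hseq as [z [Hz [[Hzlim [m [Hm [N0 Hsec]]]] Hdom]]].
  destruct (hyp_sector_cay m xi hxi Hm) as [S [HS HSec]].
  (* Shifted by [N0], so that all terms lie in the sector. *)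
  set (u := fun n => cay xi (z (N0 + n)%nat)).
  assert (HuR : forall n, RH (u n)) by (intros; apply cay_RH; auto).
  assert (HuS : forall n, RH (u n) /\ Rabs (Im (u n)) <= S * Re (u n)).
  { intros n. split; auto. apply HSec, Hsec. lia. }
  assert (Hu : forall X, exists N, forall n, (N <= n)%nat -> X <= Re (u n)).
  (* [|u + 1| >= M] gives [|u| >= M - 1], and in the sector [|u| <= (1 + S) Re u]; so [Re u] is at
     least [max X 0]. *)
  { intros X. set (M := (1 + S) * Rmax X 0 + 1).
    assert (HM : 0 < M) by (unfold M; pose proof (Rmax_r X 0); nra).
    destruct (Hzlim _ (locally_Cmod xi (2 / M) ltac:(apply Rdiv_lt_0_compat; lra))) as [N HN].
    exists N. intros n Hn. specialize (HN (N0 + n)%nat ltac:(lia)). destruct (HuS n) as [U1 U2].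
    pose proof (Cmod_cay_plus1 xi (z (N0 + n)%nat) hxi (Hz _)) as E. fold (u n) in E.
    rewrite Cmod_minus_sym in HN. apply Rmult_lt_compat_r with (r := M) in HN; [|auto].
    rewrite Rdiv_mul in HN by lra.
    pose proof (Cmod_ge_0 (u n + 1)). pose proof (Cmod_ge_0 (xi - z (N0 + n)%nat)).
    assert (HMu : M <= Cmod (u n + 1)) by (apply Rnot_lt_le; intros L; nra).
    pose proof (Cmod_triangle (u n) 1) as T. rewrite Cmod_1 in T.
    pose proof (sector_Cmod (u n) S U1 U2) as SC. pose proof (Rmax_l X 0).
    assert (Hmx : (1 + S) * Rmax X 0 <= (1 + S) * Re (u n)) by (unfold M in HMu; lra).
    apply Rmult_le_reg_l in Hmx; lra. }
  assert (HFGu : forall e, 0 < e -> exists N, forall n, (N <= n)%nat -> Cmod (F (u n) - G (u n)) * Cmod (u n) <= e).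
  (* [|G w + 1| <= (a + 2) |w|] translates into [|eta - B| >= c / |w|]. *)
  { intros e He. set (c := 2 / (a + 2)). assert (Hc : 0 < c) by (apply Rdiv_lt_0_compat; lra).
    (* The bound [c / 16] makes [|f - B|] at most half of [c / |w|], so that [eta - f] is bounded
       below as well; the other bound produces [e] at the end. *)
    set (ep := Rmin (e * c ^ 2 / 32) (c / 16)).
    assert (Hc2 : 0 < c ^ 2) by (apply pow_lt; auto).
    assert (Hep : 0 < ep) by (apply Rmin_glb_lt; nra).
    assert (Hep1 : ep <= e * c ^ 2 / 32) by apply Rmin_l. assert (Hep2 : ep <= c / 16) by apply Rmin_r.
    destruct (Hdom (mkposreal ep Hep)) as [N1 HN1].
    destruct (Hang (1 + S) 1 ltac:(lra) ltac:(lra)) as [X [HX KX]].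
    destruct (Hu (X + 1)) as [N2 HN2]. exists (Nat.max N1 N2). intros n Hn.
    specialize (HN1 (N0 + n)%nat ltac:(lia)). specialize (HN2 n ltac:(lia)). destruct (HuS n) as [U1 U2].
    set (zn := z (N0 + n)%nat) in *. set (w := u n) in *. pose proof (Hz (N0 + n)%nat) as Hzn. fold zn in Hzn.
    assert (Ew : w = cay xi zn) by reflexivity.
    assert (EF : F w = cay eta (f zn)) by (unfold F, lift; rewrite Ew, icay_cay; auto).
    assert (EG : G w = cay eta (B zn)) by (unfold G, lift; rewrite Ew, icay_cay; auto).
    change (Cmod (f zn - B zn) <= ep * Rabs (Cmod (xi - zn) ^ 3)) in HN1.
    rewrite Rabs_right in HN1 by (apply Rle_ge, pow_le, Cmod_ge_0).
    pose proof (sector_Cmod w S U1 U2) as SC. destruct (KX w ltac:(lra) SC) as [KG _].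
    set (t := Cmod w). assert (Ht : 1 <= t).
    { unfold t. eapply Rle_trans; [|apply re_le_Cmod]. eapply Rle_trans; [|apply Rle_abs]. lra. }
    assert (Hxz : Cmod (xi - zn) <= 2 / t).
    { pose proof (Cmod_cay_plus1 xi zn hxi Hzn) as E. rewrite <- Ew in E. pose proof (Cmod_le_plus1 w U1) as L. fold t in L.
      pose proof (Cmod_ge_0 (xi - zn)). apply Rmult_le_reg_r with t; [lra|]. rewrite Rdiv_mul by lra. nra. }
    assert (HfB : Cmod (f zn - B zn) <= 8 * ep / t ^ 3).
    { eapply Rle_trans; [apply HN1|].
      apply Rle_trans with (ep * (2 / t) ^ 3).
      - apply Rmult_le_compat_l; [lra|]. apply pow_incr. split; [apply Cmod_ge_0|auto].
      - right. field. lra. }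
    assert (HGt : Cmod (G w + 1) <= (a + 2) * t).
    { replace (G w + 1)%C with ((G w - a * w) + (a * w + 1))%C by ring.
      eapply Rle_trans; [apply Cmod_triangle|].
      assert (Cmod (a * w + 1) <= a * t + 1).
      { eapply Rle_trans; [apply Cmod_triangle|]. rewrite Cmod_mult, Cmod_R, Cmod_1, Rabs_right by lra. unfold t. lra. }
      assert (Re w <= t) by (unfold t; eapply Rle_trans; [apply Rle_abs|apply re_le_Cmod]). lra. }
    pose proof (Cmod_cay_plus1 eta (B zn) Heta (HBd zn Hzn)) as E2. rewrite <- EG in E2.
    assert (HdB : c / t <= Cmod (eta - B zn)).
    { pose proof (Cmod_ge_0 (eta - B zn)). apply Rmult_le_reg_r with ((a + 2) * t); [nra|].
      replace (c / t * ((a + 2) * t)) with 2 by (unfold c; field; lra). nra. }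
    assert (Hdf : c / (2 * t) <= Cmod (eta - f zn)).
    { pose proof (Cmod_tri_sub eta (f zn) (B zn)) as T.
      assert (8 * ep / t ^ 3 <= c / (2 * t)).
      { apply Rmult_le_reg_r with (t ^ 3); [apply pow_lt; lra|].
        replace (8 * ep / t ^ 3 * t ^ 3) with (8 * ep) by (field; lra).
        replace (c / (2 * t) * t ^ 3) with (c / 2 * t ^ 2) by (field; lra).
        assert (1 <= t ^ 2) by (rewrite <- (pow1 2); apply pow_incr; lra).
        assert (c / 2 * 1 <= c / 2 * t ^ 2) by (apply Rmult_le_compat_l; lra). lra. }
      replace (c / t) with (c / (2 * t) + c / (2 * t)) in HdB by (field; lra). lra. }
    pose proof (cay_den eta _ Heta (Hfd zn Hzn)) as D1. pose proof (cay_den eta _ Heta (HBd zn Hzn)) as D2.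
    assert (ED : (F w - G w)%C = (2 * eta * (f zn - B zn) / ((eta - f zn) * (eta - B zn)))%C).
    { rewrite EF, EG. unfold cay. field. auto. }
    rewrite ED, Cmod_div, !Cmod_mult, Cmod_R, Rabs_right, Heta by (try apply Cmult_neq; auto; lra).
    assert (Hprod : c ^ 2 / (2 * t ^ 2) <= Cmod (eta - f zn) * Cmod (eta - B zn)).
    { replace (c ^ 2 / (2 * t ^ 2)) with (c / (2 * t) * (c / t)) by (field; lra).
      apply Rmult_le_compat; auto; left; apply Rdiv_lt_0_compat; lra. }
    assert (Hq0 : 0 < c ^ 2 / (2 * t ^ 2)) by (apply Rdiv_lt_0_compat; nra).
    apply Rle_trans with (2 * 1 * (8 * ep / t ^ 3) * / (c ^ 2 / (2 * t ^ 2)) * t).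
    - apply Rmult_le_compat_r; [lra|]. unfold Rdiv at 1. apply Rmult_le_compat.
      + pose proof (Cmod_ge_0 (f zn - B zn)). lra.
      + left. apply Rinv_0_lt_compat. lra.
      + lra.
      + apply Rinv_le_contravar; auto.
    - replace (2 * 1 * (8 * ep / t ^ 3) * / (c ^ 2 / (2 * t ^ 2)) * t) with (ep * (32 / c ^ 2)) by (field; lra).
      apply Rle_trans with (e * c ^ 2 / 32 * (32 / c ^ 2)).
      + apply Rmult_le_compat_r; auto. left. apply Rdiv_lt_0_compat; lra.
      + right. field. lra. }
  destruct (half_plane_rigidity F G Hq c0 S u HF HG HHq HFR HGR HFG' Hle Hc0 HcG HS HuS Hu HFGu)
    as [p [d [Hp [Hd Heq]]]].
  pose proof (icay_disk xi p hxi Hp) as Hz0. set (z0 := icay xi p) in *.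
  destruct (proj1 (continuous_C_CU _ _) (cderiv_cont _ _ _ (cay_deriv xi z0 hxi Hz0)) d Hd) as [d1 [Hd1 Hnear]].
  destruct (Copen_disk z0 Hz0) as [d2 [Hd2 Hin]].
  intros v Hv.
  assert (E : (f v - B v)%C = 0).
  { apply (identity_principle (fun v => (f v - B v)%C) z0 (Rmin d1 d2)); auto.
    - apply hol_minus; auto.
    - apply Rmin_glb_lt; auto.
    - intros w Hw. assert (Hw1 := Hnear w (Rlt_le_trans _ _ _ Hw (Rmin_l _ _))).
      assert (Hwd := Hin w (Rlt_le_trans _ _ _ Hw (Rmin_r _ _))).
      unfold z0 in Hw1. rewrite cay_icay in Hw1 by auto. destruct (Heq _ Hw1) as [_ E].
      unfold F, G, lift in E. rewrite icay_cay in E by auto.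
      apply (f_equal (icay eta)) in E. rewrite !icay_cay in E by auto. rewrite E. ring. }
  replace (f v) with (f v - B v + B v)%C by ring. rewrite E. ring.
Qed.
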